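(* Fix $n$. Given $\epsilon>0$, let $\mathcal H$ be the set of isometry classes of pointed metric spaces $(M,x)$, where $M$ is a properly convex projective $n$-manifold with the Hilbert metric and $x\in M$ satisfies $\operatorname{inj}(x)\ge\epsilon$. Then $\mathcal H$ is compact in the pointed Gromov-Hausdorff topology.
   Context: A subset of $\mathbb{RP}^n$ is properly convex if every line meets it in a connected set and its closure is contained in an affine patch (complement of a hyperplane). A properly convex projective $n$-manifold is $M=\Omega/\Gamma$ with $\Omega\subset\mathbb{RP}^n$ nonempty, open, properly convex and $\Gamma$ a discrete torsion-free group of projective transformations preserving $\Omega$. Its Hilbert metric is induced from $d_\Omega(a,b)=\log\frac{\|b-x\|\|a-y\|}{\|b-y\|\|a-x\|}$, where $x,y\in\partial\overline\Omega$ are the endpoints of the segment through $a,b$ ($a$ between $x$ and $b$). $\operatorname{inj}(x)$ is the supremum of radii of embedded metric balls in $M$ centered at $x$. *)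

(* Defs.v *)
From HB Require Import structures.
From mathcomp Require Import all_boot all_order all_algebra.
From mathcomp Require Import all_classical all_reals all_analysis.
From mathcomp Require Import lra.

Set Implicit Arguments.
Unset Strict Implicit.
Unset Printing Implicit Defensive.

Import Order.TTheory GRing.Theory Num.Theory.
Import numFieldNormedType.Exports.

Local Open Scope classical_set_scope.
Local Open Scope quotient_scope.
Local Open Scope ring_scope.

Section ScalarQuotient.
Context {R : realType} {V : normedModType R} (A : set V).
Implicit Types u v w : set_type A.

Definition proportional u v : bool :=
  `[< exists2 c : R, c != 0 & \val u = c *: \val v >].

Lemma proportional_equiv : equiv_class_of proportional.
Proof.
have psym u v : proportional u v -> proportional v u.
  move=> /asboolP[c c0 uv]; apply/asboolP; exists c^-1; first by rewrite invr_eq0.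
  by rewrite uv scalerK.
split=> [u|u v|v u w].
- by apply/asboolP; exists 1; rewrite ?oner_neq0// scale1r.
- by apply/idP/idP; exact: psym.
- move=> /asboolP[c c0 uv] /asboolP[d d0 vw]; apply/asboolP.
  by exists (c * d); rewrite ?mulf_neq0// uv vw scalerA.
Qed.

Canonical proportional_equiv_rel := EquivRelPack proportional_equiv.

(* The quotient of [A] by rescaling, with the quotient topology. *)
Definition scalar_quotient : Type := quotient_topology {eq_quot proportional}.

HB.instance Definition _ := Quotient.on scalar_quotient.
HB.instance Definition _ := Topological.on scalar_quotient.

Lemma scalar_quotientP u v :
  \pi_scalar_quotient u = \pi_scalar_quotient v <->
  exists2 c : R, c != 0 & \val u = c *: \val v.
Proof.
split=> [/(@eqmodP _ proportional_equiv_rel)/asboolP//|h].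
by apply/(@eqmodP _ proportional_equiv_rel)/asboolP.
Qed.

Lemma scalar_quotient_repr u :
  exists2 c : R, c != 0 & \val (repr (\pi_scalar_quotient u)) = c *: \val u.
Proof. by apply/scalar_quotientP; rewrite reprK. Qed.

End ScalarQuotient.

Section ProjectiveSpace.
Context {R : realType} {n : nat}.

Definition nonzero_vectors : set 'cV[R]_n.+1 := [set v | v != 0].

Definition RP : Type := scalar_quotient nonzero_vectors.
HB.instance Definition _ := Quotient.on RP.
HB.instance Definition _ := Topological.on RP.

Definition proj_class (v : 'cV[R]_n.+1) (v0 : v != 0) : RP :=
  \pi_RP (SigSub (mem_set v0 : v \in nonzero_vectors)).

(* Homogeneous coordinates, chosen up to a nonzero scalar. *)
Definition hcoord (p : RP) : 'cV[R]_n.+1 := \val (repr p).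

Lemma hcoord_neq0 p : hcoord p != 0.
Proof. exact: (set_mem (valP (repr p))). Qed.

Lemma hcoord_class v (v0 : v != 0) :
  exists2 c : R, c != 0 & hcoord (proj_class v0) = c *: v.
Proof. exact: scalar_quotient_repr. Qed.

Lemma proj_classP v w (v0 : v != 0) (w0 : w != 0) :
  proj_class v0 = proj_class w0 <-> exists2 c : R, c != 0 & v = c *: w.
Proof. exact: scalar_quotientP. Qed.

Lemma hcoordK p : proj_class (hcoord_neq0 p) = p.
Proof. by rewrite -[RHS]reprK; congr \pi; exact: val_inj. Qed.

Definition projective_line (p q : RP) : set RP :=
  [set r | exists s t : R, hcoord r = s *: hcoord p + t *: hcoord q].

(* For [u != 0], the complement of the hyperplane [u = 0]. *)
Definition affine_patch (u : 'rV[R]_n.+1) : set RP :=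
  [set p | (u *m hcoord p) 0 0 != 0].

(* The identification of [affine_patch u] with the affine hyperplane [u = 1]
   of R^(n+1). *)
Definition affine_coord (u : 'rV[R]_n.+1) (p : RP) : 'cV[R]_n.+1 :=
  ((u *m hcoord p) 0 0)^-1 *: hcoord p.

Definition properly_convex (X : set RP) : Prop :=
  (forall p q, p != q -> connected (projective_line p q `&` X)) /\
  (exists2 u : 'rV[R]_n.+1, u != 0 & closure X `<=` affine_patch u).

Definition boundary (X : set RP) : set RP := closure X `\` interior X.

Definition strictly_between (x y z : 'cV[R]_n.+1) : Prop :=
  exists t : R, 0 < t < 1 /\ y = (1 - t) *: x + t *: z.

(* The norm of ['cV[R]_n.+1] is the sup norm; the four differences below are
   parallel, so the value does not depend on the norm, nor on the affine patch
   containing the closure of [Omega]. *)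
Definition hilbert_dist (Omega : set RP) (a b : RP) : R :=
  if a == b then 0 else
  xget 0 [set d | exists u x y,
    let a' := affine_coord u a in let b' := affine_coord u b in
    let x' := affine_coord u x in let y' := affine_coord u y in
    [/\ u != 0 /\ closure Omega `<=` affine_patch u,
        boundary (closure Omega) x /\ boundary (closure Omega) y,
        strictly_between x' a' b', strictly_between a' b' y' &
        d = ln ((`|b' - x'| * `|a' - y'|) / (`|b' - y'| * `|a' - x'|))]].

End ProjectiveSpace.
Arguments RP : clear implicits.

Section ProjectiveGroup.
Context {R : realType} {n : nat}.

Definition invertible_matrices : set 'M[R]_n.+1 := [set g | g \in unitmx].

Definition PGL : Type := scalar_quotient invertible_matrices.
HB.instance Definition _ := Quotient.on PGL.
HB.instance Definition _ := Topological.on PGL.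

Definition pgl_class (A : 'M[R]_n.+1) (uA : A \in unitmx) : PGL :=
  \pi_PGL (SigSub (mem_set uA : A \in invertible_matrices)).

Definition pgl_mx (g : PGL) : 'M[R]_n.+1 := \val (repr g).

Lemma pgl_mx_unit g : pgl_mx g \in unitmx.
Proof. exact: (set_mem (valP (repr g))). Qed.

Lemma pgl_mx_class A (uA : A \in unitmx) :
  exists2 c : R, c != 0 & pgl_mx (pgl_class uA) = c *: A.
Proof. exact: scalar_quotient_repr. Qed.

Lemma pgl_classP A B (uA : A \in unitmx) (uB : B \in unitmx) :
  pgl_class uA = pgl_class uB <-> exists2 c : R, c != 0 & A = c *: B.
Proof. exact: scalar_quotientP. Qed.

Lemma pgl_mxK g : pgl_class (pgl_mx_unit g) = g.
Proof. by rewrite -[RHS]reprK; congr \pi; exact: val_inj. Qed.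

Lemma mulmx_unit (A B : 'M[R]_n.+1) :
  A \in unitmx -> B \in unitmx -> A *m B \in unitmx.
Proof. by move=> uA uB; rewrite unitmx_mul uA. Qed.

Lemma invmx_unit (A : 'M[R]_n.+1) : A \in unitmx -> invmx A \in unitmx.
Proof. by rewrite unitmx_inv. Qed.

Definition pgl_one : PGL := pgl_class (unitmx1 R n.+1).
Definition pgl_mul (g h : PGL) : PGL :=
  pgl_class (mulmx_unit (pgl_mx_unit g) (pgl_mx_unit h)).
Definition pgl_inv (g : PGL) : PGL := pgl_class (invmx_unit (pgl_mx_unit g)).

Lemma pgl_mulE A B (uA : A \in unitmx) (uB : B \in unitmx) :
  pgl_mul (pgl_class uA) (pgl_class uB) = pgl_class (mulmx_unit uA uB).
Proof.
apply/pgl_classP; have [c c0 ->] := pgl_mx_class uA.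
have [d d0 ->] := pgl_mx_class uB; exists (c * d); first by rewrite mulf_neq0.
by rewrite -scalemxAl -scalemxAr scalerA.
Qed.

Lemma pgl_invE A (uA : A \in unitmx) :
  pgl_inv (pgl_class uA) = pgl_class (invmx_unit uA).
Proof.
apply/pgl_classP; have [c c0 ->] := pgl_mx_class uA.
exists c^-1; first by rewrite invr_eq0.
by rewrite invmxZ// unitmxZ ?unitfE.
Qed.

Lemma pgl_mulA : associative pgl_mul.
Proof.
move=> g h k; rewrite -(pgl_mxK g) -(pgl_mxK h) -(pgl_mxK k) !pgl_mulE.
by apply/pgl_classP; exists 1; rewrite ?oner_neq0// scale1r mulmxA.
Qed.

Lemma pgl_mul1g : left_id pgl_one pgl_mul.
Proof.
move=> g; rewrite -(pgl_mxK g) pgl_mulE.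
by apply/pgl_classP; exists 1; rewrite ?oner_neq0// scale1r mul1mx.
Qed.

Lemma pgl_mulg1 : right_id pgl_one pgl_mul.
Proof.
move=> g; rewrite -(pgl_mxK g) pgl_mulE.
by apply/pgl_classP; exists 1; rewrite ?oner_neq0// scale1r mulmx1.
Qed.

Lemma pgl_mulVg : left_inverse pgl_one pgl_inv pgl_mul.
Proof.
move=> g; rewrite -(pgl_mxK g) pgl_invE pgl_mulE.
apply/pgl_classP; exists 1; rewrite ?oner_neq0//.
by rewrite scale1r mulVmx// pgl_mx_unit.
Qed.

Lemma pgl_mulgV : right_inverse pgl_one pgl_inv pgl_mul.
Proof.
move=> g; rewrite -(pgl_mxK g) pgl_invE pgl_mulE.
apply/pgl_classP; exists 1; rewrite ?oner_neq0//.
by rewrite scale1r mulmxV// pgl_mx_unit.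
Qed.

HB.instance Definition _ := isGroup.Build PGL
  pgl_mulA pgl_mul1g pgl_mulg1 pgl_mulVg pgl_mulgV.

Lemma mulmx_neq0 (A : 'M[R]_n.+1) (v : 'cV[R]_n.+1) :
  A \in unitmx -> v != 0 -> A *m v != 0.
Proof.
by move=> uA; apply: contraNneq => Av0; rewrite -(mulKmx uA v) Av0 mulmx0.
Qed.

Definition homography (g : PGL) (p : RP R n) : RP R n :=
  proj_class (mulmx_neq0 (pgl_mx_unit g) (hcoord_neq0 p)).

Lemma homographyE A v (uA : A \in unitmx) (v0 : v != 0) :
  homography (pgl_class uA) (proj_class v0) = proj_class (mulmx_neq0 uA v0).
Proof.
apply/proj_classP; have [c c0 ->] := pgl_mx_class uA.
have [d d0 ->] := hcoord_class v0; exists (c * d); first by rewrite mulf_neq0.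
by rewrite -scalemxAl -scalemxAr scalerA.
Qed.

Lemma homography1 p : homography 1%g p = p.
Proof.
rewrite -[p in LHS]hcoordK homographyE -[RHS]hcoordK.
by apply/proj_classP; exists 1; rewrite ?oner_neq0// scale1r mul1mx.
Qed.

Lemma homographyM (g h : PGL) p :
  homography (g * h)%g p = homography g (homography h p).
Proof.
rewrite -(pgl_mxK g) -(pgl_mxK h) -(hcoordK p).
rewrite [(_ * _)%g]pgl_mulE !homographyE.
by apply/proj_classP; exists 1; rewrite ?oner_neq0// scale1r mulmxA.
Qed.

End ProjectiveGroup.
Arguments PGL : clear implicits.

Record convex_manifold (R : realType) (n : nat) := ConvexManifold {
  domain : set (RP R n);
  holonomy : set (PGL R n);
  domain_neq0 : domain !=set0;
  domain_open : open domain;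
  domain_convex : properly_convex domain;
  holonomy_group : group_closed (mem holonomy);
  holonomy_discrete : holonomy `<=` isolated holonomy;
  holonomy_torsion_free : forall (g : PGL R n) (k : nat),
    holonomy g -> (0 < k)%N -> (g ^+ k)%g = 1%g -> g = 1%g;
  holonomy_domain : forall g, holonomy g -> homography g @` domain = domain
}.

Section ConvexManifold.
Context {R : realType} {n : nat} (M : convex_manifold R n).

Definition orbit (a : RP R n) : set (RP R n) :=
  [set homography g a | g in holonomy M].

(* The points of [M = Omega / Gamma] are the [Gamma]-orbits in [Omega]. *)
Definition points : set (set (RP R n)) := orbit @` domain M.

Definition quotient_dist (P Q : set (RP R n)) : R :=
  inf [set hilbert_dist (domain M) a b | a in P & b in Q].

(* The ball of radius [r] at [P] is embedded when the ball of radius [r] in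
   [Omega] centered at a lift of [P] injects into [M]. *)
Definition embedded_ball (P : set (RP R n)) (r : R) : Prop :=
  forall a, P a ->
    set_inj [set b | domain M b /\ hilbert_dist (domain M) a b < r] orbit.

Definition inj_radius (P : set (RP R n)) : \bar R :=
  ereal_sup [set r%:E | r in [set r | 0 < r /\ embedded_ball P r]].

End ConvexManifold.

(* Not based on [metricType]: the type of all [metricType]s lives in too large
   a universe to carry a topology. *)
Record pointed_metric_space (R : realType) := PointedMetricSpace {
  space : Type;
  basepoint : space;
  dist : space -> space -> R;
  dist_refl : forall x, dist x x = 0;
  dist_eq0 : forall x y, dist x y = 0 -> x = y;
  dist_sym : forall x y, dist x y = dist y x;
  dist_triangle : forall x y z, dist x z <= dist x y + dist y z
}.
Arguments space {R} _.
Arguments basepoint {R} _.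
Arguments dist {R} _ _ _.

HB.instance Definition _ (R : realType) := gen_eqMixin (pointed_metric_space R).
HB.instance Definition _ (R : realType) :=
  gen_choiceMixin (pointed_metric_space R).

Section GromovHausdorff.
Context {R : realType}.
Implicit Types X Y Z : pointed_metric_space R.

(* [rel] matches the balls of radius [1/e] around the basepoints with points
   of the other space and has distortion less than [e]. *)
Definition gh_close (e : R) X Y : Prop :=
  exists rel : space X -> space Y -> Prop,
  [/\ rel (basepoint X) (basepoint Y),
      forall a, dist X (basepoint X) a < e^-1 -> exists b, rel a b,
      forall b, dist Y (basepoint Y) b < e^-1 -> exists a, rel a b &
      forall a a' b b', rel a b -> rel a' b' ->
        `|dist X a a' - dist Y b b'| < e].

Definition gh_entourage :
    set_system (pointed_metric_space R * pointed_metric_space R) :=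
  [set E | exists2 e, 0 < e & forall X Y, gh_close e X Y -> E (X, Y)].

Lemma gh_close_le d e X Y : 0 < d -> d <= e -> gh_close d X Y -> gh_close e X Y.
Proof.
move=> d0 de [rel [b0 hX hY hd]].
have ed : e^-1 <= d^-1 by rewrite lef_pV2// posrE (lt_le_trans d0).
exists rel; split=> // [a ae|b be|a a' b b' ab ab'].
- exact/hX/(lt_le_trans ae).
- exact/hY/(lt_le_trans be).
- exact: lt_le_trans (hd _ _ _ _ ab ab') de.
Qed.

Lemma gh_close_refl e X : 0 < e -> gh_close e X X.
Proof.
move=> e0; exists eq; split=> //; try by move=> a; exists a.
by move=> a a' _ _ <- <-; rewrite subrr normr0.
Qed.

Lemma gh_close_sym e X Y : gh_close e X Y -> gh_close e Y X.
Proof.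
move=> [rel [b0 hX hY hd]]; exists (fun y x => rel x y); split=> //.
by move=> a a' b b' ab ab'; rewrite distrC; exact: hd.
Qed.

Lemma gh_close_trans d e X Y Z : 0 < d -> d + d <= e -> d + e^-1 <= d^-1 ->
  gh_close d X Y -> gh_close d Y Z -> gh_close e X Z.
Proof.
move=> d0 de dV [r [rb rX rY rd]] [s [sb sY sZ sd]].
have ed : e^-1 <= d^-1 by apply: le_trans dV; rewrite lerDr ltW.
exists (fun x z => exists2 y, r x y & s y z); split.
- by exists (basepoint Y).
- move=> a ae; have [b ab] := rX _ (lt_le_trans ae ed).
  have [|c bc] := sY b; last by exists c, b.
  apply: lt_le_trans dV; have := rd _ _ _ _ rb ab.
  by rewrite ltr_distlC => /andP[_ /lt_trans]; apply; rewrite addrC ltrD2l.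
- move=> c ce; have [b bc] := sZ _ (lt_le_trans ce ed).
  have [|a ab] := rY b; last by exists a, b.
  apply: lt_le_trans dV; have := sd _ _ _ _ sb bc; rewrite distrC.
  by rewrite ltr_distlC => /andP[_ /lt_trans]; apply; rewrite addrC ltrD2l.
- move=> a a' c c' [b ab bc] [b' ab' bc'].
  apply: le_lt_trans (ler_distD (dist Y b b') _ _) _.
  by apply: lt_le_trans de; apply: ltrD; [exact: rd|exact: sd].
Qed.

Lemma gh_entourage_filter : Filter gh_entourage.
Proof.
split; first by exists 1.
- move=> E F [d d0 dE] [e e0 eF].
  have m0 : 0 < Num.min d e by rewrite lt_min d0.
  exists (Num.min d e) => // X Y XY.
  by split; [apply: dE|apply: eF]; apply: gh_close_le XY => //;
    rewrite ge_min lexx ?orbT.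
- by move=> E F EF [e e0 eE]; exists e => // X Y /eE/EF.
Qed.

Lemma gh_entourage_diagonal E : gh_entourage E -> diagonal `<=` E.
Proof.
by move=> [e e0 eE] [X Y] /= XY; apply: eE; rewrite -[Y]XY; exact: gh_close_refl.
Qed.

Lemma gh_entourage_inv E : gh_entourage E -> gh_entourage (E^-1)%relation.
Proof. by move=> [e e0 eE]; exists e => // X Y /gh_close_sym/eE. Qed.

Lemma gh_entourage_split E : gh_entourage E ->
  exists2 F, gh_entourage F & (F \; F)%relation `<=` E.
Proof.
move=> [e e0 eE]; pose d := Num.min (e / 2) (1 / 2).
have d0 : 0 < d by rewrite lt_min !divr_gt0.
have de : d <= e / 2 by rewrite ge_min lexx.
have d2 : d <= 1 / 2 by rewrite ge_min lexx orbT.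
exists [set XY | gh_close d XY.1 XY.2]; first by exists d.
move=> [X Z] [Y /= XY YZ]; apply: eE; apply: gh_close_trans XY YZ => //.
  by rewrite [leRHS](splitr e) lerD.
have eV : e^-1 <= d^-1 / 2.
  rewrite -invfM lef_pV2 ?posrE ?mulr_gt0//.
  by rewrite -ler_pdivlMr.
have dV : d <= d^-1 / 2.
  have dd : d * d <= (1 / 2) * (1 / 2) by apply: ler_pM => //; exact: ltW.
  rewrite -invfM -[leRHS]mul1r ler_pdivlMr ?mulr_gt0// mulrA.
  by move: dd; lra.
by rewrite [leRHS]splitr lerD.
Qed.

HB.instance Definition _ := isUniform.Build (pointed_metric_space R)
  gh_entourage_filter gh_entourage_diagonal gh_entourage_inv gh_entourage_split.

Definition isometric X Y : bool :=
  `[< exists f : space X -> space Y, [/\ bijective f,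
        forall a b, dist Y (f a) (f b) = dist X a b &
        f (basepoint X) = basepoint Y] >].

Lemma isometric_equiv : equiv_class_of isometric.
Proof.
have sym X Y : isometric X Y -> isometric Y X.
  move=> /asboolP[f [[g fK gK] fd fb]]; apply/asboolP; exists g.
  split; first by exists f.
  - by move=> a b; rewrite -fd !gK.
  - by rewrite -fb fK.
split=> [X|X Y|Y X Z].
- by apply/asboolP; exists id; split=> //; exists id.
- by apply/idP/idP; exact: sym.
- move=> /asboolP[f [fb fd f0]] /asboolP[g [gb gd g0]]; apply/asboolP.
  exists (g \o f); split; first exact: bij_comp.
  + by move=> a b /=; rewrite gd fd.
  + by rewrite /= f0 g0.
Qed.

Canonical isometric_equiv_rel := EquivRelPack isometric_equiv.

(* Isometry classes of pointed metric spaces, with the pointed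
   Gromov-Hausdorff topology. *)
Definition isometry_class : Type := quotient_topology {eq_quot isometric}.

HB.instance Definition _ := Quotient.on isometry_class.
HB.instance Definition _ := Topological.on isometry_class.

End GromovHausdorff.
Arguments isometry_class : clear implicits.

Definition isometric_to_manifold {R : realType} {n : nat}
    (X : pointed_metric_space R) (M : convex_manifold R n)
    (P : set (RP R n)) : Prop :=
  exists f : set (RP R n) -> space X,
    [/\ set_bij (points M) [set: space X] f,
        {in points M &, forall Q S, dist X (f Q) (f S) = quotient_dist M Q S} &
        f P = basepoint X].

Section Realization.
Context {R : realType} {n : nat} (M : convex_manifold R n).

Lemma orbit_id a : orbit M a a.
Proof.
exists 1%g; last exact: homography1.
by have [/set_mem] := holonomy_group M.
Qed.

Lemma orbit_eq a b : orbit M a b -> orbit M b = orbit M a.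
Proof.
have [_ divM] := holonomy_group M; move=> [g Mg <-].
apply/seteqP; split=> _ [h Mh <-].
- rewrite -homographyM; exists (h * g)%g => //.
  by apply: set_mem; apply: (group_closedM (holonomy_group M)); exact: mem_set.
- exists (h * g^-1)%g; last by rewrite -homographyM -mulgA mulVg mulg1.
  by apply: set_mem; apply: divM; exact: mem_set.
Qed.

(* The universe of [space] is large enough to contain a copy of [M]. *)
Lemma isometric_to_manifold_ex P : points M P ->
  {in points M, forall Q, quotient_dist M Q Q = 0} ->
  {in points M &, forall Q S, quotient_dist M Q S = 0 -> Q = S} ->
  {in points M &, forall Q S, quotient_dist M Q S = quotient_dist M S Q} ->
  {in points M & &, forall Q S T,
    quotient_dist M Q T <= quotient_dist M Q S + quotient_dist M S T} ->
  exists X, isometric_to_manifold X M P.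
Proof.
move=> MP d0 deq0 dsym dtri.
have [p0 _ _] := MP.
pose lift (Q : set (RP R n)) : 'cV[R]_n.+1 := hcoord (xget p0 Q).
pose code (Q : set (RP R n)) : nat -> R := fun i => lift Q (inord i) 0.
have code_inj Q S : points M Q -> points M S -> code Q = code S -> Q = S.
  move=> [a Ma <-] [b Mb <-] ab.
  have /val_inj/(can_inj reprK) eqab : lift (orbit M a) = lift (orbit M b).
    apply/colP => i; move/(congr1 (fun f : nat -> R => f i)): ab.
    by rewrite /code inord_val.
  have liftP c : orbit M c (xget p0 (orbit M c)).
    by apply: xgetPex; exists c; exact: orbit_id.
  by rewrite -(orbit_eq (liftP a)) -(orbit_eq (liftP b)) eqab.
pose T := {f : nat -> R | exists2 Q, points M Q & code Q = f}.
pose decode (f : T) := s2val (cid2 (svalP f)).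
have decodeM f : points M (decode f) by exact: (s2valP (cid2 (svalP f))).
have decodeK f : code (decode f) = sval f by exact: (s2valP' (cid2 (svalP f))).
have decode_inj f g : decode f = decode g -> f = g.
  by move=> fg; apply: eq_sig_hprop => [? ? ?|]; [exact: Prop_irrelevance|];
    rewrite -!decodeK fg.
pose encode Q : T := if pselect (points M Q) is left MQ
  then exist _ (code Q) (ex_intro2 _ _ Q MQ erefl)
  else exist _ (code P) (ex_intro2 _ _ P MP erefl).
have encodeK Q : points M Q -> decode (encode Q) = Q.
  move=> MQ; apply: code_inj => //; rewrite decodeK /encode.
  by case: pselect.
have decM f : decode f \in points M by exact: mem_set.
exists (@PointedMetricSpace R T (encode P)
  (fun f g => quotient_dist M (decode f) (decode g))
  (fun f => d0 _ (decM f))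
  (fun f g h => decode_inj _ _ (deq0 _ _ (decM f) (decM g) h))
  (fun f g => dsym _ _ (decM f) (decM g))
  (fun f g h => dtri _ _ _ (decM f) (decM g) (decM h))).
exists encode; split => //=.
- split => // [Q S /set_mem MQ /set_mem MS QS|f _].
    by rewrite -(encodeK _ MQ) QS encodeK.
  by exists (decode f) => //; apply: decode_inj; rewrite encodeK.
- by move=> Q S /set_mem MQ /set_mem MS; rewrite !encodeK.
Qed.

End Realization.

(* The isometry classes of the pointed spaces [(M, P)] with [inj P >= eps]. *)
Definition thick_classes (R : realType) (n : nat) (eps : R) :
    set (isometry_class R) :=
  [set \pi_(isometry_class R) X | X in [set X : pointed_metric_space R |
    exists (M : convex_manifold R n) (P : set (RP R n)),
      [/\ points M P, (eps%:E <= inj_radius M P)%E &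
          isometric_to_manifold X M P]]].

(* Main.v *)
(* A pointed manifold M = Omega / Gamma is replaced by the open convex cone C in
   R^(n+1) over Omega and the group G of matrices lifting Gamma.  The order of C
   expresses the Hilbert metric: d(a, b) < r when a <= l b and b <= m a with
   l m < e^r.  The states of the based cone (C, e), that is the positive
   functionals f with f(e) = 1, contain a basis of almost maximal determinant;
   in these coordinates e = (1,...,1), C lies in the positive orthant, and by
   Hahn-Banach C contains a ball around e of radius depending only on n
   (Benzecri's compactness theorem).  So along an ultrafilter the normalized
   cones have an open properly convex limit, and the groups have a limit made of
   the invertible limits of their elements, since matrices that move e by a
   bounded amount are bounded.  A nontrivial element moves e by at least eps,
   which persists in the limit and makes the limit group discrete and torsion
   free.  All distances converge, uniformly on bounded sets because any family
   of counterexamples would itself have a limit.  *)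
From HB Require Import structures.
Require Import Defs.
From mathcomp Require Import all_boot all_order all_algebra.
From mathcomp Require Import all_classical all_reals all_analysis.
From mathcomp Require Import perm ring lra.

Set Implicit Arguments.
Unset Strict Implicit.
Unset Printing Implicit Defensive.

Import Order.TTheory GRing.Theory Num.Theory.
Import numFieldNormedType.Exports.

Local Open Scope classical_set_scope.
Local Open Scope quotient_scope.
Local Open Scope ring_scope.

(** * Limits of matrices along an ultrafilter *)

(** Compactness is proved for pointed spaces before passing to isometry classes; the ultrafilter
    lives on the type of pointed spaces, which also serves as the index type of all families. Every
    comparison is strict. Membership in an open cone and [hilbert_lt] pass from the limit to almost
    every index unchanged, while in the other direction a strict inequality may become an equality.
    That direction is paid for with a multiple of [ones] for cones and with [r < s] for distances.
    The delicate object is the group: a bounded family of matrices can converge to a singular one,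
    so a matrix and its inverse have to be bounded together, after rescaling the matrix; this is why
    a model carries all positive multiples of its matrices. The hypotheses of thickness are open
    conditions, so a relation satisfied only by a limit matrix, such as finite order modulo scalars,
    can be carried back to its approximants. The limit model has radius [rho / 2] instead of [rho],
    which is harmless because a manifold is rebuilt from a model of any radius. *)

Section MatrixTopology.
Context {R : realType} {p q : nat}.
Implicit Types (A : 'M[R]_(p, q)) (W : set 'M[R]_(p, q)).

Lemma nbhs_mxP A W : nbhs A W <->
  exists2 d : R, 0 < d & forall B : 'M[R]_(p, q), (forall i j, `|B i j - A i j| < d) -> W B.
Proof.
split.
- move=> /nbhs_ballP[d /= d0 dW]; exists d => // B AB; apply: dW.
  by split=> // i j; rewrite /ball/= distrC.
- move=> [d d0 dW]; apply/nbhs_ballP; exists d => // B [_ AB]; apply: dW => i j.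
  by have := AB i j; rewrite /ball/= distrC.
Qed.

End MatrixTopology.

Section MatrixLimit.
Context {R : realType} {T : Type} (U : set_system T) {UF : UltraFilter U}.

(** Entrywise convergence reduces every matrix limit to limits of real functions, and covers vectors
    as one-column matrices. *)
Definition mxlim p q (A_ : T -> 'M[R]_(p, q)) (A : 'M[R]_(p, q)) :=
  forall i j, (fun X => A_ X i j) @ U --> A i j.

Lemma mxlim_cst p q (A : 'M[R]_(p, q)) : mxlim (fun=> A) A.
Proof. by move=> i j; exact: cvg_cst. Qed.
Arguments mxlim_cst {p q} A.

Lemma mxlimD p q (A_ B_ : T -> 'M[R]_(p, q)) A B :
  mxlim A_ A -> mxlim B_ B -> mxlim (fun X => A_ X + B_ X) (A + B).
Proof.
move=> lA lB i j; rewrite mxE.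
rewrite [X in X @ _](_ : _ = (fun X => A_ X i j + B_ X i j)); last first.
  by apply/funext => X; rewrite mxE.
exact: cvgD.
Qed.

Lemma mxlimZ p q (c_ : T -> R) (c : R) (A_ : T -> 'M[R]_(p, q)) A :
  c_ @ U --> c -> mxlim A_ A -> mxlim (fun X => c_ X *: A_ X) (c *: A).
Proof.
move=> lc lA i j; rewrite mxE.
rewrite [X in X @ _](_ : _ = (fun X => c_ X * A_ X i j)); last first.
  by apply/funext => X; rewrite mxE.
exact: cvgM.
Qed.

Lemma mxlimB p q (A_ B_ : T -> 'M[R]_(p, q)) A B :
  mxlim A_ A -> mxlim B_ B -> mxlim (fun X => A_ X - B_ X) (A - B).
Proof.
move=> lA lB; apply: mxlimD => // i j; rewrite mxE.
rewrite [X in X @ _](_ : _ = (fun X => - B_ X i j)); last first.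
  by apply/funext => X; rewrite mxE.
exact: cvgN.
Qed.

Lemma mxlim_mul p q r (A_ : T -> 'M[R]_(p, q)) (B_ : T -> 'M[R]_(q, r)) A B :
  mxlim A_ A -> mxlim B_ B -> mxlim (fun X => A_ X *m B_ X) (A *m B).
Proof.
move=> lA lB i j; rewrite mxE.
rewrite [X in X @ _](_ : _ = (fun X => \sum_k A_ X i k * B_ X k j)); last first.
  by apply/funext => X; rewrite mxE.
apply: cvg_big => [|k _]; last exact: cvgM.
exact: add_continuous.
Qed.

Lemma mxlim_near p q (A_ : T -> 'M[R]_(p, q)) A (d : R) : 0 < d ->
  mxlim A_ A -> \forall X \near U, forall i j, `|A_ X i j - A i j| < d.
Proof.
move=> d0 lA; apply: filter_forall => i; apply: filter_forall => j.
have /cvgrPdist_lt/(_ _ d0) := lA i j.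
by apply: filterS => X; rewrite distrC.
Qed.

(** The image of an ultrafilter is an ultrafilter, here containing the compact segment [[-K, K]].
    This replaces every extraction of subsequences. *)
Lemma ultra_cvg_bounded (f : T -> R) (K : R) :
  (\forall X \near U, `|f X| <= K) -> exists l : R, f @ U --> l.
Proof.
move=> fK.
have UfF : UltraFilter (f @ U).
  split; first exact: fmap_proper_filter.
  move=> G PG UG; apply/seteqP; split=> // A GA.
  have [//|UnA] := in_ultra_setVsetC (f @^-1` A) UF.
  exfalso; apply: (@filter_not_empty _ G).
  by rewrite -(setICr A); apply: filterI => //; exact: UG.
have := @segment_compact R (- K) K; rewrite compact_ultra => /(_ (f @ U) UfF).
case=> [|l [_ /= lf]]; last by exists l.
by apply: filterS fK => X /=; rewrite in_itv/= ler_norml.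
Qed.

Lemma mxlim_bounded p q (A_ : T -> 'M[R]_(p, q)) (K : R) :
  (\forall X \near U, forall i j, `|A_ X i j| <= K) -> exists A, mxlim A_ A.
Proof.
move=> AK.
have /choice[l lP] : forall ij : 'I_p * 'I_q, exists l : R,
    (fun X => A_ X ij.1 ij.2) @ U --> l.
  move=> [i j]; apply: (@ultra_cvg_bounded _ K).
  by apply: filterS AK => X; exact.
by exists (\matrix_(i, j) l (i, j)) => i j; rewrite mxE; exact: (lP (i, j)).
Qed.

(** The dummy value [y0] is used at the indices without a witness, so that the choice is a total
    function. *)
Lemma near_choice (Y : Type) (y0 : Y) (P : T -> Y -> Prop) :
  (\forall X \near U, exists y, P X y) ->
  exists y_ : T -> Y, \forall X \near U, P X (y_ X).
Proof.
move=> h; have /choice[y_ yP] : forall X, exists y, (exists y, P X y) -> P X y.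
  move=> X; have [[y Py]|nP] := pselect (exists y, P X y); first by exists y.
  by exists y0.
by exists y_; apply: filterS h => X; exact: yP.
Qed.

(** The source of the arguments by contradiction: a property that does not hold near [U] fails at
    almost every index, so counterexamples can be chosen there and passed to the limit. *)
Lemma ultra_not (P : T -> Prop) :
  ~ (\forall X \near U, P X) -> \forall X \near U, ~ P X.
Proof. by have [//|] := in_ultra_setVsetC [set X | P X] UF. Qed.

End MatrixLimit.
Arguments mxlim_cst {R T U UF p q} A.

(** * Open cones and the Hilbert metric *)

Section Cones.
Context {R : realType} {n : nat}.
Local Notation V := 'cV[R]_n.+1.
Implicit Types (C : set V) (a b c v w : V) (r s : R).

(** Closure under sums together with [~ C 0] excludes pairs of opposite vectors. *)
Definition open_cone C : Prop :=
  [/\ open C, ~ C 0, forall v w, C v -> C w -> C (v + w) &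
      forall (k : R) v, 0 < k -> C v -> C (k *: v)].

(* [hilbert_lt C a b r] says that the Hilbert distance of the rays of [a] and
   [b] is less than [r]: that distance is the logarithm of the product of the
   least [l] with [a <= l b] and the least [m] with [b <= m a], in the order
   whose positive cone is the closure of [C]. *)
Definition hilbert_lt C a b r : Prop :=
  exists l m : R, [/\ 0 < l, 0 < m, C (l *: b - a), C (m *: a - b) &
    l * m < expR r].

Lemma hilbert_lt_sym C a b r : hilbert_lt C a b r -> hilbert_lt C b a r.
Proof. by move=> [l [m [? ? ? ?]]] lm; exists m, l; split; rewrite // mulrC. Qed.

Lemma hilbert_lt_le C a b r s : r <= s -> hilbert_lt C a b r -> hilbert_lt C a b s.
Proof.
move=> rs [l [m [l0 m0 Cl Cm lm]]]; exists l, m; split=> //.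
by rewrite (lt_le_trans lm)// ler_expR.
Qed.

Lemma open_cone_shrink C v w : open_cone C -> C v ->
  exists2 d : R, 0 < d & forall t, 0 < t < d -> C (v + t *: w).
Proof.
move=> [oC _ _ _] Cv; have /nbhs_mxP[d d0 dC] : nbhs v C by exact: open_nbhs_nbhs.
(* [K] dominates every coordinate of [w], and the summand 1 keeps it positive when [w = 0]. *)
pose K := 1 + \sum_i `|w i 0|.
have K0 : 0 < K by rewrite ltr_pwDl// sumr_ge0.
exists (d / K); first exact: divr_gt0.
move=> t /andP[t0 td]; apply: dC => i j; rewrite ord1 !mxE addrAC subrr add0r.
rewrite normrM gtr0_norm//; rewrite ltr_pdivlMr// in td; apply: le_lt_trans td.
rewrite ler_pM2l// /K (bigD1 i)//= addrCA lerDl addr_ge0// ?sumr_ge0//.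
Qed.

Section OpenCone.
Variables (C : set V) (cC : open_cone C).

Lemma open_coneD v w : C v -> C w -> C (v + w).
Proof. by case: cC => _ _ + _; apply. Qed.

Lemma open_coneZ (k : R) v : 0 < k -> C v -> C (k *: v).
Proof. by case: cC => _ _ _; apply. Qed.

Lemma open_cone0 : ~ C 0. Proof. by case: cC. Qed.

Lemma open_coneN v : C v -> ~ C (- v).
Proof. by move=> Cv /(open_coneD Cv); rewrite subrr; exact: open_cone0. Qed.

Lemma open_coneZ_gt0 (k : R) v : C v -> C (k *: v) -> 0 < k.
Proof.
move=> Cv Ckv; rewrite ltNge; apply/negP; rewrite le_eqVlt => /orP[/eqP k0|k0].
  by move: Ckv; rewrite k0 scale0r; exact: open_cone0.
apply: (open_coneN Ckv); rewrite -scaleNr; apply: open_coneZ => //.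
by rewrite oppr_gt0.
Qed.

(** The sum [m (l b - a) + (m a - b) = (l m - 1) b] lies in [C], which forces [l m > 1]. *)
Lemma hilbert_lt_gt0 a b r : C b -> hilbert_lt C a b r -> 0 < r.
Proof.
move=> Cb [l [m [l0 m0 Cl Cm lm]]]; rewrite -expR_gt1 -subr_gt0.
apply: (@lt_trans _ _ (l * m - 1)); last by rewrite ltrD2r.
apply: (open_coneZ_gt0 Cb).
have -> : (l * m - 1) *: b = m *: (l *: b - a) + (m *: a - b).
  by rewrite scalerBr scalerBl scale1r addrA subrK scalerA mulrC.
by apply: open_coneD => //; exact: open_coneZ.
Qed.

Lemma hilbert_lt_trans a b c r s :
  hilbert_lt C a b r -> hilbert_lt C b c s -> hilbert_lt C a c (r + s).
Proof.
move=> [l [m [l0 m0 Cl Cm lm]]] [l' [m' [l'0 m'0 Cl' Cm' lm']]].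
exists (l * l'), (m * m'); split; try exact: mulr_gt0.
- rewrite -(subrKA (l *: b)) -scalerA -scalerBr; apply: open_coneD => //.
  exact: open_coneZ.
- rewrite -(subrKA (m' *: b)) [m * m']mulrC -scalerA -scalerBr.
  by apply: open_coneD => //; exact: open_coneZ.
- rewrite mulrACA expRD; apply: ltr_pM => //; exact/ltW/mulr_gt0.
Qed.

(** Rescaling the vectors by [k] and [k'] replaces [l] by [l k / k'] and [m] by [m k' / k], with the
    same product; hence the distance is one of rays. *)
Lemma hilbert_lt_scale (k k' : R) a b r : 0 < k -> 0 < k' ->
  hilbert_lt C (k *: a) (k' *: b) r <-> hilbert_lt C a b r.
Proof.
have scl (k1 k2 : R) a1 b1 : 0 < k1 -> 0 < k2 ->
    hilbert_lt C a1 b1 r -> hilbert_lt C (k1 *: a1) (k2 *: b1) r.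
  move=> k10 k20 [l [m [l0 m0 Cl Cm lm]]].
  exists (l * k1 / k2), (m * k2 / k1); split; try by rewrite divr_gt0// mulr_gt0.
  - by rewrite scalerA mulfVK ?gt_eqF// mulrC -scalerA -scalerBr; exact: open_coneZ.
  - by rewrite scalerA mulfVK ?gt_eqF// mulrC -scalerA -scalerBr; exact: open_coneZ.
  - by have -> : l * k1 / k2 * (m * k2 / k1) = l * m;
      [field; rewrite !gt_eqF|].
move=> k0 k'0; split; last exact: scl.
move=> h; rewrite -(scalerK (lt0r_neq0 k0) a) -(scalerK (lt0r_neq0 k'0) b).
by apply: scl; rewrite ?invr_gt0.
Qed.

Lemma hilbert_lt_refl a r : 0 < r -> C a -> hilbert_lt C a a r.
Proof.
(* Any [l > 1] with [l * l < expR r] would do; this one gives [l * l = expR (r / 2)]. *)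
move=> r0 Ca; pose l := expR (r / 4).
have l1 : 1 < l by rewrite expR_gt1 divr_gt0.
exists l, l; split; rewrite ?expR_gt0//.
- by rewrite -[X in _ - X]scale1r -scalerBl; apply: open_coneZ => //; rewrite subr_gt0.
- by rewrite -[X in _ - X]scale1r -scalerBl; apply: open_coneZ => //; rewrite subr_gt0.
- by rewrite -expRD ltr_expR; lra.
Qed.

End OpenCone.

Lemma hilbert_lt_map C (A : 'M[R]_n.+1) a b r : (forall v, C v -> C (A *m v)) ->
  hilbert_lt C a b r -> hilbert_lt C (A *m a) (A *m b) r.
Proof.
move=> AC [l [m [l0 m0 Cl Cm lm]]]; exists l, m; split=> //.
- by rewrite scalemxAr -mulmxBr; exact: AC.
- by rewrite scalemxAr -mulmxBr; exact: AC.
Qed.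

Definition ones : V := const_mx 1.

(* Benzecri's normal form of an open cone based at [ones]. *)
Definition positive_cone (rho : R) C : Prop :=
  [/\ 0 < rho, open_cone C, forall v, C v -> forall i, 0 < v i 0 &
      forall v, (forall i, `|v i 0| < rho) -> C (ones + v)].

Section PositiveCone.
Variables (rho : R) (C : set V) (pC : positive_cone rho C).

Lemma positive_coneW : open_cone C. Proof. by case: pC. Qed.

Lemma positive_cone_gt0 v i : C v -> 0 < v i 0.
Proof. by case: pC => _ _ h _ Cv; exact: h. Qed.

Lemma positive_cone_near v (d : R) : (forall i, `|v i 0| < rho * d) ->
  C (d *: ones + v).
Proof.
have [rho0 cC _ ball] := pC => hv.
(* The hypothesis at coordinate 0 already forces [d] to be positive. *)
have d0 : 0 < d by rewrite -(pmulr_rgt0 _ rho0) (le_lt_trans _ (hv 0)).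
have -> : d *: ones + v = d *: (ones + d^-1 *: v).
  by rewrite scalerDr scalerA mulfV ?scale1r// gt_eqF.
apply: open_coneZ => //; apply: ball => i; rewrite mxE normrM gtr0_norm ?invr_gt0//.
by rewrite mulrC ltr_pdivrMr.
Qed.

Lemma positive_cone_ones (d : R) : 0 < d -> C (d *: ones).
Proof.
have [rho0 _ _ _] := pC; move=> d0; rewrite -[_ *: _]addr0; apply: positive_cone_near => i.
by rewrite mxE normr0 mulr_gt0.
Qed.

Lemma positive_cone_lower v : C v -> exists2 d : R, 0 < d & C (v - d *: ones).
Proof.
move=> /(open_cone_shrink (- ones) positive_coneW)[d d0 dC].
exists (d / 2); first exact: divr_gt0.
by rewrite -scalerN; apply: dC; apply/andP; split; lra.
Qed.

Lemma positive_cone_upper v : exists2 d : R, 0 < d & C (d *: ones - v).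
Proof.
have [rho0 _ _ _] := pC.
have S0 : 0 <= \sum_i `|v i 0| by rewrite sumr_ge0.
exists ((1 + \sum_i `|v i 0|) / rho); first by rewrite divr_gt0// ltr_pwDl.
apply: positive_cone_near => i; rewrite mxE normrN mulrC divfK ?gt_eqF//.
by rewrite (bigD1 i)//= addrCA ltrDl ltr_pwDl// sumr_ge0.
Qed.

(** The vectors [ones] plus or minus [rho / 2] times a basis vector lie in [C], so their images have
    positive coordinates; as [A *m ones] has coordinates below [K], this bounds each entry. Maps
    that move [ones] by a bounded amount thus form a bounded set of matrices. *)
Lemma positive_cone_entries (A : 'M[R]_n.+1) (K : R) :
  (forall v, C v -> C (A *m v)) -> C (K *: ones - A *m ones) ->
  forall i j, `|A i j| <= 2 * K / rho.
Proof.
have [rho0 _ _ ball] := pC => AC CK i j.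
have Cd (s : R) : `|s| = 1 -> C (ones + (s * (rho / 2)) *: delta_mx j 0).
  move=> s1; apply: ball => k; rewrite !mxE eqxx andbT normrM normrM s1 mul1r.
  rewrite (gtr0_norm (divr_gt0 rho0 _))//.
  by case: (k == j); rewrite ?normr1 ?normr0; lra.
have Ad (s : R) : `|s| = 1 -> 0 < K + s * (rho / 2) * A i j.
  move=> s1; have := positive_cone_gt0 i
    (open_coneD positive_coneW CK (AC _ (Cd s s1))).
  by rewrite mulmxDr addrA subrK -scalemxAr -colE !mxE mulr1.
have := Ad 1 (normr1 _); have := Ad (-1) (normrN1 _).
rewrite mul1r mulN1r mulNr mulrC => h1 h2.
have hr : 0 < rho / 2 by lra.
have -> : 2 * K / rho = K / (rho / 2) by field; rewrite gt_eqF.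
rewrite ler_pdivlMr// -{1}(gtr0_norm hr) -normrM ler_norml lerNl -subr_ge0.
by rewrite opprK (ltW h2) /= -subr_ge0 (ltW h1).
Qed.

End PositiveCone.
End Cones.

(** * Limits of cones *)

Section ConeLimit.
Context {R : realType} {n : nat} {T : Type} (U : set_system T).
Context {UF : UltraFilter U}.
Local Notation V := 'cV[R]_n.+1.
Local Notation ones := (@ones R n).
Implicit Types C : set V.

(** The first half says that points of the limit eventually belong to the cones, the second that
    limits of points of the cones lie in the closure of [C]. Closure is expressed by pushing a
    vector inside along [ones]. *)
Definition cone_lim (C_ : T -> set V) C : Prop :=
  (forall (v_ : T -> V) v, mxlim U v_ v -> C v -> \forall X \near U, C_ X (v_ X)) /\
  (forall (v_ : T -> V) v (d : R), 0 < d -> mxlim U v_ v ->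
     (\forall X \near U, C_ X (v_ X)) -> C (v + d *: ones)).

(** The margin [d] is the same for almost all indices, which is what makes the limit open. *)
Definition limit_cone (C_ : T -> set V) : set V :=
  [set v | exists2 d : R, 0 < d & \forall X \near U, C_ X (v - d *: ones)].

Lemma limit_cone_positive (rho : R) (C_ : T -> set V) : (forall X, positive_cone rho (C_ X)) ->
  positive_cone (rho / 2) (limit_cone C_).
Proof.
move=> pC; have [X0 _] := filter_ex (@filterT _ U _).
have [rho0 _ _ _] := pC X0; split; first exact: divr_gt0.
- split.
  + rewrite openE => v [d d0 Cd]; apply/nbhs_mxP.
    (* One half of the margin absorbs [w - v], the other half remains as the margin of [w]. *)
    exists (rho * (d / 2)); first by rewrite mulr_gt0// divr_gt0.
    move=> w wv; exists (d / 2); first exact: divr_gt0.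
    apply: filterS Cd => X Cd.
    have -> : w - (d / 2) *: ones = v - d *: ones + ((d / 2) *: ones + (w - v)).
      by apply/colP => i; rewrite !mxE; lra.
    apply: (open_coneD (positive_coneW (pC X)) Cd).
    by apply: (positive_cone_near (pC X)) => i; have := wv i 0; rewrite !mxE.
  + move=> [d d0 Cd]; have [X CX] := filter_ex Cd.
    by have := positive_cone_gt0 (pC X) 0 CX; rewrite !mxE; lra.
  + move=> v w [d d0 Cv] [d' d'0 Cw]; exists (d + d'); first exact: addr_gt0.
    apply: filterS2 Cv Cw => X Cv Cw; rewrite scalerDl opprD addrACA.
    exact: (open_coneD (positive_coneW (pC X))).
  + move=> k v k0 [d d0 Cv]; exists (k * d); first exact: mulr_gt0.
    apply: filterS Cv => X Cv; rewrite -scalerA -scalerBr.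
    exact: (open_coneZ (positive_coneW (pC X))).
- move=> v [d d0 Cd] i; have [X CX] := filter_ex Cd.
  by have := positive_cone_gt0 (pC X) i CX; rewrite !mxE; lra.
(* Half of [ones] is spent on the margin; around the other half the ball of radius [rho] scales down
   to [rho / 2]. *)
- move=> v hv; exists (1 / 2); first by rewrite divr_gt0.
  apply: nearW => X.
  have -> : ones + v - (1 / 2) *: ones = (1 / 2 : R) *: ones + v.
    by apply/colP => i; rewrite !mxE; lra.
  by apply: (positive_cone_near (pC X)) => i; have := hv i; lra.
Qed.

Lemma limit_coneP (rho : R) (C_ : T -> set V) : (forall X, positive_cone rho (C_ X)) ->
  cone_lim C_ (limit_cone C_).
Proof.
move=> pC; have [X0 _] := filter_ex (@filterT _ U _).
have [rho0 _ _ _] := pC X0; split.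
- move=> v_ v vv [d d0 Cd]; apply: filterS2 Cd (mxlim_near (mulr_gt0 rho0 d0) vv) => X Cd vX.
  have -> : v_ X = v - d *: ones + (d *: ones + (v_ X - v)).
    by apply/colP => i; rewrite !mxE; lra.
  apply: (open_coneD (positive_coneW (pC X)) Cd).
  by apply: (positive_cone_near (pC X)) => i; have := vX i 0; rewrite !mxE.
- move=> v_ v d d0 vv CX; exists (d / 2); first exact: divr_gt0.
  have d20 : 0 < d / 2 by exact: divr_gt0.
  apply: filterS2 CX (mxlim_near (mulr_gt0 rho0 d20) vv) => X CX vX.
  have -> : v + d *: ones - (d / 2) *: ones = v_ X + ((d / 2) *: ones + (v - v_ X)).
    by apply/colP => i; rewrite !mxE; lra.
  apply: (open_coneD (positive_coneW (pC X)) CX).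
  by apply: (positive_cone_near (pC X)) => i; have := vX i 0; rewrite !mxE distrC.
Qed.

(** Viewing the limit as a constant family lets the same lemmas compare the family with its limit in
    both directions. *)
Lemma cone_lim_cst (rho : R) C : positive_cone rho C -> cone_lim (fun=> C) C.
Proof.
move=> pC; have [rho0 [oC _ _ _] _ _] := pC; split.
- move=> v_ v vv Cv; have /nbhs_mxP[d d0 dC] := open_nbhs_nbhs (conj oC Cv).
  by apply: filterS (mxlim_near d0 vv) => X; exact: dC.
- move=> v_ v d d0 vv CX.
  have [X [CX' vX]] := filter_ex (filterI CX (mxlim_near (mulr_gt0 rho0 d0) vv)).
  have -> : v + d *: ones = v_ X + (d *: ones + (v - v_ X)).
    by apply/colP => i; rewrite !mxE; lra.
  apply: (open_coneD (positive_coneW pC) CX').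
  by apply: (positive_cone_near pC) => i; have := vX i 0; rewrite !mxE distrC.
Qed.

Section Limits.
Variables (rho : R) (C_ : T -> set V) (C : set V).
Hypotheses (pC_ : forall X, positive_cone rho (C_ X)) (lC : cone_lim C_ C).
Variables (rho' : R) (pC : positive_cone rho' C).
Variables (a_ b_ : T -> V) (a b : V).
Hypotheses (la : mxlim U a_ a) (lb : mxlim U b_ b).

(** The constants [l] and [m] of the limit can be kept, since membership in the open cone is
    stable. *)
Lemma hilbert_lt_lim r : hilbert_lt C a b r ->
  \forall X \near U, hilbert_lt (C_ X) (a_ X) (b_ X) r.
Proof.
move=> [l [m [l0 m0 Cl Cm lm]]]; have [L1 _] := lC.
have cl : mxlim U (fun X => l *: b_ X - a_ X) (l *: b - a).
  by apply: mxlimB => //; apply: mxlimZ => //; exact: cvg_cst.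
have cm : mxlim U (fun X => m *: a_ X - b_ X) (m *: a - b).
  by apply: mxlimB => //; apply: mxlimZ => //; exact: cvg_cst.
by apply: filterS2 (L1 _ _ cl Cl) (L1 _ _ cm Cm) => X ? ?; exists l, m.
Qed.

(* A limit of nonnegative vectors is nonnegative, so adding any positive
   vector brings it into the open cone. *)
Lemma cone_lim_add (v_ : T -> V) v w : mxlim U v_ v ->
  (\forall X \near U, C_ X (v_ X)) -> C w -> C (v + w).
Proof.
move=> lv CX Cw; have [d d0 Cd] := positive_cone_lower pC Cw.
rewrite -(subrK (d *: ones) w) addrCA; apply: (open_coneD (positive_coneW pC) Cd).
exact: (lC.2 _ _ _ d0 lv CX).
Qed.

(** Coordinate 0 is positive on the cones, so [l_ X] exceeds the quotient of the coordinates of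
    [x_ X] and [y_ X]; eventually the numerator is above half of its limit and the denominator below
    twice its limit. *)
Lemma coord_ratio_lower (l_ : T -> R) (x_ y_ : T -> V) (x y : V) :
  mxlim U x_ x -> mxlim U y_ y -> C x -> C y ->
  (\forall X \near U, C_ X (l_ X *: y_ X - x_ X)) ->
  exists2 c : R, 0 < c & \forall X \near U, c < l_ X.
Proof.
move=> lx ly Cx Cy Cl.
have x0 := positive_cone_gt0 pC 0 Cx; have y0 := positive_cone_gt0 pC 0 Cy.
exists (x 0 0 / 2 / (2 * y 0 0)); first by rewrite !divr_gt0// mulr_gt0.
have x20 : 0 < x 0 0 / 2 by rewrite divr_gt0.
apply: filterS2 Cl (filterI (mxlim_near x20 lx) (mxlim_near y0 ly)) => X.
move=> /(positive_cone_gt0 (pC_ X) 0); rewrite !mxE => h [/(_ 0 0) hx /(_ 0 0) hy].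
rewrite ltr_pdivrMr ?mulr_gt0//; move: hx hy; rewrite !ltr_distl.
move=> /andP[hx _] /andP[hy1 hy2].
have l0 : 0 < l_ X.
  rewrite ltNge; apply/negP => l0.
  have : l_ X * y_ X 0 0 <= 0 by rewrite mulr_le0_ge0//; lra.
  by lra.
have : l_ X * y_ X 0 0 <= l_ X * (2 * y 0 0) by rewrite ler_pM2l//; lra.
by lra.
Qed.

(** Each of [l_] and [m_] is bounded below and their product is bounded above, so both are bounded
    and converge. The limits satisfy only weak inequalities, and the gap between [r] and [s] leaves
    room to enlarge them to strict ones. *)
Lemma lim_hilbert_lt r s : C a -> C b ->
  (\forall X \near U, hilbert_lt (C_ X) (a_ X) (b_ X) r) -> r < s ->
  hilbert_lt C a b s.
Proof.
move=> Ca Cb h rs.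
have : \forall X \near U, exists lm : R * R, [/\ 0 < lm.1, 0 < lm.2,
    C_ X (lm.1 *: b_ X - a_ X), C_ X (lm.2 *: a_ X - b_ X) &
    lm.1 * lm.2 < expR r].
  by apply: filterS h => X [l [m ?]]; exists (l, m).
move=> /(near_choice (0 : R * R))[lm_ hlm].
pose l_ X := (lm_ X).1; pose m_ X := (lm_ X).2.
have hl : \forall X \near U, C_ X (l_ X *: b_ X - a_ X).
  by apply: filterS hlm => X [].
have hm : \forall X \near U, C_ X (m_ X *: a_ X - b_ X).
  by apply: filterS hlm => X [].
have hp : \forall X \near U, l_ X * m_ X < expR r.
  by apply: filterS hlm => X [].
have [c c0 cl] := coord_ratio_lower la lb Ca Cb hl.
have [c' c'0 cm] := coord_ratio_lower lb la Cb Ca hm.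
have e0 := expR_gt0 r.
have bnd (c1 : R) (x_ y_ : T -> R) : 0 < c1 -> (\forall X \near U, c1 < y_ X) ->
    (\forall X \near U, 0 < x_ X) -> (\forall X \near U, x_ X * y_ X < expR r) ->
    \forall X \near U, `|x_ X| <= expR r / c1.
  move=> c10 hy hx hxy; apply: filterS3 hy hx hxy => X hy hx hxy.
  rewrite gtr0_norm// ler_pdivlMr//; apply: ltW; apply: le_lt_trans hxy.
  by rewrite ler_pM2l// ltW.
have pl : \forall X \near U, 0 < l_ X by apply: filterS hlm => X [].
have pm : \forall X \near U, 0 < m_ X by apply: filterS hlm => X [].
have [l ll] := ultra_cvg_bounded (bnd _ _ _ c'0 cm pl hp).
have hp' : \forall X \near U, m_ X * l_ X < expR r.
  by apply: filterS hp => X; rewrite mulrC.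
have [m lm] := ultra_cvg_bounded (bnd _ _ _ c0 cl pm hp').
have l0 : 0 <= l.
  by apply: (cvgr_to_ge ll); apply: filterS pl => X /ltW.
have m0 : 0 <= m.
  by apply: (cvgr_to_ge lm); apply: filterS pm => X /ltW.
have lmr : l * m <= expR r.
  apply: (cvgr_to_le (cvgM ll lm)); apply: filterS hp => X /ltW//.
have rs' : expR r < expR s by rewrite ltr_expR.
(* As [eta <= 1], the product [(l + eta) * (m + eta)] is at most [l * m + eta * D], and [eta * D] is
   kept below [expR s - expR r]. *)
pose D := l + m + 1; have D0 : 0 < D by rewrite /D; lra.
pose eta := Num.min 1 ((expR s - expR r) / D / 2).
have eta0 : 0 < eta by rewrite lt_min ltr01 !divr_gt0// subr_gt0.
have eta1 : eta <= 1 by rewrite ge_min lexx.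
have etaD : eta * D < expR s - expR r.
  apply: (@le_lt_trans _ _ ((expR s - expR r) / D / 2 * D)).
    by rewrite ler_pM2r// ge_min lexx orbT.
  rewrite mulrAC divfK ?gt_eqF//; lra.
exists (l + eta), (m + eta); split; try by lra.
- rewrite scalerDl addrAC; apply: (cone_lim_add _ hl).
    by apply: mxlimB => //; exact: mxlimZ.
  exact: (open_coneZ (positive_coneW pC) eta0 Cb).
- rewrite scalerDl addrAC; apply: (cone_lim_add _ hm).
    by apply: mxlimB => //; exact: mxlimZ.
  exact: (open_coneZ (positive_coneW pC) eta0 Ca).
- have : eta * eta <= eta * 1 by rewrite ler_pM2l.
  move: etaD; rewrite /D mulrDr mulr1 mulrDr => etaD eta2.
  have -> : (l + eta) * (m + eta) = l * m + (eta * l + eta * m + eta * eta).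
    by ring.
  by move: etaD eta2 lmr; lra.
Qed.

End Limits.
End ConeLimit.

(** * Limits of matrix groups *)

Section MatrixLimitInv.
Context {R : realType} {T : Type} (U : set_system T) {UF : UltraFilter U}.

Lemma mxlim_det m (A_ : T -> 'M[R]_m) (A : 'M[R]_m) :
  mxlim U A_ A -> (fun X => \det (A_ X)) @ U --> \det A.
Proof.
move=> lA; apply: cvg_big => [|s _]; first exact: add_continuous.
apply: cvgM; first exact: cvg_cst.
by apply: cvg_big => [|i _]; [exact: mul_continuous|exact: lA].
Qed.

Lemma mxlim_adj m (A_ : T -> 'M[R]_m) (A : 'M[R]_m) :
  mxlim U A_ A -> mxlim U (fun X => \adj (A_ X)) (\adj A).
Proof.
move=> lA i j; rewrite mxE.
rewrite [X in X @ _](_ : _ = (fun X => cofactor (A_ X) j i)); last first.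
  by apply/funext => X; rewrite mxE.
apply: cvgM; first exact: cvg_cst.
apply: mxlim_det => k l; rewrite !mxE.
rewrite [X in X @ _](_ : _ = (fun X => A_ X (lift j k) (lift i l))) //.
by apply/funext => X; rewrite !mxE.
Qed.

Lemma mxlim_near_unit m (A_ : T -> 'M[R]_m) (A : 'M[R]_m) :
  mxlim U A_ A -> A \in unitmx -> \forall X \near U, A_ X \in unitmx.
Proof.
move=> /mxlim_det lA; rewrite unitmxE unitfE -normr_gt0 => d0.
have /cvgrPdist_lt/(_ _ d0) := lA; apply: filterS => X.
rewrite unitmxE unitfE; apply: contraTneq => ->.
by rewrite subr0 ltxx.
Qed.

Lemma mxlim_inv m (A_ : T -> 'M[R]_m) (A : 'M[R]_m) : mxlim U A_ A ->
  A \in unitmx -> mxlim U (fun X => invmx (A_ X)) (invmx A).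
Proof.
move=> lA uA i j; rewrite [invmx A]/invmx uA.
have l : mxlim U (fun X => (\det (A_ X))^-1 *: \adj (A_ X)) ((\det A)^-1 *: \adj A).
  apply: mxlimZ; last exact: mxlim_adj.
  by apply: cvgV; [rewrite -unitfE -unitmxE|exact: mxlim_det].
apply: cvg_trans (l i j); apply: near_eq_cvg.
apply: filterS (mxlim_near_unit lA uA) => X uX.
by rewrite /invmx uX.
Qed.

Lemma mxlim_near_eq p q (A_ B_ : T -> 'M[R]_(p, q)) A B :
  mxlim U A_ A -> mxlim U B_ B -> (\forall X \near U, A_ X = B_ X) -> A = B.
Proof.
move=> lA lB AB; apply/matrixP => i j.
apply: (@norm_cvg_unique _ _ ((fun X => A_ X i j) @ U) _ _ _ (lA i j)).
apply: cvg_trans (lB i j); apply: near_eq_cvg.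
by apply: filterS AB => X ->.
Qed.

Lemma mxlim_scalar m (A_ : T -> 'M[R]_m.+1) (A : 'M[R]_m.+1) : mxlim U A_ A ->
  (\forall X \near U, exists c : R, A_ X = c%:M) -> exists c : R, A = c%:M.
Proof.
move=> lA h; exists (A 0 0).
have l2 : mxlim U (fun X => (A_ X 0 0)%:M) ((A 0 0)%:M : 'M[R]_m.+1).
  move=> i j; rewrite mxE -mulr_natr.
  rewrite [X in X @ _](_ : _ = (fun X => A_ X 0 0 * (i == j)%:R)).
    by apply: cvgM => //; exact: cvg_cst.
  by apply/funext => X; rewrite mxE mulr_natr.
apply: (mxlim_near_eq lA l2); apply: filterS h => X [c ->].
by rewrite mxE eqxx.
Qed.

End MatrixLimitInv.

(** * Models of pointed manifolds and their limits *)

Section Models.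
Context {R : realType} {n : nat}.
Local Notation V := 'cV[R]_n.+1.
Local Notation ones := (@ones R n).
Implicit Types (C : set V) (G : set 'M[R]_n.+1).

(** Positive scalars are included so that the representative of a projective map may be rescaled
    freely, as bounding a family of matrices requires. *)
Definition matrix_group G : Prop :=
  [/\ forall A, G A -> A \in unitmx, forall c : R, 0 < c -> G c%:M,
      forall A B, G A -> G B -> G (A *m B) & forall A, G A -> G (invmx A)].

Definition preserves C G : Prop := forall A v, G A -> C v -> C (A *m v).

(** The embedded ball of radius [eps] at the basepoint, seen upstairs. Freeness of the action is
    built in: the conclusion says that [A] is projectively trivial, not merely that it fixes the ray
    of [b]. *)
Definition thick (eps : R) C G : Prop := forall A b, G A -> C b ->
  hilbert_lt C ones b eps -> hilbert_lt C ones (A *m b) eps ->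
  exists c : R, A = c%:M.

Definition torsion_free G : Prop := forall A k, G A -> (0 < k)%N ->
  (exists c : R, A ^+ k = c%:M) -> exists c : R, A = c%:M.

(* A cone in normal form, together with the positive multiples of the matrices
   of a group of projective maps, describing a pointed manifold [(M, x)] with
   [inj x >= eps]. *)
Definition model (rho eps : R) C G : Prop :=
  [/\ positive_cone rho C, matrix_group G, preserves C G, thick eps C G &
      torsion_free G].

Definition quotient_lt C G (a b : V) (r : R) : Prop :=
  exists2 A, G A & hilbert_lt C a (A *m b) r.

Lemma matrix_groupX G A k : matrix_group G -> G A -> G (A ^+ k).
Proof.
move=> [_ G1 GM _] GA; elim: k => [|k IH]; first by rewrite expr0; exact: G1.
by rewrite exprS -mulmxE; exact: GM.
Qed.

Lemma matrix_groupZ G A (c : R) : matrix_group G -> G A -> 0 < c -> G (c *: A).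
Proof. by move=> [_ G1 GM _] GA c0; rewrite -mul_scalar_mx; apply: GM => //; exact: G1. Qed.

End Models.

Section GroupLimit.
Context {R : realType} {n : nat} {T : Type} (U : set_system T).
Context {UF : UltraFilter U}.
Local Notation V := 'cV[R]_n.+1.
Local Notation ones := (@ones R n).
Implicit Types (C : set V) (G : set 'M[R]_n.+1).

(** Chabauty convergence of closed subgroups: each element of [G] is approximated, and each
    invertible limit of elements belongs to [G]. *)
Definition group_lim (G_ : T -> set 'M[R]_n.+1) G : Prop :=
  (forall A, G A -> exists2 A_ : T -> 'M[R]_n.+1, mxlim U A_ A &
     \forall X \near U, G_ X (A_ X)) /\
  (forall A_ A, mxlim U A_ A -> A \in unitmx ->
     (\forall X \near U, G_ X (A_ X)) -> G A).

Definition limit_group (G_ : T -> set 'M[R]_n.+1) : set 'M[R]_n.+1 :=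
  [set A | A \in unitmx /\ exists2 A_ : T -> 'M[R]_n.+1, mxlim U A_ A &
     \forall X \near U, G_ X (A_ X)].

Lemma limit_groupP (G_ : T -> set 'M[R]_n.+1) : group_lim G_ (limit_group G_).
Proof.
split; first by move=> A [_].
by move=> A_ A lA uA GA; split=> //; exists A_.
Qed.

(** A limit of maps preserving the cones could send [C] onto its boundary; invertibility prevents
    this. In the order of the cone, [invmx A *m ones <= K ones] gives [ones <= K A_ ones] for the
    approximants, and from [d ones <= v] one gets [(d / K) ones <= A_ v], a margin that survives in
    the limit. *)
Lemma cone_lim_preserves (rho rho' : R) (C_ : T -> set V) C
    (A_ : T -> 'M[R]_n.+1) A v :
  (forall X, positive_cone rho (C_ X)) -> cone_lim U C_ C -> positive_cone rho' C ->
  mxlim U A_ A -> A \in unitmx ->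
  (\forall X \near U, forall v, C_ X v -> C_ X (A_ X *m v)) ->
  C v -> C (A *m v).
Proof.
move=> pC_ lC pC lA uA AC Cv.
have [K K0 CK] := positive_cone_upper pC (invmx A *m ones).
have lB : mxlim U (fun X => K *: ones - invmx (A_ X) *m ones)
    (K *: ones - invmx A *m ones).
  apply: mxlimB; first exact: mxlim_cst.
  by apply: mxlim_mul; [exact: mxlim_inv|exact: mxlim_cst].
have [d d0 Cd] := positive_cone_lower pC Cv.
have dK : 0 < d / K by exact: divr_gt0.
have lv : mxlim U (fun X => A_ X *m v - (d / K) *: ones) (A *m v - (d / K) *: ones).
  apply: mxlimB; last exact: mxlim_cst.
  by apply: mxlim_mul => //; exact: mxlim_cst.
have dK2 : 0 < d / K / 2 by exact: divr_gt0.
have := lC.2 _ _ _ dK2 lv.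
have half (w : V) (q : R) : w - q *: ones + (q / 2) *: ones = w - (q / 2) *: ones.
  by apply/colP => i; rewrite !mxE; lra.
rewrite half.
move=> h; rewrite -(subrK ((d / K / 2) *: ones) (A *m v)).
apply: (open_coneD (positive_coneW pC)); last exact: (positive_cone_ones pC).
apply: h; apply: filterS3 (filterI AC (mxlim_near_unit lA uA)) (lC.1 _ _ lB CK)
  (lC.1 _ _ (mxlim_cst (U := U) _) Cd) => X [AX uX] CX CvX.
have -> : A_ X *m v - (d / K) *: ones = A_ X *m (v - d *: ones) +
    (d / K) *: (A_ X *m (K *: ones - invmx (A_ X) *m ones)).
  rewrite !mulmxBr mulKVmx// -!scalemxAr scalerBr scalerA divfK ?gt_eqF//.
  by rewrite subrKA.
apply: (open_coneD (positive_coneW (pC_ X))); first exact: AX.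
by apply: (open_coneZ (positive_coneW (pC_ X))) => //; exact: AX.
Qed.

Section LimitModel.
Variables (rho eps : R) (C_ : T -> set V) (G_ : T -> set 'M[R]_n.+1).
Hypotheses (eps0 : 0 < eps) (mX : forall X, model rho eps (C_ X) (G_ X)).
Let C := limit_cone U C_.
Let G := limit_group G_.

Let pC_ X : positive_cone rho (C_ X). Proof. by case: (mX X). Qed.
Let pC : positive_cone (rho / 2) C. Proof. exact: limit_cone_positive. Qed.
Let lC : cone_lim U C_ C. Proof. exact: limit_coneP. Qed.

Let limit_preserves : preserves C G.
Proof.
move=> A v [uA [A_ lA GA]] Cv; apply: (cone_lim_preserves pC_ lC pC lA) => //.
by apply: filterS GA => X GA w; case: (mX X) => _ _ + _ _; apply.
Qed.

(** The two Hilbert inequalities are open conditions, so they pass to [A_ X] with the same [b], and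
    thickness of the approximating models applies. *)
Let limit_scalar (A_ : T -> 'M[R]_n.+1) A b : mxlim U A_ A ->
  (\forall X \near U, G_ X (A_ X)) -> C b ->
  hilbert_lt C ones b eps -> hilbert_lt C ones (A *m b) eps ->
  \forall X \near U, exists c : R, A_ X = c%:M.
Proof.
move=> lA GA Cb h1 h2.
have lb : mxlim U (fun=> b) b by exact: mxlim_cst.
have lo : mxlim U (fun=> ones) ones by exact: mxlim_cst.
apply: filterS3 (filterI GA (lC.1 _ _ lb Cb)) (hilbert_lt_lim lC lo lb h1)
  (hilbert_lt_lim lC lo (mxlim_mul lA lb) h2) => X [GX CX] hX hX'.
by case: (mX X) => _ _ _ + _; apply; eauto.
Qed.

Let limit_matrix_group : matrix_group G.
Proof.
split.
- by move=> A [].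
- move=> c c0; split; first by rewrite unitmxE det_scalar unitfE expf_neq0// gt_eqF.
  exists (fun=> c%:M); first exact: mxlim_cst.
  by apply: nearW => X; case: (mX X) => _ [_ + _ _] _ _ _; apply.
- move=> A B [uA [A_ lA GA]] [uB [B_ lB GB]]; split; first by rewrite unitmx_mul uA.
  exists (fun X => A_ X *m B_ X); first exact: mxlim_mul.
  by apply: filterS2 GA GB => X; case: (mX X) => _ [_ _ + _] _ _ _; apply.
- move=> A [uA [A_ lA GA]]; split; first by rewrite unitmx_inv.
  exists (fun X => invmx (A_ X)); first exact: mxlim_inv.
  by apply: filterS GA => X; case: (mX X) => _ [_ _ _ +] _ _ _; apply.
Qed.

Lemma limit_model : model (rho / 2) eps C G.
Proof.
split=> //.
- move=> A b [uA [A_ lA GA]] Cb h1 h2; apply: (mxlim_scalar lA).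
  exact: (limit_scalar lA GA Cb).
- move=> A k [uA [A_ lA GA]] k0 [c Akc]; apply: (mxlim_scalar lA).
  (* Only the limit [A ^+ k] is known to be scalar. It fixes the ray of [ones], so thickness makes
     the powers [A_ X ^+ k] scalar as well, and the approximating groups are torsion free. *)
  have GAk : G (A ^+ k) by apply: matrix_groupX => //; split=> //; exists A_.
  have lk : mxlim U (fun X => A_ X ^+ k) (A ^+ k).
    elim: (k) => [|j IH]; first by rewrite expr0; exact: mxlim_cst.
    rewrite exprS (_ : (fun _ => _) = (fun X => A_ X *m A_ X ^+ j)).
      exact: (mxlim_mul lA IH).
    by apply/funext => X; rewrite exprS.
  have C1 : C ones by rewrite -[ones]scale1r; exact: (positive_cone_ones pC).
  have C1k := limit_preserves GAk C1.
  have c0 : 0 < c.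
    apply: (open_coneZ_gt0 (positive_coneW pC) C1).
    by move: C1k; rewrite Akc mul_scalar_mx.
  have h1 := hilbert_lt_refl (positive_coneW pC) eps0 C1.
  have h2 : hilbert_lt C ones (A ^+ k *m ones) eps.
    rewrite Akc mul_scalar_mx -[X in hilbert_lt _ X _ _]scale1r.
    exact/(hilbert_lt_scale (positive_coneW pC)).
  have GkX : \forall X \near U, G_ X (A_ X ^+ k).
    by apply: filterS GA => X; apply: matrix_groupX; case: (mX X).
  apply: filterS2 GA (limit_scalar lk GkX C1 h1 h2) => X GX.
  by case: (mX X) => _ _ _ _; apply.
Qed.

End LimitModel.

(** The content is that [G] is closed among invertible matrices. Two terms of a convergent family
    move [ones] to nearby points, so by thickness they differ by a scalar; hence the limit is a
    multiple of one term, a positive one since both preserve [C]. *)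
Lemma group_lim_cst (rho eps : R) C G : 0 < eps -> model rho eps C G ->
  group_lim (fun=> G) G.
Proof.
move=> eps0 [pC mG CG thG tfG]; split.
  by move=> A GA; exists (fun=> A); [exact: mxlim_cst|exact: nearW].
move=> A_ A lA uA GA.
have C1 : C ones by rewrite -[ones]scale1r; exact: (positive_cone_ones pC).
have CA1 : C (A *m ones).
  apply: (cone_lim_preserves (fun=> pC) (cone_lim_cst pC) pC lA) => //.
  by apply: filterS GA => X GX v; exact: CG.
have l1 : mxlim U (fun X => A_ X *m ones) (A *m ones).
  by apply: mxlim_mul => //; exact: mxlim_cst.
have e2 : 0 < eps / 2 by exact: divr_gt0.
have near1 : \forall X \near U, G (A_ X) /\
    hilbert_lt C (A_ X *m ones) (A *m ones) (eps / 2).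
  apply: filterI GA _.
  apply: (hilbert_lt_lim (cone_lim_cst pC) l1 (mxlim_cst (A *m ones))).
  exact: (hilbert_lt_refl (positive_coneW pC)).
have [X0 [GX0 hX0]] := filter_ex near1.
have [uG G1 GM GV] := mG; have GV0 := GV _ GX0.
have lB : mxlim U (fun X => invmx (A_ X0) *m A_ X) (invmx (A_ X0) *m A).
  by apply: mxlim_mul => //; exact: mxlim_cst.
have [c Ac] : exists c : R, invmx (A_ X0) *m A = c%:M.
  apply: (mxlim_scalar lB); apply: filterS near1 => X [GX hX].
  apply: (thG _ _ (GM _ _ GV0 GX) C1).
    exact: (hilbert_lt_refl (positive_coneW pC)).
  rewrite -mulmxA -[X in hilbert_lt _ X _ _](mulKmx (uG _ GX0)).
  apply: hilbert_lt_map; first by move=> v; exact: CG.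
  rewrite [eps]splitr.
  by apply: (hilbert_lt_trans (positive_coneW pC) hX0); exact: hilbert_lt_sym.
have Ae : A = c *: A_ X0.
  by rewrite -(mulKVmx (uG _ GX0) A) Ac mul_mx_scalar.
rewrite Ae; apply: matrix_groupZ => //.
apply: (open_coneZ_gt0 (positive_coneW pC) (CG _ _ GX0 C1)).
by rewrite scalemxAl -Ae.
Qed.

Section Limits.
Variables (rho eps rho' : R) (C_ : T -> set V) (G_ : T -> set 'M[R]_n.+1).
Variables (C : set V) (G : set 'M[R]_n.+1).
Hypotheses (mX : forall X, model rho eps (C_ X) (G_ X)).
Hypotheses (mC : model rho' eps C G).
Hypotheses (lC : cone_lim U C_ C) (lG : group_lim G_ G).
Variables (a_ b_ : T -> V) (a b : V).
Hypotheses (la : mxlim U a_ a) (lb : mxlim U b_ b).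

Lemma quotient_lt_lim r : quotient_lt C G a b r ->
  \forall X \near U, quotient_lt (C_ X) (G_ X) (a_ X) (b_ X) r.
Proof.
move=> [A GA h]; have [A_ lA GA_] := lG.1 _ GA.
apply: filterS2 GA_ (hilbert_lt_lim lC la (mxlim_mul lA lb) h) => X GX hX.
by exists (A_ X).
Qed.

(** The radii may vary with the index, and one [A] has to serve every [s] that eventually bounds
    them: with radii tending to 0 this shows that the distance of two orbits is attained. The fixed
    bound [r] provides the compactness. *)
Lemma lim_quotient (r_ : T -> R) r : C a -> C b ->
  (\forall X \near U, quotient_lt (C_ X) (G_ X) (a_ X) (b_ X) (r_ X)) ->
  (\forall X \near U, r_ X <= r) ->
  exists2 A, G A & forall s s', (\forall X \near U, r_ X <= s) -> s < s' ->
    hilbert_lt C a (A *m b) s'.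
Proof.
move=> Ca Cb h hr.
have pC_ X : positive_cone rho (C_ X) by case: (mX X).
have [pC _ _ _ _] := mC.
have cC_ X := positive_coneW (pC_ X).
(* [K1] bounds [v] above and [d] bounds it below by multiples of [ones]; their combination
   [K1 + d^-1] does both. *)
have bound v_ v : mxlim U v_ v -> C v -> exists2 K : R, 0 < K &
    \forall X \near U, C_ X (K *: ones - v_ X) /\ C_ X (K *: v_ X - ones).
  move=> lv Cv; have [K1 K10 CK1] := positive_cone_upper pC v.
  have [d d0 Cd] := positive_cone_lower pC Cv.
  exists (K1 + d^-1); first by rewrite addr_gt0// invr_gt0.
  have l1 : mxlim U (fun X => K1 *: ones - v_ X) (K1 *: ones - v).
    by apply: mxlimB => //; exact: mxlim_cst.
  have l2 : mxlim U (fun X => v_ X - d *: ones) (v - d *: ones).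
    by apply: mxlimB => //; exact: mxlim_cst.
  apply: filterS3 (lC.1 _ _ l1 CK1) (lC.1 _ _ l2 Cd) (lC.1 _ _ lv Cv).
  move=> X C1 C2 C3; rewrite !scalerDl; split.
    rewrite addrAC; apply: (open_coneD (cC_ X)) => //.
    by apply: (positive_cone_ones (pC_ X)); rewrite invr_gt0.
  rewrite -addrA; apply: (open_coneD (cC_ X)); first exact: (open_coneZ (cC_ X)).
  rewrite -[ones](scalerK (lt0r_neq0 d0)) -scalerBr.
  by apply: (open_coneZ (cC_ X)); rewrite ?invr_gt0.
have [Ka Ka0 hKa] := bound _ _ la Ca; have [Kb Kb0 hKb] := bound _ _ lb Cb.
have : \forall X \near U, exists A, G_ X A /\
    [/\ hilbert_lt (C_ X) (a_ X) (A *m b_ X) (r_ X),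
        C_ X ((Kb * Ka) *: ones - A *m ones) &
        C_ X ((Ka * expR r * Kb) *: ones - invmx A *m ones)].
  apply: filterS3 hKa hKb (filterI h hr) => X [ha1 ha2] [hb1 hb2] [[A GA] + rX].
  have [_ mG CG _ _] := mX X; have [uG _ GM GV] := mG.
  move=> [l [m [l0 m0 Cl Cm lmX]]].
  have lm : l * m < expR r by rewrite (lt_le_trans lmX)// ler_expR.
  (* Dividing [A] by [m] normalizes it: then [A b <= a], and applying the inverse to [a <= l A b]
     gives [invmx A a <= l m b] with [l m < expR r]. Only the product of [l] and [m] has to be
     bounded. *)
  have CAa : C_ X (a_ X - (m^-1 *: A) *m b_ X).
    rewrite -[a_ X](scalerK (lt0r_neq0 m0)) -scalemxAl -scalerBr.
    by apply: (open_coneZ (cC_ X)); rewrite ?invr_gt0.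
  have GA' : G_ X (m^-1 *: A) by apply: matrix_groupZ; rewrite ?invr_gt0.
  have Cb_ : C_ X (b_ X).
    rewrite -[b_ X](scalerK (lt0r_neq0 Kb0)).
    apply: (open_coneZ (cC_ X)); first by rewrite invr_gt0.
    rewrite -(subrK ones (_ *: _)); apply: (open_coneD (cC_ X)) => //.
    by rewrite -[ones]scale1r; apply: (positive_cone_ones (pC_ X)).
  have CBb : C_ X (expR r *: b_ X - invmx (m^-1 *: A) *m a_ X).
    rewrite -(subrKA ((l * m) *: b_ X)) -scalerBl; apply: (open_coneD (cC_ X)).
      by apply: (open_coneZ (cC_ X)); rewrite ?subr_gt0.
    have := CG _ _ (GV _ GA') Cl; rewrite mulmxBr -scalemxAr.
    have -> : invmx (m^-1 *: A) *m (A *m b_ X) = m *: b_ X.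
      have -> : A *m b_ X = m *: ((m^-1 *: A) *m b_ X).
        by rewrite -scalemxAl scalerA mulfV ?scale1r// gt_eqF.
      by rewrite -scalemxAr mulKmx ?uG.
    by rewrite scalerA.
  exists (m^-1 *: A); split=> //; split.
  - have := hilbert_lt_scale (cC_ X) (a_ X) (A *m b_ X) (r_ X) (@ltr01 R) (_ : 0 < m^-1).
    rewrite invr_gt0 scale1r -scalemxAl => /(_ m0)[_]; apply.
    by exists l, m.
  - have -> : (Kb * Ka) *: ones - (m^-1 *: A) *m ones =
        Kb *: (Ka *: ones - a_ X) + Kb *: (a_ X - (m^-1 *: A) *m b_ X) +
        (m^-1 *: A) *m (Kb *: b_ X - ones).
      by rewrite -scalerDr subrKA scalerBr scalerA mulmxBr -scalemxAr subrKA.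
    apply: (open_coneD (cC_ X)); last exact: CG.
    by apply: (open_coneD (cC_ X)); exact: (open_coneZ (cC_ X)).
  - have -> : (Ka * expR r * Kb) *: ones - invmx (m^-1 *: A) *m ones =
        (Ka * expR r) *: (Kb *: ones - b_ X) +
        Ka *: (expR r *: b_ X - invmx (m^-1 *: A) *m a_ X) +
        invmx (m^-1 *: A) *m (Ka *: a_ X - ones).
      by rewrite !scalerBr !scalerA mulmxBr -scalemxAr !subrKA.
    apply: (open_coneD (cC_ X)); last by apply: CG => //; exact: GV.
    apply: (open_coneD (cC_ X)); apply: (open_coneZ (cC_ X)) => //.
    by rewrite mulr_gt0// expR_gt0.
move=> /(near_choice 0)[A_ hA].
have [A lA] : exists A, mxlim U A_ A.
  apply: (@mxlim_bounded _ _ _ _ _ _ _ (2 * (Kb * Ka) / rho)).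
  apply: filterS hA => X [GA [_ h1 _]]; apply: (positive_cone_entries (pC_ X)) => //.
  by move=> v; have [_ _ CG _ _] := mX X; exact: CG.
(* The inverses converge too, and their limit inverts [A]; a bound on the [A_ X] alone would allow a
   singular limit. *)
have [B lB] : exists B, mxlim U (fun X => invmx (A_ X)) B.
  apply: (@mxlim_bounded _ _ _ _ _ _ _ (2 * (Ka * expR r * Kb) / rho)).
  apply: filterS hA => X [GA [_ _ h1]]; apply: (positive_cone_entries (pC_ X)) => //.
  by move=> v; have [_ [_ _ _ GV] CG _ _] := mX X; apply/CG/GV.
have uA : A \in unitmx.
  suff /mulmx1_unit[//] : A *m B = 1%:M.
  apply: (mxlim_near_eq (mxlim_mul lA lB) (mxlim_cst _)).
  by apply: filterS hA => X [GA _]; have [_ [uG _ _ _] _ _ _] := mX X; rewrite mulmxV ?uG.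
have GA : \forall X \near U, G_ X (A_ X) by apply: filterS hA => X [].
exists A; first exact: (lG.2 _ _ lA).
move=> s s' rs ss'; apply: (lim_hilbert_lt pC_ lC pC la (mxlim_mul lA lb)) ss' => //.
  apply: (cone_lim_preserves pC_ lC pC lA) => //.
  by apply: filterS GA => X GA v; have [_ _ CG _ _] := mX X; exact: CG.
by apply: filterS2 hA rs => X [_ [hX _ _]] rX; exact: hilbert_lt_le hX.
Qed.

Lemma lim_quotient_lt r s : C a -> C b ->
  (\forall X \near U, quotient_lt (C_ X) (G_ X) (a_ X) (b_ X) r) -> r < s ->
  quotient_lt C G a b s.
Proof.
move=> Ca Cb h rs; have rr : \forall X \near U, (fun=> r) X <= r by exact: nearW.
have [A GA hA] := @lim_quotient (fun=> r) r Ca Cb h rr.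
by exists A => //; exact: hA rr rs.
Qed.

End Limits.
End GroupLimit.

(** * Gromov-Hausdorff convergence *)

Section Realization.
Context {R : realType} {n : nat}.
Local Notation V := 'cV[R]_n.+1.
Local Notation ones := (@ones R n).
Implicit Types (C : set V) (G : set 'M[R]_n.+1) (X : pointed_metric_space R).

Lemma quotient_lt_le C G a b (r s : R) : r <= s ->
  quotient_lt C G a b r -> quotient_lt C G a b s.
Proof. by move=> rs [A GA h]; exists A => //; exact: hilbert_lt_le h. Qed.

(** Values of [phi] outside [C] are arbitrary. Strict comparison with every real [r] determines the
    distance, so no infimum has to be taken. *)
Definition realizes X C G (phi : V -> Defs.space X) : Prop :=
  [/\ forall x, exists2 v, C v & phi v = x, phi ones = basepoint X &
      forall a b, C a -> C b -> forall r,
        dist X (phi a) (phi b) < r <-> quotient_lt C G a b r].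

Lemma dist_ge0 X x y : 0 <= dist X x y.
Proof.
by have := dist_triangle (p := X) x y x; rewrite dist_refl (dist_sym y x); lra.
Qed.

Section Lift.
Variables (rho eps : R) (C : set V) (G : set 'M[R]_n.+1).
Variables (X : pointed_metric_space R) (phi : V -> Defs.space X).
Hypotheses (mC : model rho eps C G) (rX : realizes C G phi).

Lemma realizes_action A (c : R) b : G A -> 0 < c -> C b -> phi (c *: (A *m b)) = phi b.
Proof.
have [pC mG CG _ _] := mC; have [uG _ _ GV] := mG; have [_ _ dP] := rX.
have cC := positive_coneW pC; move=> GA c0 Cb; apply/esym/dist_eq0/eqP.
rewrite eq_le dist_ge0 andbT; apply/ler_addgt0Pr => r r0; rewrite add0r; apply/ltW/dP => //.
  by apply: (open_coneZ cC) => //; exact: CG.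
exists (invmx A); first exact: GV.
rewrite -scalemxAr mulKmx ?uG// -[X in hilbert_lt _ X _ _]scale1r.
exact/(hilbert_lt_scale cC _ _ _ ltr01 c0)/(hilbert_lt_refl cC).
Qed.

(** Dividing the lift by [m] makes it at most [ones], and the lower bound then involves only
    [l * m < expR r]. Points of a ball thus lift to a bounded slab of the cone. *)
Lemma realizes_lift x r : dist X (basepoint X) x < r -> exists b,
  [/\ C b, phi b = x, C (ones - b) & C (expR r *: b - ones)].
Proof.
have [pC mG CG _ _] := mC; have [_ base dP] := rX; have [sur _ _] := rX.
have cC := positive_coneW pC; have [b0 Cb0 <-] := sur x.
have C1 : C ones by rewrite -[ones]scale1r; exact: (positive_cone_ones pC).
rewrite -base => /(dP _ _ C1 Cb0)[A GA [l [m [l0 m0 Cl Cm lm]]]].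
have m'0 : 0 < m^-1 by rewrite invr_gt0.
have Cb : C (m^-1 *: (A *m b0)) by apply: (open_coneZ cC) => //; exact: CG.
exists (m^-1 *: (A *m b0)); split=> //.
- exact: realizes_action.
- rewrite -[ones](scalerK (lt0r_neq0 m0)) -scalerBr; exact: (open_coneZ cC).
- rewrite -(subrKA ((l * m) *: (m^-1 *: (A *m b0)))) -scalerBl.
  apply: (open_coneD cC); first by apply: (open_coneZ cC); rewrite ?subr_gt0.
  by rewrite scalerA mulfK// gt_eqF.
Qed.

End Lift.
End Realization.

Section GHLimit.
Context {R : realType} {n : nat} {T : Type} (U : set_system T).
Context {UF : UltraFilter U}.
Local Notation V := 'cV[R]_n.+1.
Local Notation ones := (@ones R n).
Variables (C : set V) (G : set 'M[R]_n.+1) (rho' eps : R).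
Hypothesis (mC : model rho' eps C G).

Let pC : positive_cone rho' C. Proof. by case: mC. Qed.
Let cC : open_cone C. Proof. exact: (positive_coneW pC). Qed.

(** The upper bound makes the vectors bounded since the cones lie in the orthant, and the lower
    bound keeps the limit inside the open cone. Weak inequalities in the limit are stated by adding
    an arbitrary [w] of [C]. *)
Lemma bounded_limit (rho : R) (C_ : T -> set V) (b_ : T -> V) (k K : R) :
  (forall X, positive_cone rho (C_ X)) -> cone_lim U C_ C -> 0 < K ->
  (\forall X \near U, C_ X (k *: ones - b_ X) /\ C_ X (K *: b_ X - ones)) ->
  exists2 b, mxlim U b_ b & [/\ C b, forall w, C w -> C (k *: ones - b + w) &
    forall w, C w -> C (K *: b - ones + w)].
Proof.
move=> pC_ lC K0 hb.
have [b lb] : exists b, mxlim U b_ b.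
  apply: (@mxlim_bounded _ _ _ _ _ _ _ k); apply: filterS hb => X [h1 h2] i j.
  have := positive_cone_gt0 (pC_ X) i h1; have := positive_cone_gt0 (pC_ X) i h2.
  rewrite ord1 !mxE mulr1 subr_gt0 => h3 h4.
  have b0 : 0 < b_ X i 0 by rewrite -(pmulr_rgt0 _ K0) (lt_trans ltr01).
  by rewrite gtr0_norm//; lra.
have l1 : mxlim U (fun X => k *: ones - b_ X) (k *: ones - b).
  by apply: mxlimB => //; exact: mxlim_cst.
have l2 : mxlim U (fun X => K *: b_ X - ones) (K *: b - ones).
  by apply: mxlimB; [apply: mxlimZ => //; exact: cvg_cst|exact: mxlim_cst].
have C1 : C ones by rewrite -[ones]scale1r; exact: (positive_cone_ones pC).
have h1 : \forall X \near U, C_ X (k *: ones - b_ X) by apply: filterS hb => X [].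
have h2 : \forall X \near U, C_ X (K *: b_ X - ones) by apply: filterS hb => X [].
exists b => //; split.
- rewrite -(scalerK (lt0r_neq0 K0) b) -(subrK ones (K *: b)).
  apply: (open_coneZ cC); first by rewrite invr_gt0.
  exact: (cone_lim_add lC pC l2).
- by move=> w; exact: (cone_lim_add lC pC l1).
- by move=> w; exact: (cone_lim_add lC pC l2).
Qed.

(** The limit of a family of counterexamples satisfies the bounds with [1] and [K] only weakly;
    adding [ones], respectively [b], makes them strict with [2] and [K + 1]. *)
Lemma bounded_transfer (rho1 : R) (C1_ C2_ : T -> set V) (K : R) :
  (forall X, positive_cone rho1 (C1_ X)) -> cone_lim U C1_ C ->
  cone_lim U C2_ C -> 0 < K ->
  \forall X \near U, forall b, C1_ X (ones - b) -> C1_ X (K *: b - ones) ->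
    [/\ C2_ X b, C2_ X (2 *: ones - b) & C2_ X ((K + 1) *: b - ones)].
Proof.
move=> pC1 lC1 lC2 K0; apply: contrapT => /ultra_not/= hn.
have /(near_choice (0 : V))[b_ hb] : \forall X \near U, exists b,
    (C1_ X (ones - b) /\ C1_ X (K *: b - ones)) /\
    ~ [/\ C2_ X b, C2_ X (2 *: ones - b) & C2_ X ((K + 1) *: b - ones)].
  apply: filterS hn => X /existsNP[b /not_implyP[h1 /not_implyP[h2 h3]]].
  by exists b.
have [|b lb [Cb Cu Cl]] := @bounded_limit _ _ b_ 1 _ pC1 lC1 K0.
  by apply: filterS hb => X [[h1 h2] _]; rewrite scale1r.
have l1 : mxlim U (fun X => 2 *: ones - b_ X) (2 *: ones - b).
  by apply: mxlimB => //; exact: mxlim_cst.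
have l2 : mxlim U (fun X => (K + 1) *: b_ X - ones) ((K + 1) *: b - ones).
  by apply: mxlimB; [apply: mxlimZ => //; exact: cvg_cst|exact: mxlim_cst].
have C1 : C ones by rewrite -[ones]scale1r; exact: (positive_cone_ones pC).
have Cu' : C (2 *: ones - b).
  have := Cu _ C1; rewrite addrAC -[X in _ + X - _]scale1r -scalerDl.
  by [].
have Cl' : C ((K + 1) *: b - ones).
  by have := Cl _ Cb; rewrite addrAC scalerDl scale1r.
have [X [h1 [h2 [h3 [_ h4]]]]] := filter_ex (filterI (lC2.1 _ _ lb Cb)
  (filterI (lC2.1 _ _ l1 Cu') (filterI (lC2.1 _ _ l2 Cl') hb))).
exact: h4.
Qed.

(** Both families have the same limit; one of them is meant to be the constant family, in either
    role. The radius [r] is quantified inside the neighbourhood, so it has to be bounded before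
    limits are taken. *)
Lemma quotient_lt_transfer (rho1 rho2 : R) (C1_ C2_ : T -> set V)
    (G1_ G2_ : T -> set 'M[R]_n.+1) (K d : R) :
  (forall X, model rho1 eps (C1_ X) (G1_ X)) -> cone_lim U C1_ C ->
  group_lim U G1_ G ->
  (forall X, model rho2 eps (C2_ X) (G2_ X)) -> cone_lim U C2_ C ->
  group_lim U G2_ G -> 0 < K -> 0 < d ->
  \forall X \near U, forall b b' r,
    C1_ X (2 *: ones - b) -> C1_ X (K *: b - ones) ->
    C1_ X (2 *: ones - b') -> C1_ X (K *: b' - ones) ->
    C2_ X (2 *: ones - b) -> C2_ X (K *: b - ones) ->
    C2_ X (2 *: ones - b') -> C2_ X (K *: b' - ones) ->
    quotient_lt (C1_ X) (G1_ X) b b' r -> quotient_lt (C2_ X) (G2_ X) b b' (r + d).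
Proof.
move=> m1 lC1 lG1 m2 lC2 lG2 K0 d0; apply: contrapT => /ultra_not/= hn.
have pC1 X : positive_cone rho1 (C1_ X) by case: (m1 X).
have : \forall X \near U, exists z : (V * V) * R,
    [/\ C1_ X (2 *: ones - z.1.1) /\ C1_ X (K *: z.1.1 - ones),
        C1_ X (2 *: ones - z.1.2) /\ C1_ X (K *: z.1.2 - ones),
        quotient_lt (C1_ X) (G1_ X) z.1.1 z.1.2 z.2,
        ~ quotient_lt (C2_ X) (G2_ X) z.1.1 z.1.2 (z.2 + d) &
        `|z.2| <= (2 * K) * (2 * K)].
  apply: filterS hn => X /existsNP[b /existsNP[b' /existsNP[r]]].
  move=> /not_implyP[h1 /not_implyP[h2 /not_implyP[h3 /not_implyP[h4]]]].
  move=> /not_implyP[h5 /not_implyP[h6 /not_implyP[h7 /not_implyP[h8]]]].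
  move=> /not_implyP[h9 h10]; exists (b, b', r); split=> //=.
  have [_ mG1 CG1 _ _] := m1 X; have [A GA hA] := h9.
  have cC1 := positive_coneW (pC1 X).
  have C1b' : C1_ X b'.
    rewrite -(scalerK (lt0r_neq0 K0) b') -(subrK ones (K *: b')).
    apply: (open_coneZ cC1); first by rewrite invr_gt0.
    apply: (open_coneD cC1) => //.
    by rewrite -[ones]scale1r; exact: (positive_cone_ones (pC1 X)).
  have r0 : 0 < r by apply: (hilbert_lt_gt0 cC1) hA => //; exact: CG1.
  (* A counterexample cannot have a large [r]: in the second cone the identity with both constants
     equal to [2 * K] already gives the conclusion, by [1 + x <= expR x]. *)
  rewrite gtr0_norm// leNgt; apply/negP => rK; apply: h10.
  have [pC2 [_ G21 _ _] _ _ _] := m2 X; have cC2 := positive_coneW pC2.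
  have K20 : 0 < 2 * K by rewrite mulr_gt0.
  have C2l w w' : C2_ X (2 *: ones - w) -> C2_ X (K *: w' - ones) ->
      C2_ X ((2 * K) *: w' - w).
    move=> hw hw'; rewrite -(subrKA (2 *: ones)) -scalerA -scalerBr.
    by apply: (open_coneD cC2) => //; apply: (open_coneZ cC2).
  exists 1%:M; first exact: G21.
  rewrite mul1mx; exists (2 * K), (2 * K); split=> //; try exact: C2l.
  apply: (lt_trans rK); apply: (@lt_le_trans _ _ (1 + (r + d))); first by lra.
  exact: expR_ge1Dx.
move=> /(near_choice (0 : (V * V) * R))[z_ hz].
pose r_ X := (z_ X).2; pose b_ X := (z_ X).1.1; pose b'_ X := (z_ X).1.2.
have [|b lb [Cb _ _]] := @bounded_limit _ _ b_ 2 _ pC1 lC1 K0.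
  by apply: filterS hz => X [].
have [|b' lb' [Cb' _ _]] := @bounded_limit _ _ b'_ 2 _ pC1 lC1 K0.
  by apply: filterS hz => X [].
have [r lr] : exists r : R, r_ @ U --> r.
  by apply: (@ultra_cvg_bounded _ _ _ _ _ ((2 * K) * (2 * K))); apply: filterS hz => X [].
(* Replacing [r_ X] by its limit costs [d / 4], passing to the limit model costs another [d / 4],
   and [r + d / 2 < r_ X + d] closes the loop. *)
have d4 : 0 < d / 4 by exact: divr_gt0.
have hr : \forall X \near U, `|r - r_ X| < d / 4 by move/cvgrPdist_lt : lr => /(_ _ d4).
have h1 : \forall X \near U, quotient_lt (C1_ X) (G1_ X) (b_ X) (b'_ X) (r + d / 4).
  apply: filterS2 hz hr => X [_ _ hq _ _]; rewrite ltr_distlC => /andP[h1 h2].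
  by apply: quotient_lt_le hq; exact: ltW.
have rd : r + d / 4 < r + d / 2 by lra.
have h2 : \forall X \near U, quotient_lt (C2_ X) (G2_ X) (b_ X) (b'_ X) (r + d / 2).
  apply: (quotient_lt_lim lC2 lG2 lb lb').
  exact: (lim_quotient_lt m1 mC lC1 lG1 lb lb' Cb Cb' h1 rd).
have [X [hq [[_ _ _ hn' _]]]] := filter_ex (filterI h2 (filterI hz hr)).
rewrite ltr_distlC => /andP[h3 h4]; apply: hn'; apply: quotient_lt_le hq.
by rewrite -/(r_ X); lra.
Qed.

(** Two points are related when one vector [b] lifts both of them and lies in the bounded slabs of
    both cones. The normal form makes this meaningful, as all cones share the same coordinates. *)
Lemma gh_close_limit (X_ : T -> pointed_metric_space R) (L : pointed_metric_space R)
    (rho : R) (C_ : T -> set V) (G_ : T -> set 'M[R]_n.+1) (psi : V -> Defs.space L) :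
  0 < eps ->
  (forall t, model rho eps (C_ t) (G_ t)) -> cone_lim U C_ C -> group_lim U G_ G ->
  (\forall t \near U, exists phi : V -> Defs.space (X_ t), realizes (C_ t) (G_ t) phi) ->
  realizes C G psi ->
  forall e : R, 0 < e -> \forall t \near U, gh_close e (X_ t) L.
Proof.
move=> eps0 mt lC lG hphi rL e e0.
have pC_ t : positive_cone rho (C_ t) by case: (mt t).
have lCc : cone_lim U (fun=> C) C by exact: (cone_lim_cst pC).
have lGc : group_lim U (fun=> G) G by exact: (group_lim_cst eps0 mC).
(* Lifts of the ball of radius [e^-1] satisfy the lower bound with [K1], and transfer to the other
   cone raises it to [K1 + 1]. The distortion is kept to [e / 2] so that it is strictly less than
   [e]. *)
pose K1 := expR e^-1; have K10 : 0 < K1 := expR_gt0 _.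
have K0 : 0 < K1 + 1 by rewrite addr_gt0.
have e2 : 0 < e / 2 by exact: divr_gt0.
apply: filter_app (bounded_transfer pC_ lC lCc K10).
apply: filter_app (bounded_transfer (fun=> pC) lCc lC K10).
apply: filter_app (quotient_lt_transfer mt lC lG (fun=> mC) lCc lGc K0 e2).
apply: filter_app (quotient_lt_transfer (fun=> mC) lCc lGc mt lC lG K0 e2).
apply: filterS hphi => t [phi rX] q2 q1 tr2 tr1.
have cC_ := positive_coneW (pC_ t).
have [_ phi1 phiP] := rX; have [_ psi1 psiP] := rL.
have C_1 : C_ t ones by rewrite -[ones]scale1r; exact: (positive_cone_ones (pC_ t)).
have C1 : C ones by rewrite -[ones]scale1r; exact: (positive_cone_ones pC).
have two (D : set V) b : open_cone D -> D ones -> D (ones - b) -> D (2 *: ones - b).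
  by move=> cD D1 Db; rewrite (_ : 2 = 1 + 1)// scalerDl scale1r -addrA; exact: open_coneD.
have Kp1 (D : set V) b : open_cone D -> D b -> D (K1 *: b - ones) ->
    D ((K1 + 1) *: b - ones).
  by move=> cD D1 Db; rewrite scalerDl scale1r addrAC; exact: open_coneD.
exists (fun x y => exists b, [/\ C_ t b /\ C b, phi b = x /\ psi b = y,
  C_ t (2 *: ones - b) /\ C_ t ((K1 + 1) *: b - ones) &
  C (2 *: ones - b) /\ C ((K1 + 1) *: b - ones)]); split.
- exists ones; split=> //; split.
  + by rewrite (_ : 2 = 1 + 1)// scalerDl scale1r addrK.
  + by rewrite scalerDl scale1r addrK; exact: (positive_cone_ones (pC_ t)).
  + by rewrite (_ : 2 = 1 + 1)// scalerDl scale1r addrK.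
  + by rewrite scalerDl scale1r addrK; exact: (positive_cone_ones pC).
- move=> x /(realizes_lift (mt t) rX)[b [Cb xb Cu Cl]].
  have [Cb' Cu' Cl'] := tr1 b Cu Cl; exists (psi b), b; split=> //; split=> //.
  + exact: two.
  + exact: Kp1.
- move=> x /(realizes_lift mC rL)[b [Cb xb Cu Cl]].
  have [Cb' Cu' Cl'] := tr2 b Cu Cl; exists (phi b), b; split=> //; split=> //.
  + exact: two.
  + exact: Kp1.
- move=> x x' y y' [b [[Cb Cb'] [<- <-] [h1 h2] [h3 h4]]].
  move=> [c [[Cc Cc'] [<- <-] [h5 h6] [h7 h8]]].
  have d1 : dist L (psi b) (psi c) <= dist (X_ t) (phi b) (phi c) + e / 2.
    apply/ler_addgt0Pr => r r0; apply/ltW/psiP => //; rewrite addrAC; apply: q1 => //.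
    by apply/phiP => //; rewrite ltrDl.
  have d2 : dist (X_ t) (phi b) (phi c) <= dist L (psi b) (psi c) + e / 2.
    apply/ler_addgt0Pr => r r0; apply/ltW/phiP => //; rewrite addrAC; apply: q2 => //.
    by apply/psiP => //; rewrite ltrDl.
  by rewrite ltr_distl; apply/andP; split; lra.
Qed.

End GHLimit.

(** * Cones over projective domains *)

Section ScalarQuotientTopology.
Context {R : realType} {V : normedModType R} (A : set V).

(** Topology is done on preimages in the vector space, because [repr] chooses representatives
    without any continuity. *)
Definition vlift (W : set (scalar_quotient A)) : set V :=
  [set v | exists2 u : A, \val u = v & W (\pi_(scalar_quotient A) u)].

Lemma open_vlift (W : set (scalar_quotient A)) : open A ->
  open W <-> open (vlift W).
Proof.
move=> oA; split.
- move=> [B oB BW]; rewrite (_ : vlift W = B `&` A); first exact: openI.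
  apply/seteqP; split=> [_ [u <- Wu]|v [Bv Av]].
    split; last exact: (set_mem (valP u)).
    by have : (\pi_(scalar_quotient A) @^-1` W) u by []; rewrite -BW.
  exists (SigSub (mem_set Av)) => //.
  have : (set_val @^-1` B) (SigSub (mem_set Av) : A) by [].
  by rewrite BW.
- move=> oW; exists (vlift W) => //; apply/seteqP; split=> [u [u' uu' Wu']|u Wu].
    by rewrite (_ : u = u')//; apply: val_inj; rewrite uu'.
  by exists u.
Qed.

Lemma vliftZ (W : set (scalar_quotient A)) (k : R) v : A v ->
  k != 0 -> vlift W (k *: v) -> vlift W v.
Proof.
move=> Av k0 [u uv Wu]; exists (SigSub (mem_set Av)) => //.
suff -> : \pi_(scalar_quotient A) (SigSub (mem_set Av) : A) = \pi u by [].
apply/scalar_quotientP; exists k^-1; first by rewrite invr_eq0.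
by rewrite uv scalerK.
Qed.

End ScalarQuotientTopology.

Section ProjectiveTopology.
Context {R : realType} {n : nat}.
Local Notation V := 'cV[R]_n.+1.
Implicit Types (W : set (RP R n)) (u : 'rV[R]_n.+1) (v w : V) (C : set V).

Lemma open_nonzero : open (nonzero_vectors : set V).
Proof.
rewrite openE => v /= v0.
have [i vi] : exists i, v i 0 != 0.
  apply/existsP; apply: contraNT v0; rewrite negb_exists => /forallP h.
  by apply/eqP/colP => i; rewrite mxE; apply/eqP; have := h i; rewrite negbK.
apply/nbhs_mxP; exists `|v i 0|; first by rewrite normr_gt0.
move=> w /(_ i 0); apply: contraTneq => ->.
by rewrite mxE sub0r normrN ltxx.
Qed.

Lemma vlift_class W v (v0 : v != 0) : vlift W v <-> W (proj_class v0).
Proof.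
split=> [[u uv Wu]|Wv].
  suff -> : proj_class v0 = \pi_(RP R n) u by [].
  by congr \pi; apply: val_inj; rewrite uv.
by exists (SigSub (mem_set v0 : v \in nonzero_vectors)).
Qed.

Lemma vlift_neq0 W v : vlift W v -> v != 0.
Proof. by move=> [u <- _]; exact: (set_mem (valP u)). Qed.

Lemma vlift_hcoord W p : vlift W (hcoord p) <-> W p.
Proof. by rewrite (vlift_class _ (hcoord_neq0 p)) hcoordK. Qed.

Lemma vlift_scale W (k : R) v : k != 0 -> vlift W v -> vlift W (k *: v).
Proof.
move=> k0 Wv; apply: (vliftZ (k := k^-1)); rewrite ?invr_eq0 ?scalerK//.
by rewrite /nonzero_vectors/= scaler_eq0 negb_or k0 (vlift_neq0 Wv).
Qed.

(** [hcoord] is not continuous, but the existential scalar removes the dependence on the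
    representative. This is the openness of the projection. *)
Lemma saturation_open (O : set V) : open O ->
  open [set p : RP R n | exists2 k : R, k != 0 & O (k *: hcoord p)].
Proof.
move=> oO; apply/(open_vlift _ open_nonzero).
rewrite openE => v Wv; have v0 := vlift_neq0 Wv.
move: Wv => /(vlift_class _ v0)[k k0 Ov].
have [k' k'0 hv] := hcoord_class v0; rewrite hv scalerA in Ov.
have kk0 : k * k' != 0 by rewrite mulf_neq0.
have /nbhs_mxP[d d0 dO] := open_nbhs_nbhs (conj oO Ov).
have /nbhs_mxP[d' d'0 nz] := open_nbhs_nbhs (conj open_nonzero (v0 : nonzero_vectors v)).
(* [d'] keeps [w] nonzero, and the division by the norm of [k * k'] compensates the rescaling into
   [O]. *)
apply/nbhs_mxP; exists (Num.min d' (d / `|k * k'|)).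
  by rewrite lt_min d'0 divr_gt0// normr_gt0.
move=> w wv; have w0 : w != 0.
  by apply: nz => i j; apply: (lt_le_trans (wv i j)); rewrite ge_min lexx.
apply/(vlift_class _ w0); have [k2 k20 hw] := hcoord_class w0.
exists (k * k' / k2); first by rewrite mulf_neq0// invr_eq0.
rewrite hw scalerA divfK//; apply: dO => i j.
rewrite !mxE -mulrBr normrM mulrC -ltr_pdivlMr ?normr_gt0//.
by apply: (lt_le_trans (wv i j)); rewrite ge_min lexx orbT.
Qed.

Lemma nbhs_vlift N v (v0 : v != 0) : nbhs (proj_class v0) N <-> nbhs v (vlift N).
Proof.
split.
- rewrite nbhsE => -[B [oO Ov] ON].
  apply: (@filterS _ (nbhs v) _ (vlift B)) => [w Ow|].
    by apply/(vlift_class _ (vlift_neq0 Ow))/ON/vlift_class.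
  by apply: open_nbhs_nbhs; split; [exact/(open_vlift _ open_nonzero)|exact/vlift_class].
- rewrite nbhsE => -[B [oO Ov] ON]; rewrite nbhsE.
  exists [set p : RP R n | exists2 k : R, k != 0 & B (k *: hcoord p)].
    split; first exact: saturation_open.
    have [k k0 hv] := hcoord_class v0; exists k^-1; first by rewrite invr_eq0.
    by rewrite hv scalerK.
  move=> p [k k0 /ON Nk]; apply/vlift_hcoord/(vliftZ _ k0) => //.
  exact: hcoord_neq0.
Qed.

Lemma closure_mxP p q (D : set 'M[R]_(p, q)) (v : 'M[R]_(p, q)) : closure D v <->
  forall d : R, 0 < d -> exists2 w, D w & forall i j, `|w i j - v i j| < d.
Proof.
split=> [Cv d d0|h B /nbhs_mxP[d d0 dB]].
- have [|w [Cw wv]] := Cv [set w : 'M[R]_(p, q) | forall i j, `|w i j - v i j| < d].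
    by apply/nbhs_mxP; exists d.
  by exists w.
- by have [w Cw wv] := h _ d0; exists w; split=> //; exact: dB.
Qed.

Lemma closure_vlift W v (v0 : v != 0) :
  closure W (proj_class v0) <-> closure (vlift W) v.
Proof.
split=> [Wv B|Wv N /(nbhs_vlift _ v0)/Wv[w [Ww Nw]]].
- move=> Bv; pose N := [set p : RP R n | exists2 k : R, k != 0 & B (k *: hcoord p)].
  have : nbhs (proj_class v0) N.
    have /nbhs_mxP[d d0 dB] : nbhs v (B `&` nonzero_vectors).
      by apply: filterI => //; exact: open_nbhs_nbhs (conj open_nonzero v0).
    apply/(nbhs_vlift N v0)/nbhs_mxP; exists d => // w /dB[Bw w0].
    apply/(vlift_class _ w0).
    have [k k0 hw] := hcoord_class w0; exists k^-1; first by rewrite invr_eq0.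
    by rewrite hw scalerK.
  move=> /Wv[p [Wp [k k0 Bk]]]; exists (k *: hcoord p); split=> //.
  by apply: vlift_scale => //; exact/vlift_hcoord.
- have w0 := vlift_neq0 Ww; exists (proj_class w0).
  by split; exact/(vlift_class _ w0).
Qed.

Definition functional u v : R := (u *m v) 0 0.

Lemma functionalD u v w : functional u (v + w) = functional u v + functional u w.
Proof. by rewrite /functional mulmxDr mxE. Qed.
Lemma functionalZ u (k : R) v : functional u (k *: v) = k * functional u v.
Proof. by rewrite /functional -scalemxAr mxE. Qed.
Lemma functionalB u v w : functional u (v - w) = functional u v - functional u w.
Proof. by rewrite functionalD -scaleN1r functionalZ mulN1r. Qed.
Lemma functionalNl u v : functional (- u) v = - functional u v.
Proof. by rewrite /functional mulNmx mxE. Qed.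

Lemma functional_continuous u : continuous (functional u).
Proof.
rewrite (_ : functional u = (fun w : V => \sum_j u 0 j * w j 0)); last first.
  by apply/funext => w; rewrite /functional mxE.
move=> v; apply: (@cvg_big _ _ _ _ _ _ _ (nbhs v)) => [|j _].
  exact: add_continuous.
by apply: cvgM; [exact: cvg_cst|exact: coord_continuous].
Qed.

Lemma functional_gt0_open u : open [set v | 0 < functional u v].
Proof.
apply: (@open_comp _ _ (functional u) [set x | 0 < x]); last exact: open_gt.
by move=> v _; exact: functional_continuous.
Qed.

Lemma affine_patchE u p : affine_patch u p <-> functional u (hcoord p) != 0.
Proof. by []. Qed.

Lemma affine_patch_class u v (v0 : v != 0) :
  affine_patch u (proj_class v0) <-> functional u v != 0.
Proof.
have [k k0 hv] := hcoord_class v0; rewrite affine_patchE hv functionalZ.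
by rewrite mulf_eq0 negb_or k0.
Qed.

Lemma affine_coord_class u v (v0 : v != 0) :
  affine_coord u (proj_class v0) = (functional u v)^-1 *: v.
Proof.
have [k k0 hv] := hcoord_class v0; rewrite /affine_coord -/(functional _ _) hv.
by rewrite functionalZ scalerA invfM mulrAC mulVf// mul1r.
Qed.

(** The preimage of [W] is symmetric under negation; when [closure W] avoids the hyperplane of [u],
    it splits into two opposite cones, of which this is one. *)
Definition half_lift u W : set V := [set v | 0 < functional u v /\ vlift W v].

Section Domain.
Variables (u : 'rV[R]_n.+1) (W : set (RP R n)).
Hypotheses (oW : open W) (Wu : closure W `<=` affine_patch u).

Lemma vlift_functional_neq0 v : closure (vlift W) v -> v != 0 -> functional u v != 0.
Proof. by move=> Wv v0; apply/(affine_patch_class _ v0)/Wu/closure_vlift. Qed.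

Lemma half_lift_open : open (half_lift u W).
Proof.
apply: openI; last exact/(open_vlift _ open_nonzero).
exact: functional_gt0_open.
Qed.

Lemma half_liftP v : vlift W v -> half_lift u W v \/ half_lift u W (- v).
Proof.
move=> Wv; have := vlift_functional_neq0 (subset_closure Wv) (vlift_neq0 Wv).
rewrite neq_lt => /orP[h|h]; [right|by left].
split; last by rewrite -scaleN1r; apply: vlift_scale; rewrite ?oppr_eq0 ?oner_eq0.
by rewrite -scaleN1r functionalZ mulN1r oppr_gt0.
Qed.

Lemma half_liftZ (k : R) v : 0 < k -> half_lift u W v -> half_lift u W (k *: v).
Proof.
move=> k0 [uv Wv]; split; first by rewrite functionalZ mulr_gt0.
by apply: vlift_scale => //; rewrite gt_eqF.
Qed.

Lemma half_lift_neq0 v : half_lift u W v -> v != 0.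
Proof. by move=> [_]; exact: vlift_neq0. Qed.

(* An affine coordinate of the line through two points of the slice [u = 1] is
   continuous, so its image of the connected set [line & W] is an interval. *)
Lemma half_liftD v w :
  (forall p q, p != q -> connected (projective_line p q `&` W)) ->
  half_lift u W v -> half_lift u W w -> half_lift u W (v + w).
Proof.
move=> cW Cv Cw; have v0 := half_lift_neq0 Cv; have w0 := half_lift_neq0 Cw.
have [uv Wv] := Cv; have [uw Ww] := Cw.
have [/proj_classP[k k0 vk]|pq] := eqVneq (proj_class v0) (proj_class w0).
  rewrite vk -[X in _ + X]scale1r -scalerDl; apply: half_liftZ => //.
  apply: addr_gt0 => //; move: uv; rewrite vk functionalZ.
  by rewrite pmulr_lgt0.
pose a : V := (functional u v)^-1 *: v; pose b : V := (functional u w)^-1 *: w.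
have ab : a != b.
  apply: contraNneq pq => ab; apply/eqP/proj_classP.
  exists (functional u v / functional u w); first by rewrite mulf_neq0 ?invr_eq0 ?gt_eqF.
  by rewrite -scalerA -/b -ab scalerA mulfV ?scale1r// gt_eqF.
have [i abi] : exists i, b i 0 - a i 0 != 0.
  apply/existsP; apply: contraNT ab; rewrite negb_exists => /forallP h.
  by apply/eqP/colP => i; have := h i; rewrite negbK subr_eq0 => /eqP.
pose phi (x : V) : R := (x i 0 / functional u x - a i 0) / (b i 0 - a i 0).
have phiZ (k : R) x : k != 0 -> phi (k *: x) = phi x.
  move=> k0; rewrite /phi functionalZ mxE invfM mulrACA mulfV// mul1r//.
pose f := phi \o hcoord : RP R n -> R.
have fE x (x0 : x != 0) : f (proj_class x0) = phi x.
  by rewrite /f/=; have [k k0 ->] := hcoord_class x0; rewrite phiZ.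
pose S := projective_line (proj_class v0) (proj_class w0) `&` W.
have cf : {within S, continuous f}.
  apply: continuous_in_subspaceT => p /set_mem[_ Wp].
  have up : functional u (hcoord p) != 0 by apply/affine_patchE/Wu/subset_closure.
  move=> B fB; change (nbhs p (f @^-1` B)); rewrite -(hcoordK p).
  apply/nbhs_vlift.
  have cphi : {for hcoord p, continuous phi}.
    pose F := nbhs (hcoord p).
    have l1 : (fun x : V => x i 0) @ F --> hcoord p i 0 by exact: coord_continuous.
    have l2 : (fun x : V => (functional u x)^-1) @ F --> (functional u (hcoord p))^-1.
      by apply: cvgV => //; exact: functional_continuous.
    exact: (cvgM (cvgB (cvgM l1 l2) (cvg_cst _)) (cvg_cst _)).
  have /nbhs_mxP[d d0 dB] : nbhs (hcoord p) ((phi @^-1` B) `&` nonzero_vectors).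
    apply: filterI; last exact: open_nbhs_nbhs (conj open_nonzero (hcoord_neq0 p)).
    by apply: cphi; rewrite -(fE _ (hcoord_neq0 p)) hcoordK.
  apply/nbhs_mxP; exists d => // x /dB[Bx x0]; apply/(vlift_class _ x0).
  by rewrite /preimage/= fE.
have /connected_intervalP iS : connected (f @` S).
  by apply: connected_continuous_connected cf; exact: cW.
have ua : functional u a = 1 by rewrite functionalZ mulVf// gt_eqF.
have ub : functional u b = 1 by rewrite functionalZ mulVf// gt_eqF.
have f0 : (f @` S) 0.
  exists (proj_class v0); last first.
    by rewrite fE /phi (_ : v i 0 / _ = a i 0) ?subrr ?mul0r// mxE mulrC.
  split; last exact/vlift_class.
  by exists 1, 0; rewrite scale1r scale0r addr0.
have f1 : (f @` S) 1.
  exists (proj_class w0); last first.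
    by rewrite fE /phi (_ : w i 0 / _ = b i 0) ?divff// mxE mulrC.
  split; last exact/vlift_class.
  by exists 0, 1; rewrite scale1r scale0r add0r.
have uvw : 0 < functional u v + functional u w by exact: addr_gt0.
(* The vector [v + w], rescaled to the slice [u = 1], is [(1 - t) *: a + t *: b]. *)
pose t := functional u w / (functional u v + functional u w).
have [|p [[s [s' hp]] Wp] fp] := iS _ _ f0 f1 t.
  rewrite ler_pdivrMr// mul1r lerDr (ltW uv) andbT.
  by rewrite divr_ge0 ?ltW.
have [k k0 hv] := hcoord_class v0; have [k' k'0 hw] := hcoord_class w0.
pose s1 := s * k * functional u v; pose s2 := s' * k' * functional u w.
have hp' : hcoord p = s1 *: a + s2 *: b.
  rewrite hp hv hw /a /b !scalerA.
  by rewrite -!mulrA !mulfV ?gt_eqF// !mulr1.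
have up : functional u (hcoord p) = s1 + s2.
  rewrite hp' functionalD [functional u (s1 *: a)]functionalZ ua mulr1.
  by rewrite [functional u (s2 *: b)]functionalZ ub mulr1.
have s12 : s1 + s2 != 0.
  by rewrite -up; apply/affine_patchE/Wu/subset_closure.
have st : s2 = t * (s1 + s2).
  have hpi : hcoord p i 0 = s1 * a i 0 + s2 * b i 0 by rewrite hp' !mxE.
  rewrite -fp /f/= /phi up hpi.
  move: (a i 0) (b i 0) abi s12 => x y xy s12.
  by field; rewrite xy s12.
split; first by rewrite functionalD.
have e2 (k1 : R) : k1 != 0 ->
    (functional u v + functional u w) / k1 * (t * k1) = functional u w.
  by move=> k10; rewrite mulrC -mulrA [k1 * _]mulrC divfK// /t divfK// gt_eqF.
have e1 (k1 : R) : k1 != 0 ->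
    (functional u v + functional u w) / k1 * ((1 - t) * k1) = functional u v.
  by move=> k10; rewrite mulrBl mulrBr e2// mul1r divfK// addrK.
have h2 : (functional u v + functional u w) / (s1 + s2) * s2 = functional u w.
  by rewrite [X in _ * X]st e2.
have h1 : (functional u v + functional u w) / (s1 + s2) * s1 = functional u v.
  have s1E : s1 = (1 - t) * (s1 + s2) by rewrite mulrBl mul1r -st addrK.
  by rewrite [X in _ * X]s1E e1.
have -> : v + w = ((functional u v + functional u w) / (s1 + s2)) *: hcoord p.
  rewrite hp' scalerDr (scalerA _ s1 a) (scalerA _ s2 b) h1 h2.
  by rewrite !scalerA !mulfV ?gt_eqF// !scale1r.
by apply: vlift_scale; [rewrite mulf_neq0 ?invr_eq0// gt_eqF|exact/vlift_hcoord].
Qed.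

End Domain.
End ProjectiveTopology.

(** * The cross-ratio metric and the order of the cone *)

Section HilbertDistance.
Context {R : realType} {n : nat}.
Local Notation V := 'cV[R]_n.+1.
Implicit Types (C : set V) (u : 'rV[R]_n.+1) (W : set (RP R n)).

(** Replacing [v] by a nearby [z] in [C] changes [w] by the small vector [v - z], which the openness
    of [C] at [w] absorbs. *)
Lemma closure_coneD C (v w : V) : open_cone C -> closure C v -> C w -> C (v + w).
Proof.
move=> cC /closure_mxP Cv Cw; have [oC _ _ _] := cC.
have /nbhs_mxP[d d0 dC] := open_nbhs_nbhs (conj oC Cw).
have [z Cz zv] := Cv _ d0; rewrite -[v + w](subrKC z).
apply: (open_coneD cC) => //; apply: dC => i j.
have -> : (v + w - z) i j - w i j = v i j - z i j by rewrite !mxE addrAC addrK.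
by rewrite distrC.
Qed.

(* [Y] is the boundary point of [C] on the ray from [A] through [B]. *)
Lemma ray_exit C (A B Y : V) : open_cone C -> C A -> C B -> closure C Y -> ~ C Y ->
  strictly_between A B Y -> exists al : R,
  [/\ 0 < al, 0 < `|B - Y|, `|A - Y| = al * `|B - Y| &
      forall l : R, C (l *: B - A) <-> al < l].
Proof.
move=> cC CA CB clY nCY [s [/andP[s0 s1] BE]].
have s10 : 0 < 1 - s by rewrite subr_gt0.
have BY : B - Y = (1 - s) *: (A - Y).
  by rewrite BE; apply/colP => i; rewrite !mxE; ring.
have AY : 0 < `|A - Y|.
  by rewrite normr_gt0 subr_eq0; apply: contra_notN nCY => /eqP <-.
(* From [B = (1 - s) A + s Y], the vector [(1 - s)^-1 B - A] is a positive multiple of [Y], so this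
   is the value of [l] at which [l B - A] enters [C]. *)
exists (1 - s)^-1; split.
- by rewrite invr_gt0.
- by rewrite BY normrZ mulr_gt0// normr_gt0 gt_eqF.
- by rewrite BY normrZ gtr0_norm// mulrA mulVf ?mul1r// gt_eqF.
- move=> l.
  have sY : ((1 - s)^-1 * s) *: Y = (1 - s)^-1 *: B - A.
    rewrite BE scalerDr !scalerA mulVf ?gt_eqF// scale1r.
    by rewrite addrAC subrr add0r.
  have sp : 0 < (1 - s)^-1 * s by rewrite mulr_gt0// invr_gt0.
  split=> [Cl|ll].
    rewrite ltNge; apply/negP => ll; apply: nCY.
    rewrite -(scalerK (lt0r_neq0 sp) Y); apply: (open_coneZ cC).
      by rewrite invr_gt0.
    move: ll; rewrite le_eqVlt => /orP[/eqP ll|ll]; first by rewrite sY -ll.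
    rewrite sY -[(1 - s)^-1](subrK l) scalerDl -addrA; apply: (open_coneD cC) => //.
    by apply: (open_coneZ cC) => //; rewrite subr_gt0.
  rewrite -[l](subrK (1 - s)^-1) scalerDl -addrA -sY addrC.
  rewrite -[X in _ + X](scalerKV (lt0r_neq0 sp)) -scalerDr.
  apply: (open_coneZ cC) => //; apply: (closure_coneD cC) => //.
  by apply: (open_coneZ cC); rewrite ?invr_gt0//; apply: (open_coneZ cC) => //; rewrite subr_gt0.
Qed.


Lemma strictly_between_sym (x y z : V) : strictly_between x y z -> strictly_between z y x.
Proof.
move=> [t [/andP[t0 t1] ->]]; exists (1 - t); split; first by apply/andP; split; lra.
by rewrite subKr addrC.
Qed.

Lemma cross_ratio_lt C (A B X Y : V) (r : R) : open_cone C -> C A -> C B ->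
  closure C X -> closure C Y -> ~ C X -> ~ C Y ->
  strictly_between X A B -> strictly_between A B Y ->
  ln ((`|B - X| * `|A - Y|) / (`|B - Y| * `|A - X|)) < r <-> hilbert_lt C A B r.
Proof.
move=> cC CA CB clX clY nX nY XAB ABY.
have [al [al0 BY AY alP]] := ray_exit cC CA CB clY nY ABY.
have [be [be0 AX BX beP]] := ray_exit cC CB CA clX nX (strictly_between_sym XAB).
have -> : (`|B - X| * `|A - Y|) / (`|B - Y| * `|A - X|) = al * be.
  by rewrite BX AY; field; rewrite !gt_eqF.
have ab0 : 0 < al * be by exact: mulr_gt0.
have -> : (ln (al * be) < r) = (al * be < expR r).
  by rewrite -[in RHS](lnK ab0) ltr_expR.
split=> [abr|[l [m [l0 m0 /alP l1 /beP m1 lm]]]]; last first.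
  by apply: lt_trans lm; apply: ltr_pM => //; exact: ltW.
(* Both thresholds must be exceeded strictly; the factor [k] multiplies their product by the
   exponential of only half of the available gap. *)
pose k := expR ((r - ln (al * be)) / 4).
have lnr : ln (al * be) < r by rewrite -(expRK r) ltr_ln// posrE ?expR_gt0.
have k1 : 1 < k by rewrite expR_gt1; lra.
have k0 : 0 < k by exact: expR_gt0.
exists (al * k), (be * k); split; try exact: mulr_gt0.
- by apply/alP; rewrite ltr_pMr.
- by apply/beP; rewrite ltr_pMr.
- rewrite mulrACA -[al * be](lnK ab0) -!expRD ltr_expR; lra.
Qed.

(** A nonprincipal ultrafilter on [nat], playing the role of a convergent subsequence. *)
Lemma infinitely_many_ultra : exists U : set_system nat,
  UltraFilter U /\ forall N, \forall k \near U, (N <= k)%N.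
Proof.
have [U [UU oU]] := @ultraFilterLemma nat \oo _.
by exists U; split=> // N; apply: oU; exists N.
Qed.

Section Domain.
Variables (u : 'rV[R]_n.+1) (W : set (RP R n)).
Hypotheses (oW : open W) (Wu : closure W `<=` affine_patch u).
Hypothesis lW : forall p q, p != q -> connected (projective_line p q `&` W).
Let C := half_lift u W.

Lemma half_lift_cone : open_cone C.
Proof.
split.
- exact: half_lift_open.
- by move=> /half_lift_neq0; rewrite eqxx.
- by move=> v w; exact: half_liftD.
- by move=> k v; exact: half_liftZ.
Qed.

(** Otherwise vectors of [C] of [l^1] norm 1 with [functional u] tending to 0 would converge to a
    nonzero vector over [closure W] on the hyperplane of [u]. This is the quantitative form of the
    closure lying in an affine patch. *)
Lemma half_lift_bound :
  exists2 c : R, 0 < c & forall v, C v -> forall i, c * `|v i 0| <= functional u v.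
Proof.
apply: contrapT => hn.
have /choice[v_ hv] : forall k : nat, exists v, C v /\ exists i,
    functional u v < k.+1%:R^-1 * `|v i 0|.
  move=> k; apply: contrapT => hk; apply: hn.
  exists k.+1%:R^-1; first by rewrite invr_gt0.
  move=> v Cv i; rewrite leNgt; apply/negP => h; apply: hk.
  by exists v; split=> //; exists i.
pose S (v : V) : R := \sum_i `|v i 0|.
have S0 k : 0 < S (v_ k).
  have [Cv _] := hv k; have := half_lift_neq0 Cv.
  rewrite lt_neqAle sumr_ge0// andbT; apply: contraNneq => S0.
  apply/eqP/colP => i; rewrite mxE; apply/eqP; rewrite -normr_le0 S0.
  by rewrite /S (bigD1 i)//= lerDl sumr_ge0.
have [U [UU Uoo]] := infinitely_many_ultra.
pose w_ k : V := (S (v_ k))^-1 *: v_ k.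
have Cw k : C (w_ k) by apply: half_liftZ; [rewrite invr_gt0|case: (hv k)].
have Sw k : S (w_ k) = 1.
  rewrite /S /w_; under eq_bigr do rewrite mxE normrM gtr0_norm ?invr_gt0//.
  by rewrite -mulr_sumr mulVf// gt_eqF.
have w1 k i : `|w_ k i 0| <= 1.
  by rewrite -(Sw k) /S (bigD1 i)//= lerDl sumr_ge0.
have uw k : functional u (w_ k) < k.+1%:R^-1.
  have [_ [i hi]] := hv k; rewrite functionalZ mulrC ltr_pdivrMr//.
  apply: lt_le_trans hi _; rewrite ler_pM2l ?invr_gt0//.
  by rewrite /S (bigD1 i)//= lerDl sumr_ge0.
have [w lw] : exists w : V, mxlim U w_ w.
  apply: (@mxlim_bounded _ _ _ _ _ _ _ 1); apply: nearW => k i j.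
  by rewrite ord1.
have Sw1 : S w = 1.
  have l1 : (fun k => S (w_ k)) @ U --> S w.
    apply: cvg_big => [|i _]; first exact: add_continuous.
    exact: cvg_norm.
  apply: (@norm_cvg_unique _ _ ((fun k => S (w_ k)) @ U) _ _ _ l1).
  rewrite (_ : (fun _ => _) = fun=> 1); first exact: cvg_cst.
  by apply/funext => k; rewrite Sw.
have w0 : w != 0.
  apply/eqP => w0; move: Sw1; rewrite w0 /S big1 => [/eqP|i _].
    by rewrite eq_sym oner_eq0.
  by rewrite mxE normr0.
have clw : closure (vlift W) w.
  apply/closure_mxP => d d0; have [k hk] := filter_ex (mxlim_near d0 lw).
  by exists (w_ k) => //; case: (Cw k).
have := vlift_functional_neq0 Wu clw w0.
have luw : (fun k => functional u (w_ k)) @ U --> functional u w.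
  exact: (mxlim_mul (mxlim_cst u) lw).
rewrite eq_le negb_and -!ltNge => /orP[]; apply/negP; rewrite -leNgt.
- apply/ler_addgt0Pr => e e0; rewrite add0r; apply: (cvgr_to_le luw).
  have [N hN] : exists N : nat, N.+1%:R^-1 < e.
    by have /ltr_add_invr[N hN] := e0; exists N; rewrite add0r in hN.
  apply: filterS (Uoo N) => k Nk; apply/ltW/(lt_le_trans (uw k))/ltW.
  by apply: le_lt_trans hN; rewrite lef_pV2 ?posrE// ler_nat.
- apply: (cvgr_to_ge luw); apply: nearW => k.
  by apply: ltW; case: (Cw k).
Qed.


Lemma closure_half_lift v (v0 : v != 0) : 0 < functional u v ->
  closure W (proj_class v0) -> closure C v.
Proof.
move=> uv /closure_vlift clv B Bv.
have pu : nbhs v [set w | 0 < functional u w].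
  by apply: open_nbhs_nbhs; split=> //; exact: functional_gt0_open.
by have [w [Ww [Bw uw]]] := clv _ (filterI Bv pu); exists w.
Qed.

(** With [al] the infimum of the [l] such that [l B - A] is in [C], the vector [Z = al B - A] is on
    the boundary of the cone, and [Y] is [Z] scaled to the slice. *)
Lemma half_lift_exit (A B : V) : C A -> C B -> functional u A = 1 ->
  functional u B = 1 -> A != B -> exists Y : V,
  [/\ closure C Y, ~ C Y, functional u Y = 1 & strictly_between A B Y].
Proof.
move=> CA CB uA uB AB; have cC := half_lift_cone.
pose L := [set l : R | C (l *: B - A)].
have L0 : L !=set0.
  have [d d0 dC] := open_cone_shrink (- A) cC CB.
  have d2 : 0 < d / 2 < d by apply/andP; split; lra.
  exists (d / 2)^-1; rewrite /L/= -[A](scalerK (lt0r_neq0 (proj1 (andP d2)))).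
  rewrite -scalerBr; apply: (open_coneZ cC); first by rewrite invr_gt0 (proj1 (andP d2)).
  by rewrite -scalerN; exact: dC.
have Lp l : L l -> 0 < l.
  move=> Ll; apply: (open_coneZ_gt0 cC CB).
  by rewrite -(subrK A (l *: B)); exact: (open_coneD cC).
have Lb : has_inf L by split=> //; exists 0 => l /Lp/ltW.
pose al := inf L; pose Z : V := al *: B - A.
have Lup l : al < l -> L l.
  move=> /(inf_lt L0)[m Lm ml]; rewrite /L/= -(subrK m l) scalerDl -addrA.
  apply: (open_coneD cC) => //; apply: (open_coneZ cC) => //.
  by rewrite subr_gt0.
have clZ : closure C Z.
  apply/closure_mxP => d d0; pose K := 1 + \sum_i `|B i 0|.
  have K0 : 0 < K by rewrite ltr_pwDl// sumr_ge0.
  exists ((al + d / K) *: B - A); first by apply: Lup; rewrite ltrDl divr_gt0.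
  move=> i j; rewrite ord1 !mxE.
  have -> : (al + d / K) * B i 0 - A i 0 - (al * B i 0 - A i 0) = d / K * B i 0.
    by ring.
  rewrite normrM gtr0_norm ?divr_gt0//.
  rewrite mulrAC ltr_pdivrMr// ltr_pM2l// /K (bigD1 i)//= addrCA ltrDl.
  by rewrite ltr_pwDl// sumr_ge0.
have nZ : ~ C Z.
  move=> CZ; have [d d0 dC] := open_cone_shrink (- B) cC CZ.
  have d2 : 0 < d / 2 < d by apply/andP; split; lra.
  have : L (al - d / 2).
    by rewrite /L/= scalerBl addrAC -scalerN; exact: dC.
  by move=> /(ge_inf Lb.2); rewrite -/al; move: (proj1 (andP d2)); lra.
have uZ : functional u Z = al - 1 by rewrite functionalB functionalZ uB uA mulr1.
have [c c0 cb] := half_lift_bound.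
have Zb i : c * `|Z i 0| <= al - 1.
  have k0 : 0 < 1 + c * `|B i 0| by rewrite ltr_pwDl// mulr_ge0// ltW.
  apply/ler_addgt0Pr => e e0; pose t := e / (1 + c * `|B i 0|).
  have t0 : 0 < t by exact: divr_gt0.
  have /cb/(_ i) : C ((al + t) *: B - A) by apply: Lup; rewrite ltrDl.
  rewrite functionalB functionalZ uB uA mulr1.
  rewrite scalerDl addrAC -/Z [(Z + _) i 0]mxE [(t *: B) i 0]mxE => h.
  have : c * `|Z i 0| <= c * (`|Z i 0 + t * B i 0| + t * `|B i 0|).
    rewrite ler_pM2l// -{2}(gtr0_norm t0) -normrM.
    by rewrite -{1}[Z i 0](addrK (t * B i 0)) (le_trans (ler_normB _ _)).
  have te : t + c * (t * `|B i 0|) = e by rewrite /t; field; rewrite gt_eqF.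
  by rewrite mulrDr; lra.
(* If [al <= 1], the bound [Zb] forces [Z = 0]; evaluating [u] gives [al = 1], and then [A = B]. *)
have al1 : 1 < al.
  rewrite ltNge; apply/negP => al1; move/eqP: AB; apply.
  have Z0 : Z = 0.
    apply/colP => i; rewrite [RHS]mxE; apply/eqP; rewrite -normr_le0.
    by rewrite -(pmulr_rle0 _ c0) (le_trans (Zb i))// subr_le0.
  have al1' : al = 1.
    by apply/eqP; rewrite eq_sym -subr_eq0 -opprB oppr_eq0 -uZ Z0 -(scale0r 0) functionalZ mul0r.
  by move: Z0; rewrite /Z al1' scale1r => /eqP; rewrite subr_eq0 => /eqP.
have al0 : 0 < al - 1 by rewrite subr_gt0.
exists ((al - 1)^-1 *: Z); split.
- apply/closure_mxP => d d0; have d'0 : 0 < d * (al - 1) by exact: mulr_gt0.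
  move/closure_mxP : clZ => /(_ _ d'0)[w Cw wZ].
  exists ((al - 1)^-1 *: w); first by apply: (open_coneZ cC); rewrite ?invr_gt0.
  move=> i j; rewrite !mxE -[X in _ * X - _]/(w i j) -mulrBr normrM.
  by rewrite gtr0_norm ?invr_gt0// mulrC ltr_pdivrMr//; have := wZ i j; rewrite !mxE.
- move=> CY; apply: nZ; rewrite -(scalerKV (lt0r_neq0 al0) Z).
  exact: (open_coneZ cC).
- by rewrite functionalZ uZ mulVf// gt_eqF.
- exists ((al - 1) / al); split.
    have ap : 0 < al by exact: lt_trans al1.
    apply/andP; split; first exact: divr_gt0.
    by rewrite ltr_pdivrMr// mul1r gtrBl.
  apply/colP => i; rewrite !mxE; field.
  by rewrite !gt_eqF// (lt_trans _ al1).
Qed.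

(** If [Y] were interior to [closure W], a point [w] slightly beyond [Y] on the ray from [A] would
    be in the closure of [C]; then [Y], a positive combination of [w] and [A], would be in [C]. *)
Lemma exit_boundary (A Y : V) (Y0 : Y != 0) : C A -> closure C Y -> ~ C Y ->
  functional u A = 1 -> functional u Y = 1 -> boundary (closure W) (proj_class Y0).
Proof.
move=> CA clY nY uA uY; have cC := half_lift_cone.
split.
  rewrite -((closure_id _).1 (@closed_closure _ W)).
  apply/closure_vlift => B /clY[w [[_ Ww] Bw]]; by exists w.
move=> /(nbhs_vlift _ Y0) /nbhs_mxP[d d0 dW].
pose K := 1 + \sum_i `|Y i 0 - A i 0|.
have K0 : 0 < K by rewrite ltr_pwDl// sumr_ge0.
pose t := d / K; have t0 : 0 < t by exact: divr_gt0.
pose w : V := Y + t *: (Y - A).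
have Ww : vlift (closure W) w.
  apply: dW => i j; rewrite ord1 !mxE addrAC subrr add0r normrM gtr0_norm//.
  rewrite /t mulrAC ltr_pdivrMr// ltr_pM2l// /K (bigD1 i)//= addrCA ltrDl.
  by rewrite ltr_pwDl// sumr_ge0.
have w0 := vlift_neq0 Ww.
have uw : functional u w = 1.
  by rewrite /w functionalD functionalZ functionalB uY uA subrr mulr0 addr0.
have clw : closure C w.
  have Wcw := (vlift_class _ w0).1 Ww; have uw0 : 0 < functional u w by rewrite uw.
  exact: (closure_half_lift uw0 Wcw).
apply: nY; have t1 : 0 < 1 + t by rewrite addr_gt0.
rewrite -(scalerK (lt0r_neq0 t1) Y); apply: (open_coneZ cC); first by rewrite invr_gt0.
have -> : (1 + t) *: Y = w + t *: A.
  by rewrite /w scalerBr addrA subrK scalerDl scale1r.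
by apply: (closure_coneD cC) => //; exact: (open_coneZ cC).
Qed.

Lemma boundary_half_lift x : boundary (closure W) x ->
  [/\ closure C (affine_coord u x), ~ C (affine_coord u x) &
     functional u (affine_coord u x) = 1].
Proof.
move=> [clx nx]; have {}clx : closure W x.
  by move: clx; rewrite -((closure_id _).1 (@closed_closure _ W)).
have ux : functional u (hcoord x) != 0 by exact/affine_patchE/Wu.
have u1 : functional u (affine_coord u x) = 1.
  by rewrite /affine_coord -/(functional u _) functionalZ mulVf.
have x0 : affine_coord u x != 0.
  by apply/eqP => x0; move: u1; rewrite x0 /functional mulmx0 mxE => /eqP; rewrite eq_sym oner_eq0.
have xE : proj_class x0 = x.
  rewrite -[RHS]hcoordK; apply/proj_classP; exists (functional u (hcoord x))^-1 => //.
  by rewrite invr_eq0.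
have clx0 : closure W (proj_class x0) by rewrite xE.
have ux0 : 0 < functional u (affine_coord u x) by rewrite u1.
split=> //; first exact: (closure_half_lift ux0 clx0).
move=> [_ /(vlift_class _ x0)]; rewrite xE => Wx; apply: nx.
have : nbhs x W by exact: open_nbhs_nbhs.
by apply: filterS; exact: subset_closure.
Qed.

End Domain.
End HilbertDistance.

Section HilbertDistanceLt.
Context {R : realType} {n : nat}.
Local Notation V := 'cV[R]_n.+1.
Implicit Types (u : 'rV[R]_n.+1) (W : set (RP R n)).

(** If [u] took both signs, at [v] and [w], it would vanish at a positive combination of them. *)
Lemma functional_sign (C : set V) u : open_cone C ->
  (forall v, C v -> functional u v != 0) ->
  (forall v, C v -> 0 < functional u v) \/ (forall v, C v -> functional u v < 0).
Proof.
move=> cC nz; apply: contrapT => /not_orP[].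
move=> /existsNP[v /not_implyP[Cv /negP uv]] /existsNP[w /not_implyP[Cw /negP uw]].
have uv0 : functional u v < 0 by rewrite lt_neqAle nz// leNgt.
have uw0 : 0 < functional u w by rewrite lt_neqAle eq_sym nz// leNgt.
have : C (functional u w *: v + (- functional u v) *: w).
  by apply: (open_coneD cC); apply: (open_coneZ cC); rewrite ?oppr_gt0.
move=> /nz; rewrite functionalD !functionalZ mulNr mulrC subrr eqxx//.
Qed.

Section Element.
Variables (u : 'rV[R]_n.+1) (W : set (RP R n)).
Hypotheses (oW : open W) (Wu : closure W `<=` affine_patch u).
Hypothesis lW : forall p q, p != q -> connected (projective_line p q `&` W).
Variables (a b : V) (a0 : a != 0) (b0 : b != 0).
Hypotheses (Ca : half_lift u W a) (Cb : half_lift u W b).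
Let cC := half_lift_cone oW Wu lW.

Lemma half_lift_cross_ratio x y r :
  boundary (closure W) x -> boundary (closure W) y ->
  let a' := affine_coord u (proj_class a0) in
  let b' := affine_coord u (proj_class b0) in
  let x' := affine_coord u x in let y' := affine_coord u y in
  strictly_between x' a' b' -> strictly_between a' b' y' ->
  ln ((`|b' - x'| * `|a' - y'|) / (`|b' - y'| * `|a' - x'|)) < r <->
  hilbert_lt (half_lift u W) a b r.
Proof.
move=> bx byy /= xab aby.
have [clx nx _] := boundary_half_lift oW Wu bx.
have [cly ny _] := boundary_half_lift oW Wu byy.
have ua : 0 < (functional u a)^-1 by rewrite invr_gt0; case: Ca.
have ub : 0 < (functional u b)^-1 by rewrite invr_gt0; case: Cb.
rewrite -(hilbert_lt_scale cC a b r ua ub) -(affine_coord_class u a0).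
rewrite -(affine_coord_class u b0).
apply: (cross_ratio_lt r cC _ _ clx cly nx ny xab aby).
- by rewrite affine_coord_class; exact: half_liftZ.
- by rewrite affine_coord_class; exact: half_liftZ.
Qed.

End Element.

Lemma affine_coordN u p : affine_coord (- u) p = - affine_coord u p :> V.
Proof.
by rewrite /affine_coord -!/(functional _ _) functionalNl invrN scaleNr.
Qed.

Lemma strictly_betweenN (x y z : V) :
  strictly_between x y z -> strictly_between (- x) (- y) (- z).
Proof. by move=> [t [t01 ->]]; exists t; rewrite opprD !scalerN. Qed.

(** The patch selected by [hilbert_dist] is unknown; this identifies its cone with the fixed one. *)
Lemma half_lift_change u u' W : closure W `<=` affine_patch u ->
  (forall v, half_lift u W v -> 0 < functional u' v) ->
  half_lift u' W = half_lift u W.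
Proof.
move=> Wu h; apply/seteqP; split=> v [uv Wv]; last by split=> //; exact: h.
have [//|/h] := half_liftP Wu Wv.
by rewrite -scaleN1r functionalZ mulN1r oppr_gt0 => /lt_trans/(_ uv); rewrite ltxx.
Qed.

Lemma hilbert_dist_lt u W (a b : V) (a0 : a != 0) (b0 : b != 0) r :
  open W -> closure W `<=` affine_patch u ->
  (forall p q, p != q -> connected (projective_line p q `&` W)) ->
  half_lift u W a -> half_lift u W b ->
  hilbert_dist W (proj_class a0) (proj_class b0) < r <->
  hilbert_lt (half_lift u W) a b r.
Proof.
move=> oW Wu lW Ca Cb; have cC := half_lift_cone oW Wu lW.
have [ua _] := Ca; have [ub _] := Cb.
rewrite /hilbert_dist; have [/proj_classP[k k0 ak]|ab] := eqVneq.
  have k1 : 0 < k by move: ua; rewrite ak functionalZ pmulr_lgt0.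
  split; last exact: (hilbert_lt_gt0 cC).
  move=> r0; rewrite ak -[X in hilbert_lt _ _ X _]scale1r.
  exact/(hilbert_lt_scale cC _ _ _ k1 ltr01)/hilbert_lt_refl.
set S := [set d | _].
have S0 : S !=set0.
  pose A : V := (functional u a)^-1 *: a; pose B : V := (functional u b)^-1 *: b.
  have CA : half_lift u W A by apply: half_liftZ; rewrite ?invr_gt0.
  have CB : half_lift u W B by apply: half_liftZ; rewrite ?invr_gt0.
  have uA : functional u A = 1 by rewrite functionalZ mulVf// gt_eqF.
  have uB : functional u B = 1 by rewrite functionalZ mulVf// gt_eqF.
  have AB : A != B.
    apply: contraNneq ab => AB; apply/eqP/proj_classP.
    exists (functional u a / functional u b); first by rewrite mulf_neq0 ?invr_eq0 ?gt_eqF.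
    by rewrite -scalerA -/B -AB scalerA mulfV ?scale1r// gt_eqF.
  have BA : B != A by rewrite eq_sym.
  have [Y [clY nY uY ABY]] := half_lift_exit oW Wu lW CA CB uA uB AB.
  have [X [clX nX uX BAX]] := half_lift_exit oW Wu lW CB CA uB uA BA.
  have n0 (Z : V) : functional u Z = 1 -> Z != 0.
    by apply: contra_eq_neq => ->; rewrite /functional mulmx0 mxE eq_sym oner_neq0.
  have X0 := n0 _ uX; have Y0 := n0 _ uY.
  eexists; exists u, (proj_class X0), (proj_class Y0).
  rewrite !affine_coord_class uX uY invr1 !scale1r -/A -/B; split; last reflexivity.
  - split=> //; apply: contraTneq ua => ->.
    by rewrite /functional mul0mx mxE ltxx.
  - by split; [exact: (exit_boundary oW Wu lW X0 CA)|exact: (exit_boundary oW Wu lW Y0 CA)].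
  - exact: strictly_between_sym.
  - exact: ABY.
(* [xget] returns the value of an unknown patch [u'] and unknown endpoints. [u'] has a constant sign
   on the cone; if the sign is negative, [- u'] has the same cone and negates all affine
   coordinates, which changes no norm. *)
have := xgetPex 0 S0; set d := xget 0 S.
case=> u' [x [y /= [[u'0 Wu'] [bx byy] xab aby dE]]].
have nz v : half_lift u W v -> functional u' v != 0.
  by move=> [_ Wv]; apply: (vlift_functional_neq0 Wu' (subset_closure Wv)); exact: vlift_neq0 Wv.
have [pos|neg] := functional_sign cC nz.
  have E := half_lift_change Wu pos; rewrite dE -E.
  by apply: half_lift_cross_ratio; rewrite ?E.
have pos v : half_lift u W v -> 0 < functional (- u') v.
  by move=> /neg; rewrite functionalNl oppr_gt0.
have Wu'' : closure W `<=` affine_patch (- u').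
  by move=> p /Wu'; rewrite !affine_patchE functionalNl oppr_eq0.
have E := half_lift_change Wu pos; rewrite dE -E.
have normN p q : `|affine_coord u' p - affine_coord u' q| =
    `|affine_coord (- u') p - affine_coord (- u') q|.
  by rewrite !affine_coordN -opprD normrN.
rewrite !normN.
apply: half_lift_cross_ratio; rewrite ?E// !affine_coordN; exact: strictly_betweenN.
Qed.

End HilbertDistanceLt.

(** * From manifolds to cones and matrix groups *)

Section InvertibleMatrices.
Context {R : realType} {n : nat}.

Lemma open_invertible : open (@invertible_matrices R n).
Proof.
rewrite openE => A /= uA.
have cdet : (fun B : 'M[R]_n.+1 => \det B) @ nbhs A --> \det A.
  apply: (@cvg_big _ _ _ _ _ _ _ (nbhs A)) => [|s _]; first exact: add_continuous.
  apply: cvgM; first exact: cvg_cst.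
  apply: (@cvg_big _ _ _ _ _ _ _ (nbhs A)) => [|i _]; first exact: mul_continuous.
  exact: coord_continuous.
rewrite /invertible_matrices/= unitmxE unitfE -normr_gt0 in uA.
move/cvgrPdist_lt : cdet => /(_ _ uA); apply: filterS => B.
rewrite /invertible_matrices/= unitmxE unitfE; apply: contraTneq => ->.
by rewrite subr0 ltxx.
Qed.

Lemma vlift_pgl (N : set (PGL R n)) (A : 'M[R]_n.+1) (uA : A \in unitmx) :
  vlift N A <-> N (pgl_class uA).
Proof.
split=> [[w wA Nw]|NA].
  suff -> : pgl_class uA = \pi_(PGL R n) w by [].
  by congr \pi; apply: val_inj; rewrite wA.
by exists (SigSub (mem_set uA : A \in invertible_matrices)).
Qed.

Lemma pgl_classX (A : 'M[R]_n.+1) (uA : A \in unitmx) k : exists uAk : A ^+ k \in unitmx,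
  (pgl_class uA ^+ k)%g = pgl_class uAk.
Proof.
elim: k => [|k [uAk IH]].
  have u1 : A ^+ 0 \in unitmx by rewrite expr0 unitmx1.
  exists u1; rewrite expg0; apply/pgl_classP; exists 1; first exact: oner_neq0.
  by rewrite scale1r expr0.
have u1 : A ^+ k.+1 \in unitmx by rewrite exprS -mulmxE; exact: mulmx_unit.
exists u1; rewrite expgS IH [(_ * _)%g]pgl_mulE; apply/pgl_classP.
by exists 1; rewrite ?oner_neq0// scale1r exprS.
Qed.

Lemma pgl_class_scalar (A : 'M[R]_n.+1) (uA : A \in unitmx) :
  pgl_class uA = 1%g <-> exists c : R, A = c%:M.
Proof.
split.
  move=> /(@pgl_classP _ _ _ _ uA (unitmx1 R n.+1))[c _ ->].
  by exists c; rewrite scalemx1.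
move=> [c Ac]; apply/pgl_classP; exists c; last by rewrite scalemx1.
apply: contraTneq uA => c0.
by rewrite Ac c0 unitmxE det_scalar expr0n/= unitr0.
Qed.

End InvertibleMatrices.

Section ManifoldCone.
Context {R : realType} {n : nat} (M : convex_manifold R n).
Local Notation V := 'cV[R]_n.+1.
Variable u : 'rV[R]_n.+1.
Let W := domain M.
Hypothesis Wu : closure W `<=` affine_patch u.
Let oW : open W. Proof. exact: domain_open. Qed.
Let lW : forall p q, p != q -> connected (projective_line p q `&` W).
Proof. by case: (domain_convex M). Qed.
Let C := half_lift u W.
Let cC : open_cone C. Proof. exact: half_lift_cone. Qed.

(** The second condition discards the representatives that exchange [C] and [- C]. *)
Definition holonomy_matrices : set 'M[R]_n.+1 :=
  [set A | (exists uA : A \in unitmx, holonomy M (pgl_class uA)) /\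
           forall v, C v -> C (A *m v)].
Let G := holonomy_matrices.

Let hol1 : holonomy M 1%g.
Proof. by have [/set_mem] := holonomy_group M. Qed.

Let holM g h : holonomy M g -> holonomy M h -> holonomy M (g * h)%g.
Proof.
move=> Mg Mh; apply: set_mem; apply: (group_closedM (holonomy_group M));
  exact: mem_set.
Qed.

Let holV g : holonomy M g -> holonomy M (g^-1)%g.
Proof.
move=> Mg; apply: set_mem; apply: (group_closedV (holonomy_group M)); exact: mem_set.
Qed.

Let hol_vlift A (uA : A \in unitmx) v : holonomy M (pgl_class uA) -> vlift W v ->
  vlift W (A *m v).
Proof.
move=> MA Wv; have v0 := vlift_neq0 Wv; move: Wv => /(vlift_class _ v0) Wv.
apply/(vlift_class _ (mulmx_neq0 uA v0)); rewrite -homographyE.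
rewrite /W -(holonomy_domain MA); by exists (proj_class v0).
Qed.

(** Each vector of [C] is sent into [C] or [- C]; since [functional (u *m A)] does not vanish on
    [C], its sign is constant, and so one of [A], [- A] works for all vectors at once. *)
Lemma holonomy_matricesP g : holonomy M g -> exists A (uA : A \in unitmx),
  G A /\ pgl_class uA = g.
Proof.
move=> Mg; pose A := pgl_mx g.
have [uA gA] : exists uA : A \in unitmx, pgl_class uA = g.
  by exists (pgl_mx_unit g); exact: pgl_mxK.
have MA : holonomy M (pgl_class uA) by rewrite gA.
have CA v : C v -> C (A *m v) \/ C (- (A *m v)).
  by move=> [_ Wv]; apply: (half_liftP Wu); exact: (hol_vlift MA).
have nz v : C v -> functional (u *m A) v != 0.
  move=> Cv; rewrite /functional -mulmxA -/(functional _ _).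
  have := CA _ Cv; rewrite -[- _]scaleN1r.
  by move=> [[]|[]]; rewrite ?functionalZ ?mulN1r ?oppr_gt0 neq_lt => -> _; rewrite ?orbT.
have uN : - A \in unitmx by rewrite -scaleN1r unitmxZ// unitrN1.
have fA v : functional (u *m A) v = functional u (A *m v).
  by rewrite /functional mulmxA.
have [pos|neg] := functional_sign cC nz.
  exists A, uA; split=> //.
  split; first by exists uA.
  move=> v Cv; have [//|[+ _]] := CA _ Cv; have := pos _ Cv; rewrite fA.
  by rewrite -scaleN1r functionalZ mulN1r oppr_gt0 => /lt_trans h /h; rewrite ltxx.
have NA : pgl_class uN = pgl_class uA.
  by apply/pgl_classP; exists (-1); rewrite ?oppr_eq0 ?oner_eq0// scaleN1r.
exists (- A), uN; split; last by rewrite NA.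
split; first by exists uN; rewrite NA.
move=> v Cv; rewrite mulNmx; have [[+ _]|//] := CA _ Cv; have := neg _ Cv; rewrite fA.
by move=> /lt_trans h /h; rewrite ltxx.
Qed.

Lemma holonomy_matrix_group : matrix_group G.
Proof.
split.
- by move=> A [[]].
- move=> c c0; have uc : (c%:M : 'M[R]_n.+1) \in unitmx.
    by rewrite unitmxE det_scalar unitfE expf_neq0// gt_eqF.
  split; last by move=> v Cv; rewrite mul_scalar_mx; exact: (open_coneZ cC).
  by exists uc; rewrite (_ : pgl_class uc = 1%g)//; apply/pgl_class_scalar; exists c.
- move=> A B [[uA MA] CA] [[uB MB] CB]; split; last first.
    by move=> v Cv; rewrite -mulmxA; exact/CA/CB.
  by exists (mulmx_unit uA uB); rewrite -pgl_mulE; exact: holM.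
- move=> A [[uA MA] CA]; have MV : holonomy M (pgl_class (invmx_unit uA)).
    by rewrite -pgl_invE; exact: holV.
  split; first by exists (invmx_unit uA).
  move=> v Cv; have [_ Wv] := Cv.
  have [//|/CA] := half_liftP Wu (hol_vlift MV Wv).
  by rewrite mulmxN mulKVmx// => /(open_coneN cC Cv).
Qed.

Lemma holonomy_torsion : torsion_free G.
Proof.
move=> A k [[uA MA] _] k0 Ak; apply/(pgl_class_scalar uA).
apply: (holonomy_torsion_free MA k0).
by have [uAk ->] := pgl_classX uA k; apply/pgl_class_scalar.
Qed.

Lemma holonomy_matrices_isolated : exists2 d : R, 0 < d &
  forall A, G A -> (forall i j, `|A i j - (1%:M : 'M[R]_n.+1) i j| < d) ->
    exists c : R, A = c%:M.
Proof.
have [_ [N N1 NM]] := holonomy_discrete hol1.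
move: N1; rewrite nbhsE => -[B [oB B1] BN].
have /nbhs_mxP[d d0 dB] : nbhs (1%:M : 'M[R]_n.+1) (vlift B).
  apply: open_nbhs_nbhs; split; first exact/(open_vlift _ open_invertible).
  exact/(vlift_pgl _ (unitmx1 R n.+1)).
exists d => // A [[uA MA] _] /dB/(vlift_pgl _ uA)/BN NA.
apply/(pgl_class_scalar uA).
by have : (N `&` holonomy M) (pgl_class uA) by []; rewrite NM.
Qed.

(** The points [b] plus or minus [d / 2] times a basis vector are in [C], and so are their images.
    The values of [functional u] at these images add up to twice its value at [b], and
    [half_lift_bound] turns this into a bound on the entries. *)
Lemma stabilizer_bounded (b : V) : C b -> exists K : R, forall A, G A -> A *m b = b ->
  forall i j, `|A i j| <= K.
Proof.
move=> Cb; have [c c0 cb] := half_lift_bound Wu.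
have [oC _ _ _] := cC; have /nbhs_mxP[d d0 dC] := open_nbhs_nbhs (conj oC Cb).
exists (functional u b / (c * (d / 2))) => A [_ CA] Ab i j.
have hs (s : R) : `|s| = 1 -> c * `|b i 0 + s * (d / 2) * A i j| <=
    functional u b + s * functional u (A *m ((d / 2) *: delta_mx j 0)).
  move=> s1; have : C (b + s *: ((d / 2) *: delta_mx j 0)).
    apply: dC => k l; rewrite ord1 !mxE addrAC subrr add0r normrM normrM s1 mul1r.
    rewrite eqxx andbT (gtr0_norm (divr_gt0 d0 _))//.
    by case: (k == j); rewrite ?normr1 ?normr0; lra.
  move=> /CA /cb/(_ i); rewrite mulmxDr Ab -!scalemxAr functionalD functionalZ.
  by rewrite -colE !mxE mulrA.
have h1 := hs 1 (normr1 _); have h2 := hs (-1) (normrN1 _).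
have cd : 0 < c * (d / 2) by rewrite mulr_gt0// divr_gt0.
rewrite ler_pdivlMr//; move: h1 h2; rewrite !mul1r !mulN1r !mulNr.
set x := d / 2 * A i j; set y := functional u (A *m _) => h1 h2.
have -> : `|A i j| * (c * (d / 2)) = c * `|x|.
  by rewrite /x normrM (@gtr0_norm _ (d / 2)) ?divr_gt0//; ring.
have : `|x| * 2 <= `|b i 0 + x| + `|b i 0 - x|.
  have -> : `|x| * 2 = `|(b i 0 + x) - (b i 0 - x)|.
    have -> : b i 0 + x - (b i 0 - x) = x * 2 by ring.
    by rewrite (normrM x) normr_nat.
  exact: ler_normB.
by rewrite -(ler_pM2l c0) mulrDr; lra.
Qed.

(* Powers of a matrix fixing a point of the domain stay in a compact group, so
   two of them are close; by discreteness their quotient is trivial. *)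
Lemma holonomy_free A b (k : R) : G A -> C b -> A *m b = k *: b ->
  exists c : R, A = c%:M.
Proof.
move=> GA Cb Ab; have mG := holonomy_matrix_group.
have [uG _ _ GV] := mG; have k0 : 0 < k.
  by apply: (open_coneZ_gt0 cC Cb); rewrite -Ab; case: GA => _; apply.
pose B := k^-1 *: A.
have GB : G B by apply: matrix_groupZ => //; rewrite invr_gt0.
have Bb : B *m b = b by rewrite -scalemxAl Ab scalerK// gt_eqF.
have Bj j : (B ^+ j) *m b = b.
  elim: j => [|j IH]; first by rewrite expr0 mul1mx.
  by rewrite exprSr -mulmxE -mulmxA Bb.
have [K hK] := stabilizer_bounded Cb.
have [U [UU Uoo]] := infinitely_many_ultra.
have GBj j : G (B ^+ j) by exact: matrix_groupX.
have Vb j : invmx (B ^+ j) *m b = b.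
  by rewrite -{1}(Bj j) mulKmx// uG.
have [L lL] : exists L, mxlim U (fun j => B ^+ j) L.
  by apply: (@mxlim_bounded _ _ _ _ _ _ _ K); apply: nearW => j; exact: hK.
have [L' lL'] : exists L', mxlim U (fun j => invmx (B ^+ j)) L'.
  apply: (@mxlim_bounded _ _ _ _ _ _ _ K); apply: nearW => j.
  by apply: hK => //; exact: GV.
have LL : L' *m L = 1%:M.
  apply: (mxlim_near_eq (mxlim_mul lL' lL) (mxlim_cst _)).
  by apply: nearW => j; rewrite mulVmx// uG.
have [d d0 dG] := holonomy_matrices_isolated.
have d2 : 0 < d / 2 by exact: divr_gt0.
have lj : mxlim U (fun j => invmx (B ^+ j) *m L) 1%:M.
  by rewrite -LL; apply: mxlim_mul => //; exact: mxlim_cst.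
(* First [j] is fixed with [invmx (B ^+ j) *m L] near the identity, then [i] with [B ^+ i] close
   enough to [L]. Asking for [i > j] makes [i - j] positive, as torsion-freeness requires. *)
have [j hj] := filter_ex (mxlim_near d2 lj).
have li : mxlim U (fun i => invmx (B ^+ j) *m B ^+ i) (invmx (B ^+ j) *m L).
  by apply: mxlim_mul => //; exact: mxlim_cst.
have [i [hi ji]] := filter_ex (filterI (mxlim_near d2 li) (Uoo j.+1)).
have [c Bc] : exists c : R, B ^+ (i - j) = c%:M.
  apply: dG => // s t.
  have -> : B ^+ (i - j) = invmx (B ^+ j) *m B ^+ i.
    by rewrite -{2}(subnKC (ltnW ji)) exprD -mulmxE mulKmx// uG.
  rewrite [d]splitr; apply: le_lt_trans (ltrD (hi s t) (hj s t)).
  exact: ler_distD.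
have [c' Bc'] : exists c : R, B = c%:M.
  by apply: (holonomy_torsion GB (_ : 0 < i - j)%N); [rewrite subn_gt0|exists c].
exists (k * c'); rewrite -[A](scalerKV (lt0r_neq0 k0)) -/B Bc'.
by rewrite scale_scalar_mx.
Qed.

End ManifoldCone.

Section ManifoldDistance.
Context {R : realType} {n : nat}.
Local Notation V := 'cV[R]_n.+1.

(** Needed because the injectivity radius is a supremum that may not be attained: the radius has to
    be lowered strictly below [eps]. *)
Lemma hilbert_lt_dense (C : set V) a b (r : R) :
  hilbert_lt C a b r -> exists2 s, s < r & hilbert_lt C a b s.
Proof.
move=> [l [m [l0 m0 Cl Cm lm]]]; have lm0 : 0 < l * m by exact: mulr_gt0.
have h : ln (l * m) < r by rewrite -(expRK r) ltr_ln// posrE ?expR_gt0.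
exists ((ln (l * m) + r) / 2); first by lra.
by exists l, m; split=> //; rewrite -{1}[l * m](lnK lm0) ltr_expR; lra.
Qed.

Lemma ones_neq0 : @ones R n != 0.
Proof.
by apply/eqP => /colP/(_ 0); rewrite !mxE => /eqP; rewrite oner_eq0.
Qed.

(** The zero vector gets the ray of [ones] to make the map total; open cones never contain it. *)
Definition ray (v : V) : RP R n :=
  if pselect (v != 0) is left v0 then proj_class v0 else proj_class ones_neq0.

Lemma rayE v (v0 : v != 0) : ray v = proj_class v0.
Proof.
rewrite /ray; case: pselect => // v1.
by congr proj_class; exact: Prop_irrelevance.
Qed.

Variables (M : convex_manifold R n) (u : 'rV[R]_n.+1).
Let W := domain M.
Hypothesis Wu : closure W `<=` affine_patch u.
Let oW : open W. Proof. exact: domain_open. Qed.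
Let lW : forall p q, p != q -> connected (projective_line p q `&` W).
Proof. by case: (domain_convex M). Qed.
Let C := half_lift u W.
Let cC : open_cone C. Proof. exact: half_lift_cone. Qed.
Let G := holonomy_matrices M u.
Let mG : matrix_group G. Proof. exact: holonomy_matrix_group. Qed.

Lemma ray_domain v : C v -> W (ray v).
Proof. by move=> [_ Wv]; rewrite (rayE (vlift_neq0 Wv)); exact/vlift_class. Qed.

Lemma domain_ray p : W p -> exists2 v, C v & ray v = p.
Proof.
move=> Wp; have h0 : hcoord p != 0 by exact: hcoord_neq0.
have [Cp|Cp] := half_liftP Wu ((vlift_hcoord _ _).2 Wp).
  by exists (hcoord p) => //; rewrite (rayE (hcoord_neq0 p)) hcoordK.
have Nh0 : - hcoord p != 0 by rewrite oppr_eq0.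
exists (- hcoord p) => //; rewrite (rayE Nh0) -[RHS]hcoordK.
by apply/proj_classP; exists (-1); rewrite ?oppr_eq0 ?oner_eq0// scaleN1r.
Qed.

Lemma ray_scale (k : R) v : k != 0 -> v != 0 -> ray (k *: v) = ray v.
Proof.
move=> k0 v0; have kv0 : k *: v != 0 by rewrite scaler_eq0 negb_or k0.
by rewrite (rayE kv0) (rayE v0); apply/proj_classP; exists k.
Qed.

Lemma ray_inj v w : C v -> C w -> ray v = ray w -> exists k : R, v = k *: w.
Proof.
move=> /half_lift_neq0 v0 /half_lift_neq0 w0; rewrite (rayE v0) (rayE w0).
by move=> /proj_classP[k _ ->]; exists k.
Qed.

Lemma homography_ray A (uA : A \in unitmx) v : v != 0 ->
  homography (pgl_class uA) (ray v) = ray (A *m v).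
Proof.
move=> v0; rewrite (rayE v0) homographyE.
by rewrite (rayE (mulmx_neq0 uA v0)).
Qed.

Lemma orbit_ray v p : C v -> Defs.orbit M (ray v) p ->
  exists2 A, G A & p = ray (A *m v).
Proof.
move=> Cv [g Mg <-]; have [A [uA [GA <-]]] := holonomy_matricesP Wu Mg.
by exists A => //; rewrite homography_ray//; exact: half_lift_neq0 Cv.
Qed.

Lemma ray_orbit v A : C v -> G A -> Defs.orbit M (ray v) (ray (A *m v)).
Proof.
move=> Cv [[uA MA] _]; exists (pgl_class uA) => //.
by rewrite homography_ray//; exact: half_lift_neq0 Cv.
Qed.

Lemma hilbert_dist_ray a b r : C a -> C b ->
  hilbert_dist W (ray a) (ray b) < r <-> hilbert_lt C a b r.
Proof.
move=> Ca Cb; have a0 := half_lift_neq0 Ca; have b0 := half_lift_neq0 Cb.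
by rewrite (rayE a0) (rayE b0); exact: hilbert_dist_lt.
Qed.

Lemma quotient_dist_ray a b r : C a -> C b ->
  quotient_dist M (Defs.orbit M (ray a)) (Defs.orbit M (ray b)) < r <->
  quotient_lt C G a b r.
Proof.
move=> Ca Cb; have [uG G1 GM GV] := mG; rewrite /quotient_dist.
set S := (X in inf X < _).
have S0 : S !=set0.
  by exists (hilbert_dist W (ray a) (ray b)); exists (ray a); [exact: Defs.orbit_id|];
    exists (ray b); [exact: Defs.orbit_id|].
have CG A v : G A -> C v -> C (A *m v) by move=> [_]; apply.
have Sb : has_lbound S.
  exists 0 => _ [p /(orbit_ray Ca)[A GA ->] [q /(orbit_ray Cb)[B GB ->] <-]].
  rewrite leNgt; apply/negP => /(hilbert_dist_ray _ (CG _ _ GA Ca) (CG _ _ GB Cb)).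
  by move=> /(hilbert_lt_gt0 cC (CG _ _ GB Cb)); rewrite ltxx.
split.
- move=> /(inf_lt S0)[_ [p /(orbit_ray Ca)[A GA ->] [q /(orbit_ray Cb)[B GB ->] <-]]].
  move=> /(hilbert_dist_ray _ (CG _ _ GA Ca) (CG _ _ GB Cb)) h.
  exists (invmx A *m B); first by apply: GM => //; exact: GV.
  rewrite -[a](mulKmx (uG _ GA)) -mulmxA; apply: hilbert_lt_map h => v.
  by apply: CG; exact: GV.
- move=> [A GA h]; apply: le_lt_trans ((hilbert_dist_ray _ Ca (CG _ _ GA Cb)).2 h).
  apply: ge_inf => //; exists (ray a); first exact: Defs.orbit_id.
  by exists (ray (A *m b)) => //; exact: ray_orbit.
Qed.

(** Injectivity of the ball only yields that [A] fixes the ray of [b]; [holonomy_free] turns this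
    into projective triviality. *)
Lemma injectivity_thick (eps : R) e0 A b : C e0 ->
  (eps%:E <= inj_radius M (Defs.orbit M (ray e0)))%E -> G A -> C b ->
  hilbert_lt C e0 b eps -> hilbert_lt C e0 (A *m b) eps ->
  exists c : R, A = c%:M.
Proof.
move=> Ce0 inj GA Cb /hilbert_lt_dense[r1 r1e h1] /hilbert_lt_dense[r2 r2e h2].
have CAb : C (A *m b) by case: GA => _; apply.
pose r := Num.max r1 r2.
have re : (r%:E < inj_radius M (Defs.orbit M (ray e0)))%E.
  by apply: lt_le_trans inj; rewrite lte_fin gt_max r1e.
have [_ [s [s0 emb] <-]] := ereal_sup_gt re; rewrite lte_fin => rs.
have mem c r' : C c -> r' <= r -> hilbert_lt C e0 c r' ->
    ray c \in [set b | domain M b /\ hilbert_dist (domain M) (ray e0) b < s].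
  move=> Cc rr h; apply: mem_set; split; first exact: ray_domain.
  by apply/hilbert_dist_ray => //; apply: hilbert_lt_le h; exact: le_trans rr (ltW rs).
have h1' : r1 <= r by rewrite le_max lexx.
have h2' : r2 <= r by rewrite le_max lexx orbT.
have := emb _ (Defs.orbit_id M _) _ _ (mem _ _ Cb h1' h1) (mem _ _ CAb h2' h2).
rewrite (Defs.orbit_eq (ray_orbit Cb GA)) => /(_ erefl).
move=> /esym/(ray_inj CAb Cb)[k Ab]; exact: (holonomy_free Wu GA Cb Ab).
Qed.

End ManifoldDistance.

(** * Benzecri's normal form *)

Section HahnBanach.
Context {R : realType} {n : nat}.
Local Notation V := 'cV[R]_n.+1.
Implicit Types (p q : V -> R) (v w : V).

Definition sublinear p : Prop := (forall v w, p (v + w) <= p v + p w) /\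
  (forall (k : R) v, 0 < k -> p (k *: v) <= k * p v).

(** Homogeneity with [k = 2] gives [0 <= p 0], and with [k = 1 / 2] the converse. *)
Lemma sublinear0 p : sublinear p -> p 0 = 0.
Proof.
move=> [_ pZ]; have := pZ 2 0 (ltr0Sn _ 1); have h : (0 : R) < 1 / 2 by lra.
by have := pZ _ 0 h; rewrite !scaler0 => h1 h2; lra.
Qed.

Lemma sublinearN p v : sublinear p -> 0 <= p v + p (- v).
Proof. by move=> sp; have := sp.1 v (- v); rewrite subrr sublinear0. Qed.

(* The minorant is linear along [w]; iterating over a basis makes it linear. *)
Lemma sublinear_step p w : sublinear p -> exists q, [/\ sublinear q,
  forall v, q v <= p v & q (- w) <= - p w].
Proof.
move=> sp; have [pD pZ] := sp.
(* The minorant is the infimum of [S v]: [t = 0] bounds it by [p v], [t = 1] at [- w] bounds it by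
   [- p w], and [- p (- v)] is a lower bound of [S v]. *)
pose S v := [set p (v + t *: w) - t * p w | t in [set t : R | 0 <= t]].
have S0 v : S v !=set0 by exists (p (v + 0 *: w) - 0 * p w); exists 0 => //=.
have Sb v : has_lbound (S v).
  exists (- p (- v)) => _ [t /= t0 <-].
  have := pD (v + t *: w) (- v); rewrite addrAC subrr add0r => h.
  suff : t * p w <= p (t *: w) by lra.
  move: t0; rewrite le_eqVlt => /orP[/eqP <-|t0].
    by rewrite mul0r scale0r sublinear0.
  have ti : 0 < t^-1 by rewrite invr_gt0.
  by have := pZ _ (t *: w) ti; rewrite scalerK ?gt_eqF// mulrC ler_pdivlMr// mulrC.
have infS v x : (forall y, S v y -> x <= y) -> x <= inf (S v).
  by move=> h; apply: lb_le_inf => // y; exact: h.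
have Sinf v y : S v y -> inf (S v) <= y by move=> Sy; apply: ge_inf.
exists (fun v => inf (S v)); split; last first.
- apply: Sinf; exists 1 => //=.
  by rewrite scale1r addNr sublinear0// mul1r sub0r.
- move=> v; apply: Sinf; exists 0 => //=.
  by rewrite scale0r addr0 mul0r subr0.
- split=> [v v'|k v k0].
  + apply/ler_addgt0Pr => e e0; have e2 : 0 < e / 2 by exact: divr_gt0.
    have [|y [t /= t0 ty] yv] := @inf_lt _ (S v) (inf (S v) + e / 2) (S0 v).
      by rewrite ltrDl.
    have [|y' [t' /= t'0 ty'] yv'] := @inf_lt _ (S v') (inf (S v') + e / 2) (S0 v').
      by rewrite ltrDl.
    apply: (@le_trans _ _ (y + y')); last by lra.
    apply: (@le_trans _ _ (p (v + v' + (t + t') *: w) - (t + t') * p w)).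
      by apply: Sinf; exists (t + t') => //=; exact: addr_ge0.
    rewrite -ty -ty' scalerDl addrACA mulrDl.
    by have := pD (v + t *: w) (v' + t' *: w); lra.
  + rewrite mulrC -ler_pdivrMr//; apply: infS => _ [t /= t0 <-].
    rewrite ler_pdivrMr// mulrC; apply: (@le_trans _ _ (p (k *: v + (k * t) *: w) - (k * t) * p w)).
      by apply: Sinf; exists (k * t) => //=; rewrite mulr_ge0// ltW.
    rewrite -scalerA -scalerDr mulrBr mulrA.
    by have := pZ _ (v + t *: w) k0; lra.
Qed.

(** Oddness along earlier vectors is not destroyed: the minorant has
    [q' v + q' (- v) <= q v + q (- v) <= 0], and [sublinearN] gives the opposite inequality. *)
Lemma sublinear_steps p (s : seq V) : sublinear p -> exists q, [/\ sublinear q,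
  forall v, q v <= p v & forall w, w \in s -> q (- w) = - q w].
Proof.
elim: s p => [|w s IH] p sp; first by exists p.
have [q [sq qp qs]] := IH _ sp; have [q' [sq' qq' q'w]] := sublinear_step w sq.
exists q'; split=> // [v|v]; first exact: le_trans (qp v).
have odd w' : q w' + q (- w') <= 0 -> q' (- w') = - q' w'.
  move=> h; have := sublinearN w' sq'; have := qq' w'; have := qq' (- w').
  move=> h1 h2 h3; apply/eqP; rewrite -addr_eq0 addrC eq_le h3 andbT.
  by apply: le_trans h; exact: lerD.
rewrite inE => /orP[/eqP ->|vs]; last by apply: odd; rewrite qs// subrr.
have := sublinearN w sq'; have := qq' w.
by move=> h1 h2; apply/eqP; rewrite -addr_eq0 addrC eq_le h2 andbT; lra.
Qed.

(** The first step, along [- w], secures the value at [w]; the basis vectors follow. Oddness on the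
    basis gives [q <= f] by expanding a vector, and applying this to [- v] gives [f <= q]. *)
Lemma hahn_banach p w : sublinear p -> exists f : 'rV[R]_n.+1,
  (forall v, functional f v <= p v) /\ functional f w <= - p (- w).
Proof.
move=> sp; have [q1 [sq1 q1p q1w]] := sublinear_step (- w) sp.
have [q [sq qq1 qb]] := sublinear_steps [seq delta_mx i 0 | i <- enum 'I_n.+1] sq1.
have qd i : q (- delta_mx i 0) = - q (delta_mx i 0).
  by apply: qb; apply: map_f; rewrite mem_enum.
have [qD qZ] := sq.
pose f : 'rV[R]_n.+1 := \row_i q (delta_mx i 0).
have qc (c : R) i : q (c *: delta_mx i 0) <= c * q (delta_mx i 0).
  have [c0|c0|->] := ltgtP c 0; last by rewrite scale0r mul0r sublinear0.
    rewrite -[c]opprK scaleNr -scalerN mulNr -mulrN -qd; apply: qZ.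
    by rewrite oppr_gt0.
  exact: qZ.
have qf v : q v <= functional f v.
  have -> : functional f v = \sum_i v i 0 * q (delta_mx i 0).
    by rewrite /functional mxE; apply: eq_bigr => i _; rewrite mxE mulrC.
  have {1}-> : v = \sum_i v i 0 *: delta_mx i 0.
    rewrite {1}[v]matrix_sum_delta; apply: eq_bigr => i _.
    by rewrite big_ord1.
  elim/big_ind2: _ => [|x1 x2 y1 y2 h1 h2|i _]; last exact: qc.
    by rewrite sublinear0.
  by apply: (le_trans (qD _ _)); exact: lerD.
have fp v : functional f v <= q v.
  have := qf (- v); rewrite -scaleN1r functionalZ mulN1r scaleN1r.
  by have := sublinearN v sq; lra.
exists f; split=> [v|].
  exact: le_trans (fp v) (le_trans (qq1 v) (q1p v)).
apply: (le_trans (fp w)); apply: (le_trans (qq1 w)).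
by move: q1w; rewrite opprK.
Qed.

(** [p] is the order-unit functional of [e0], the least [l] with [v <= l e0]. A linear minorant of
    it is a state, and [p (- w) >= 0] since otherwise [w] would be in [C]. *)
Lemma open_cone_separation (C : set V) e0 w : open_cone C -> C e0 -> ~ C w ->
  exists f : 'rV[R]_n.+1, [/\ forall v, C v -> 0 < functional f v,
    functional f e0 = 1 & functional f w <= 0].
Proof.
move=> cC Ce0 nCw; pose S v := [set l : R | C (l *: e0 - v)].
have S0 v : S v !=set0.
  have [d d0 dC] := open_cone_shrink (- v) cC Ce0.
  have d2 : 0 < d / 2 by exact: divr_gt0.
  exists (d / 2)^-1; rewrite /S/= -[v](scalerK (lt0r_neq0 d2)) -scalerBr.
  apply: (open_coneZ cC); first by rewrite invr_gt0.
  by rewrite -scalerN; apply: dC; apply/andP; split; lra.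
have Sb v : has_lbound (S v).
  have [m Sm] := S0 (- v); exists (- m) => l Sl.
  have : C ((l + m) *: e0).
    have := open_coneD cC Sl Sm.
    by rewrite opprK addrACA [- v + v]addNr addr0 -scalerDl.
  by move=> /(open_coneZ_gt0 cC Ce0); lra.
pose p v := inf (S v).
have pS v l : S v l -> p v <= l by move=> Sl; exact: ge_inf.
have Sp v l : p v < l -> S v l.
  move=> /(inf_lt (S0 v))[m Sm ml]; rewrite /S/= -(subrK m l) scalerDl -addrA.
  by apply: (open_coneD cC) => //; apply: (open_coneZ cC); rewrite ?subr_gt0.
have sp : sublinear p.
  split=> [v w'|k v k0].
    apply/ler_addgt0Pr => e e0_gt0; apply: pS.
    have h1 : S v (p v + e / 2) by apply: Sp; rewrite ltrDl divr_gt0.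
    have h2 : S w' (p w' + e / 2) by apply: Sp; rewrite ltrDl divr_gt0.
    rewrite /S/= (_ : p v + p w' + e = (p v + e / 2) + (p w' + e / 2)); last by lra.
    by rewrite scalerDl opprD addrACA; exact: (open_coneD cC).
  rewrite mulrC -ler_pdivrMr//; apply/ler_addgt0Pr => e e1; rewrite ler_pdivrMr//.
  apply: pS; rewrite /S/= mulrC -scalerA -scalerBr; apply: (open_coneZ cC) => //.
  by apply: Sp; rewrite ltrDl.
have [f [fp fw]] := hahn_banach w sp.
have fN v : functional f (- v) = - functional f v.
  by rewrite -scaleN1r functionalZ mulN1r.
exists f; split.
- move=> v Cv; have [d d0 dC] := open_cone_shrink (- e0) cC Cv.
  have d2 : 0 < d / 2 < d by apply/andP; split; lra.
  have : p (- v) <= - (d / 2).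
    apply: pS; rewrite /S/= opprK scaleNr addrC -scalerN; exact: dC.
  have := fp (- v); rewrite fN; move: (proj1 (andP d2)); lra.
- have h1 : p e0 <= 1.
    apply/ler_addgt0Pr => e e1; apply: pS; rewrite /S/= scalerDl scale1r addrAC subrr add0r.
    exact: (open_coneZ cC).
  have h2 : p (- e0) <= - 1.
    apply/ler_addgt0Pr => e e1; apply: pS; rewrite /S/= scalerDl scaleN1r opprK addrAC addNr add0r.
    exact: (open_coneZ cC).
  have := fp e0; have := fp (- e0); rewrite fN => h3 h4.
  by apply/eqP; rewrite eq_le; apply/andP; split; lra.
- apply: (le_trans fw); rewrite oppr_le0; apply: lb_le_inf => // l Sl.
  rewrite leNgt; apply/negP => l0; apply: nCw.
  have -> : w = (l *: e0 - - w) + (- l) *: e0 by rewrite opprK scaleNr addrAC subrr add0r.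
  by apply: (open_coneD cC) => //; apply: (open_coneZ cC); rewrite ?oppr_gt0.
Qed.

End HahnBanach.

Section NormalForm.
Context {R : realType} {n : nat}.
Local Notation V := 'cV[R]_n.+1.
Local Notation ones := (@ones R n).

(** Cramer's rule: the factor is the coordinate of [f] along row [i] in the basis formed by the rows
    of [F]. *)
Lemma det_replace_row m (F : 'M[R]_m) (f : 'rV[R]_m) i : F \in unitmx ->
  \det (\matrix_(k, j) if k == i then f 0 j else F k j) =
  (f *m invmx F) 0 i * \det F.
Proof.
move=> uF; set Fi := \matrix_(_, _) _.
rewrite (expand_det_row Fi i).
have -> : \sum_j Fi i j * cofactor Fi i j = (f *m \adj F) 0 i.
  rewrite mxE; apply: eq_bigr => j _; rewrite !mxE eqxx; congr (_ * (_ * \det _)).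
  apply/matrixP => k l; rewrite !mxE.
  by rewrite eq_sym (negbTE (neq_lift i k)).
rewrite -{1}(mulmxKV uF f).
by rewrite -(mulmxA _ F) mul_mx_adj mul_mx_scalar mxE mulrC.
Qed.

Section States.
Variables (C : set V) (e0 : V) (cC : open_cone C) (Ce0 : C e0).
Variables (u : 'rV[R]_n.+1) (c : R) (c0 : 0 < c).
Hypothesis uC : forall v, C v -> forall i, c * `|v i 0| <= functional u v.

(** Each row is a functional that is positive on [C] and equal to 1 at [e0]. *)
Definition states : set 'M[R]_n.+1 :=
  [set F | F *m e0 = ones /\ forall v, C v -> forall i, 0 < (F *m v) i 0].

(** Positivity at [e0] plus or minus [d / 2] times a basis vector bounds every entry by [2 / d]; the
    Leibniz formula does the rest. *)
Lemma states_det_bounded : exists D : R, forall F, states F -> `|\det F| <= D.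
Proof.
have [oC _ _ _] := cC; have /nbhs_mxP[d d0 dC] := open_nbhs_nbhs (conj oC Ce0).
exists (\sum_(s : 'S_n.+1) \prod_(i < n.+1) (2 / d)) => F [F1 FC].
apply: (le_trans (ler_norm_sum _ _ _)); apply: ler_sum => s _.
rewrite normrM normrX normrN1 expr1n mul1r normr_prod; apply: ler_prod => i _.
rewrite normr_ge0/=; set j := s i.
have hs (k : R) : `|k| = 1 -> 0 < 1 + k * (d / 2) * F i j.
  move=> k1; have : C (e0 + k *: ((d / 2) *: delta_mx j 0)).
    apply: dC => k' l; rewrite ord1 !mxE addrAC subrr add0r normrM normrM k1 mul1r.
    rewrite eqxx andbT (gtr0_norm (divr_gt0 d0 _))//.
    by case: (k' == j); rewrite ?normr1 ?normr0; lra.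
  move=> /FC/(_ i); rewrite mulmxDr F1 -!scalemxAr -colE !mxE.
  by rewrite mulrA.
have h1 := hs 1 (normr1 _); have h2 := hs (-1) (normrN1 _).
have d2 : 0 < d / 2 by exact: divr_gt0.
have -> : 2 / d = 1 / (d / 2) by field; rewrite gt_eqF.
rewrite ler_pdivlMr// -{1}(gtr0_norm d2) -normrM ler_norml.
move: h1 h2; rewrite mul1r mulN1r mulNr mulrC => h1 h2; apply/andP; split; lra.
Qed.

Lemma states_unit : exists2 F, states F & F \in unitmx.
Proof.
(* The rows perturb [u] by coordinate functionals. The size [s < c] preserves positivity, and the
   signs make the matrix invertible: a kernel vector [w] satisfies [(s + \sum_i |u_i|) u(w) = 0], so
   [u(w) = 0] and then [w = 0]. *)
pose sg i : R := if 0 <= u 0 i then 1 else -1.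
have sg1 i : `|sg i| = 1 by rewrite /sg; case: ifP; rewrite ?normr1 ?normrN1.
have sgu i : sg i * u 0 i = `|u 0 i|.
  rewrite /sg; case: ifP => [u0|/negbT]; first by rewrite mul1r ger0_norm.
  by rewrite -ltNge => u0; rewrite mulN1r ltr0_norm.
pose s := c / 2; have s0 : 0 < s by exact: divr_gt0.
have sE : s < c by rewrite /s ltr_pdivrMr// ltr_pMr// ltr1n.
pose row_ i v := functional u v + s * sg i * v i 0.
have rowp v i : C v -> 0 < row_ i v.
  move=> Cv; have h1 : - (s * `|v i 0|) <= s * sg i * v i 0.
    rewrite lerNl; apply: (le_trans (ler_norm _)).
    by rewrite normrN (normrM (s * sg i)) (normrM s) sg1 mulr1 gtr0_norm.
  have h2 := uC Cv i.
  have [vi0|vi0] := eqVneq (v i 0) 0.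
    rewrite /row_ vi0 mulr0 addr0 lt_neqAle; apply/andP; split.
      apply/eqP => u0; apply: (open_cone0 cC); rewrite (_ : 0 = v)//.
      apply/colP => j; rewrite mxE; apply/esym/eqP; rewrite -normr_le0.
      by rewrite -(pmulr_rle0 _ c0) u0; exact: uC.
    by apply: le_trans h2; rewrite mulr_ge0// ltW.
  have : s * `|v i 0| < c * `|v i 0| by rewrite ltr_pM2r// normr_gt0.
  by rewrite /row_; lra.
pose F : 'M[R]_n.+1 := \matrix_(i, j) ((u 0 j + s * sg i * (i == j)%:R) / row_ i e0).
have FE v i : (F *m v) i 0 = row_ i v / row_ i e0.
  rewrite mxE; under eq_bigr do rewrite mxE mulrAC mulrDl.
  rewrite -mulr_suml big_split/=; congr (_ / _); congr (_ + _).
    by rewrite /functional mxE.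
  rewrite (bigD1 i)//= eqxx mulr1 big1 ?addr0// => j ji.
  by rewrite eq_sym (negbTE ji) mulr0 mul0r.
exists F.
  split; first by apply/colP => i; rewrite FE mxE divff// gt_eqF// rowp.
  by move=> v Cv i; rewrite FE divr_gt0// rowp.
rewrite -unitmx_tr unitmxE unitfE; apply/det0P => -[w w0 wF].
have Fv : F *m w^T = 0 by rewrite -[LHS]trmxK trmx_mul trmxK wF trmx0.
have row0 i : row_ i w^T = 0.
  move/colP/(_ i): Fv; rewrite FE mxE => /eqP; rewrite mulf_eq0 invr_eq0.
  by rewrite (gt_eqF (rowp e0 i Ce0)) orbF => /eqP.
have wi i : s * w 0 i = - (functional u w^T) * sg i.
  have sgsg : sg i * sg i = 1 by rewrite /sg; case: ifP; rewrite ?mulr1 ?mulrNN ?mulr1.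
  have := row0 i; rewrite /row_ mxE => /eqP; rewrite addr_eq0 => /eqP ->.
  by rewrite opprK -[LHS]mulr1 -sgsg; ring.
have uw0 : functional u w^T = 0.
  have : s * functional u w^T = - functional u w^T * \sum_i `|u 0 i|.
    rewrite {1}/functional mxE !mulr_sumr; apply: eq_bigr => i _.
    by rewrite -sgu [w^T _ _]mxE [RHS]mulrA -wi; ring.
  move=> h; have S0 : 0 <= \sum_i `|u 0 i| by rewrite sumr_ge0.
  have : (s + \sum_i `|u 0 i|) * functional u w^T = 0.
    by rewrite mulrDl h; ring.
  move/eqP; rewrite mulf_eq0 => /orP[|/eqP //].
  by rewrite gt_eqF// ltr_wpDr.
move/eqP: w0; apply; apply/rowP => i; rewrite mxE.
have := wi i; rewrite uw0 oppr0 mul0r => /eqP; rewrite mulf_eq0 (gt_eqF s0)/=.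
by move/eqP.
Qed.

(** States are strictly positive, so the supremum of the determinants need not be attained; a matrix
    [T] above half of it suffices. Replacing a row of [T] by a state at most doubles the
    determinant, so a state has coordinates at most 2 in the basis of rows. With [n.+1] coordinates
    of [T *m v] below [(4 * n.+1)^-1], the state is at least [- 1 / 2] at [v], hence positive at
    [e0 + v]. *)
Lemma normal_form : exists2 T : 'M[R]_n.+1, T \in unitmx &
  [/\ T *m e0 = ones, forall v, C v -> forall i, 0 < (T *m v) i 0 &
      forall v, (forall i, `|(T *m v) i 0| < (4 * n.+1%:R)^-1) -> C (e0 + v)].
Proof.
have [D hD] := states_det_bounded; have [F0 SF0 uF0] := states_unit.
pose E := [set `|\det F| | F in states].
have hsE : has_sup E.
  by split; [exists `|\det F0|; exists F0|exists D => _ [F SF <-]; exact: hD].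
have F0p : 0 < `|\det F0| by rewrite normr_gt0 -unitfE -unitmxE.
have supp : 0 < sup E by apply: (lt_le_trans F0p); apply: sup_ubound; [exact: hsE.2|exists F0].
have [|_ [T ST <-]] := @sup_adherent _ E (sup E / 2) _ hsE; first by rewrite divr_gt0.
have -> : sup E - sup E / 2 = sup E / 2 by lra.
move=> dT; have dT0 : 0 < `|\det T| by apply: lt_trans dT; rewrite divr_gt0.
have uT : T \in unitmx by rewrite unitmxE unitfE -normr_gt0.
exists T => //; have [T1 TC] := ST; split=> // v hv.
apply: contrapT => /(open_cone_separation cC Ce0)[f [fC f1 fv]].
have cf i : `|(f *m invmx T) 0 i| <= 2.
  pose Ti : 'M[R]_n.+1 := \matrix_(k, j) if k == i then f 0 j else T k j.
  have TiE w k : (Ti *m w) k 0 = if k == i then functional f w else (T *m w) k 0.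
    rewrite mxE; case: eqP => ki.
      rewrite /functional mxE; apply: eq_bigr => j _; by rewrite mxE ki eqxx.
    by rewrite mxE; apply: eq_bigr => j _; rewrite mxE; case: eqP.
  have STi : states Ti.
    split; last by move=> w Cw k; rewrite TiE; case: ifP => _; [exact: fC|exact: TC].
    by apply/colP => k; rewrite TiE f1 T1 mxE; case: ifP.
  have h1 : `|\det Ti| <= sup E by apply: sup_ubound; [exact: hsE.2|exists Ti].
  move: h1; rewrite det_replace_row// normrM => h1.
  by rewrite -(ler_pM2r dT0); lra.
have fvE : functional f v = \sum_i (f *m invmx T) 0 i * (T *m v) i 0.
  by rewrite {1}/functional -{1}(mulmxKV uT f) -(mulmxA _ T) mxE.
have : `|functional f v| <= 1 / 2.
  rewrite fvE; apply: (le_trans (ler_norm_sum _ _ _)).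
  apply: (@le_trans _ _ (\sum_(i < n.+1) 2 * (4 * n.+1%:R)^-1)).
    by apply: ler_sum => i _; rewrite normrM; apply: ler_pM => //; exact/ltW/hv.
  rewrite sumr_const card_ord -[_ *+ n.+1]mulr_natr.
  have half (x : R) : x != 0 -> 2 * (4 * x)^-1 * x = 1 / 2 by move=> x0; field.
  by rewrite half ?lexx// pnatr_eq0.
rewrite functionalD f1 in fv.
by rewrite ler_norml => /andP[h _]; move: h fv; lra.
Qed.

End States.
End NormalForm.

(** * Pointed manifolds in normal form *)

Section Premodel.
Context {R : realType} {n : nat}.
Local Notation V := 'cV[R]_n.+1.

Lemma manifold_realizes (M : convex_manifold R n) (u : 'rV[R]_n.+1) (e0 : V)
    (X : pointed_metric_space R) :
  closure (domain M) `<=` affine_patch u -> half_lift u (domain M) e0 ->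
  isometric_to_manifold X M (Defs.orbit M (ray e0)) ->
  exists phi : V -> Defs.space X,
  [/\ forall x, exists2 v, half_lift u (domain M) v & phi v = x,
      phi e0 = basepoint X &
      forall a b, half_lift u (domain M) a -> half_lift u (domain M) b -> forall r,
        dist X (phi a) (phi b) < r <->
        quotient_lt (half_lift u (domain M)) (holonomy_matrices M u) a b r].
Proof.
move=> Wu Ce0 [f [[fM finj fsur] fd fP]].
exists (fun v => f (Defs.orbit M (ray v))); split=> //.
- move=> x; have [Q [p Wp <-] <-] := fsur x I.
  by have [v Cv <-] := domain_ray Wu Wp; exists v.
- move=> a b Ca Cb r; rewrite fd; first exact: quotient_dist_ray.
  + by apply: mem_set; exists (ray a) => //; exact: ray_domain Ca.
  + by apply: mem_set; exists (ray b) => //; exact: ray_domain Cb.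
Qed.

(** Conjugation by the matrix [T] of the normal form: [C'] is the image of the cone under [T], and
    [G'] the conjugate group. The radius depends on [n] only, so one [rho] serves all manifolds. *)
Theorem manifold_model (eps : R) (M : convex_manifold R n) P
    (X : pointed_metric_space R) :
  points M P -> (eps%:E <= inj_radius M P)%E -> isometric_to_manifold X M P ->
  exists (C : set V) (G : set 'M[R]_n.+1) (phi : V -> Defs.space X),
    model (4 * n.+1%:R)^-1 eps C G /\ realizes C G phi.
Proof.
move=> [p0 Wp0 <-] inj iso.
have [lW [u u0 Wu]] := domain_convex M; have oW := @domain_open R n M.
have [e0 Ce0 pe0] := domain_ray Wu Wp0; rewrite -pe0 in inj iso.
have [phi [sur base distP]] := manifold_realizes Wu Ce0 iso.
have thG A b := injectivity_thick (A := A) (b := b) Wu Ce0 inj.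
have mG := holonomy_matrix_group Wu; have tfG := holonomy_torsion (u := u) (M := M).
have cC := half_lift_cone oW Wu lW; have [c c0 uC] := half_lift_bound Wu.
have [T uT [T1 TC Tball]] := normal_form cC Ce0 c0 uC.
move: thG mG tfG cC sur distP Tball TC => {uC}.
set C := half_lift u _; set G := holonomy_matrices _ _.
move=> thG mG tfG cC sur distP Tball TC; have [uG G1 GM GV] := mG.
have CG A v : G A -> C v -> C (A *m v) by move=> [_]; apply.
pose S : 'M[R]_n.+1 := invmx T; have uS : S \in unitmx by rewrite unitmx_inv.
have TS (v : V) : T *m (S *m v) = v by rewrite mulKVmx.
have ST (v : V) : S *m (T *m v) = v by rewrite mulKmx.
pose C' : set V := [set v | C (S *m v)].
pose G' : set 'M[R]_n.+1 := [set A : 'M[R]_n.+1 | G (S *m A *m T)].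
have hltP a b r : hilbert_lt C' a b r <-> hilbert_lt C (S *m a) (S *m b) r.
  by split=> -[l [m [l0 m0 Cl Cm lm]]]; exists l, m; split=> //; move: Cl Cm;
    rewrite /C'/= !mulmxBr -!scalemxAr.
have rho0 : 0 < (4 * n.+1%:R)^-1 :> R by rewrite invr_gt0 mulr_gt0// ltr0n.
have S1 : S *m @ones R n = e0 by rewrite -T1 ST.
have conjS (A : 'M[R]_n.+1) (v : V) : S *m A *m T *m (S *m v) = S *m (A *m v).
  by rewrite -!mulmxA TS.
have scal (A : 'M[R]_n.+1) (k : R) : S *m A *m T = k%:M -> A = k%:M.
  move=> h; have : T *m (S *m A *m T) *m S = A.
    by rewrite !mulmxA mulmxV// mul1mx -mulmxA mulmxV// mulmx1.
  by rewrite h mul_mx_scalar -scalemxAl mulmxV// scalemx1.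
exists C', G', (fun v => phi (S *m v)); split; split.
- split=> //.
  + split.
    * rewrite openE => v C'v; have [oC _ _ _] := cC.
      have /nbhs_mxP[d d0 dC] := open_nbhs_nbhs (conj oC C'v).
      pose K := 1 + \sum_i \sum_j `|S i j|.
      have K0 : 0 < K by rewrite ltr_pwDl// sumr_ge0// => i _; rewrite sumr_ge0.
      apply/nbhs_mxP; exists (d / K); first exact: divr_gt0.
      move=> w wv; apply: dC => i j; rewrite ord1.
      have -> : (S *m w) i 0 - (S *m v) i 0 = \sum_k S i k * (w k 0 - v k 0).
        by rewrite !mxE -sumrB; apply: eq_bigr => k _; rewrite mulrBr.
      apply: (le_lt_trans (ler_norm_sum _ _ _)).
      apply: (@le_lt_trans _ _ (\sum_k `|S i k| * (d / K))).
        by apply: ler_sum => k _; rewrite normrM ler_wpM2l// ltW.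
      rewrite -mulr_suml mulrA ltr_pdivrMr// mulrC ltr_pM2l//.
      rewrite /K ltr_pwDl// [leRHS](bigD1 i)//= lerDl sumr_ge0// => k _.
      exact: sumr_ge0.
    * by rewrite /C'/= mulmx0; exact: (open_cone0 cC).
    * by move=> v w; rewrite /C'/= mulmxDr; exact: (open_coneD cC).
    * by move=> k v k0; rewrite /C'/= -scalemxAr; exact: (open_coneZ cC).
  + by move=> v /TC; rewrite TS.
  + by move=> v hv; rewrite /C'/= mulmxDr S1; apply: Tball; rewrite TS.
- split.
  + move=> A /uG; rewrite !unitmx_mul uT andbT => /andP[]; by [].
  + move=> k k0; rewrite /G'/= mul_mx_scalar -scalemxAl mulVmx// scalemx1.
    exact: G1.
  + move=> A B GA GB; rewrite /G'/=.
    have -> : S *m (A *m B) *m T = (S *m A *m T) *m (S *m B *m T).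
      by rewrite -!mulmxA mulKVmx.
    exact: GM.
  + move=> A GA; have uA : A \in unitmx.
      by move/uG: GA; rewrite !unitmx_mul uT andbT => /andP[].
    rewrite /G'/= (_ : _ *m _ = invmx (S *m A *m T)); first exact: GV.
    apply: (can_inj (mulKmx (uG _ GA))); rewrite mulmxV ?uG//.
    by rewrite !mulmxA -(mulmxA _ T) mulmxV// mulmx1 -(mulmxA S) mulmxV// mulmx1 mulVmx.
- by move=> A v GA Cv; rewrite /C'/= -conjS; exact: CG.
- move=> A b GA Cb; rewrite !hltP S1 -conjS => h1 h2.
  by have [k /scal] := thG _ _ GA Cb h1 h2; exists k.
- move=> A k GA k0 [c' Ak].
  have AkE : (S *m A *m T) ^+ k = S *m A ^+ k *m T.
    elim: (k) => [|j IH]; first by rewrite !expr0 mulmx1 mulVmx.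
    by rewrite !exprS IH -!mulmxE -!mulmxA mulKVmx.
  have [|k' /scal] := tfG _ _ GA k0; last by exists k'.
  by exists c'; rewrite AkE Ak mul_mx_scalar -scalemxAl mulVmx// scalemx1.
- by move=> x; have [v Cv <-] := sur x; exists (T *m v); rewrite /C'/= ?ST.
- by rewrite S1.
- move=> a b Ca Cb r; rewrite distP//; split=> -[A GA h].
    exists (T *m A *m S).
      by rewrite /G'/= !mulmxA mulVmx// mul1mx -mulmxA mulVmx// mulmx1.
    by apply/hltP; rewrite !mulmxA mulVmx// mul1mx -mulmxA.
  by exists (S *m A *m T) => //; rewrite conjS; exact/hltP.
Qed.

End Premodel.

(** * From cones and matrix groups to manifolds *)

Section ModelManifold.
Context {R : realType} {n : nat}.
Local Notation V := 'cV[R]_n.+1.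
Local Notation ones := (@ones R n).
Variables (rho eps : R) (C : set V) (G : set 'M[R]_n.+1).
Hypotheses (eps0 : 0 < eps) (mC : model rho eps C G).

Let pC : positive_cone rho C. Proof. by case: mC. Qed.
Let cC : open_cone C. Proof. exact: (positive_coneW pC). Qed.
Let mG : matrix_group G. Proof. by case: mC. Qed.
Let CG A v : G A -> C v -> C (A *m v). Proof. by case: mC => _ _ + _ _; apply. Qed.
Let C1 : C ones.
Proof. by rewrite -[ones]scale1r; exact: (positive_cone_ones pC). Qed.

(** Both signs appear because [hcoord] picks a representative of unspecified sign. *)
Definition cone_domain : set (RP R n) := [set p | C (hcoord p) \/ C (- hcoord p)].

Lemma vlift_cone_domain v : vlift cone_domain v <-> C v \/ C (- v).
Proof.
have nz w : C w -> w != 0.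
  by move=> Cw; apply/eqP => w0; move: Cw; rewrite w0; exact: (open_cone0 cC).
have sgn (k : R) w : k != 0 -> C w \/ C (- w) -> C (k *: w) \/ C (- (k *: w)).
  rewrite neq_lt => /orP[k0|k0] [Cw|Cw].
  - by right; rewrite -scaleNr; apply: (open_coneZ cC) => //; rewrite oppr_gt0.
  - left; rewrite -[k]opprK scaleNr -scalerN; apply: (open_coneZ cC) => //.
    by rewrite oppr_gt0.
  - by left; exact: (open_coneZ cC).
  - by right; rewrite -scalerN; exact: (open_coneZ cC).
split=> [Wv|Cv].
  have v0 := vlift_neq0 Wv; move: Wv => /(vlift_class _ v0).
  have [k k0 hv] := hcoord_class v0; rewrite /cone_domain/= hv => Cv.
  have k'0 : k^-1 != 0 by rewrite invr_eq0.
  by have := sgn _ _ k'0 Cv; rewrite scalerK.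
have v0 : v != 0 by case: Cv => /nz//; rewrite oppr_eq0.
apply/(vlift_class _ v0); have [k k0 hv] := hcoord_class v0.
by rewrite /cone_domain/= hv; exact: sgn.
Qed.

Lemma cone_domain_open : open cone_domain.
Proof.
apply/(open_vlift _ open_nonzero); have [oC _ _ _] := cC.
rewrite (_ : vlift cone_domain = C `|` [set v | C (- v)]); last first.
  by apply/seteqP; split=> v /vlift_cone_domain.
apply: openU => //; rewrite openE => v Cv.
have /nbhs_mxP[d d0 dC] := open_nbhs_nbhs (conj oC Cv).
apply/nbhs_mxP; exists d => // w wv; apply: dC => i j.
by rewrite !mxE -opprD normrN.
Qed.

Definition sum_coords : 'rV[R]_n.+1 := const_mx 1.

Lemma sum_coordsE v : functional sum_coords v = \sum_i v i 0.
Proof. by rewrite /functional mxE; apply: eq_bigr => i _; rewrite mxE mul1r. Qed.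

Lemma sum_coords_gt0 v : C v -> 0 < functional sum_coords v.
Proof.
move=> Cv; rewrite sum_coordsE big_ord_recl ltr_pwDl ?sumr_ge0// => [|i _].
  exact: (positive_cone_gt0 pC).
by apply: ltW; exact: (positive_cone_gt0 pC).
Qed.

(** On [C] and [- C] the coordinates have a common sign, so the absolute value of their sum is the
    [l^1] norm. Approximating within [S / 4] in total a vector of norm [S] with coordinate sum 0
    would give [S <= S / 2]. *)
Lemma cone_domain_closure : closure cone_domain `<=` affine_patch sum_coords.
Proof.
move=> p clp; have h0 := hcoord_neq0 p; apply/affine_patchE/eqP => sum0.
have {}clp : closure (vlift cone_domain) (hcoord p).
  by apply/(closure_vlift _ (hcoord_neq0 p)); rewrite hcoordK.
set v := hcoord p in clp h0 sum0 *.
pose S := \sum_i `|v i 0|; have S0 : 0 < S.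
  rewrite lt_neqAle sumr_ge0// andbT; apply: contraNneq h0 => S0.
  apply/eqP/colP => i; rewrite mxE; apply/eqP; rewrite -normr_le0 S0.
  by rewrite /S (bigD1 i)//= lerDl sumr_ge0.
have N0 : 0 < n.+1%:R :> R by rewrite ltr0n.
have d0 : 0 < S / (4 * n.+1%:R) by rewrite divr_gt0// mulr_gt0.
have [w /vlift_cone_domain Cw wv] := (closure_mxP _ _).1 clp _ d0.
have sumE : \sum_(i < n.+1) S / (4 * n.+1%:R) = S / 4.
  rewrite sumr_const card_ord -[_ *+ n.+1]mulr_natr.
  by move: (n.+1%:R : R) N0 => N N0; field; rewrite gt_eqF.
have h1 : `|functional sum_coords w| <= S / 4.
  rewrite -[functional _ _]subr0 -sum0 -functionalB sum_coordsE -sumE.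
  apply: (le_trans (ler_norm_sum _ _ _)); apply: ler_sum => i _.
  by apply: ltW; have := wv i 0; rewrite !mxE.
have h2 : \sum_i `|v i 0| <= \sum_i `|w i 0| + S / 4.
  rewrite -sumE -big_split/=; apply: ler_sum => i _.
  have := wv i 0; rewrite distrC => /ltW h.
  by rewrite -lerBlDl (le_trans _ h)// lerB_dist.
have h3 : \sum_i `|w i 0| = `|functional sum_coords w|.
  rewrite sum_coordsE; case: Cw => Cw.
    rewrite ger0_norm.
      by apply: eq_bigr => i _; rewrite gtr0_norm//; exact: (positive_cone_gt0 pC).
    by apply: sumr_ge0 => i _; apply: ltW; exact: (positive_cone_gt0 pC).
  rewrite -normrN -sumrN ger0_norm.
    apply: eq_bigr => i _; rewrite -normrN gtr0_norm//.
    by have := positive_cone_gt0 pC i Cw; rewrite mxE.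
  apply: sumr_ge0 => i _; apply: ltW.
  by have := positive_cone_gt0 pC i Cw; rewrite mxE.
by move: h1 h2; rewrite h3 -/S; lra.
Qed.

Lemma half_lift_cone_domain : half_lift sum_coords cone_domain = C.
Proof.
apply/seteqP; split=> [v [sv /vlift_cone_domain[//|Cv]]|v Cv].
  by have := sum_coords_gt0 Cv; rewrite -scaleN1r functionalZ mulN1r oppr_gt0 =>
    /lt_trans/(_ sv); rewrite ltxx.
by split; [exact: sum_coords_gt0|apply/vlift_cone_domain; left].
Qed.

Lemma ray_cone v : C v -> cone_domain (ray v).
Proof.
move=> Cv; have Wv : vlift cone_domain v by apply/vlift_cone_domain; left.
by rewrite (rayE (vlift_neq0 Wv)); exact/vlift_class.
Qed.

Lemma cone_ray p : cone_domain p -> exists2 v, C v & ray v = p.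
Proof.
move=> [Cp|Cp].
  by exists (hcoord p) => //; rewrite (rayE (hcoord_neq0 p)) hcoordK.
have N0 : - hcoord p != 0 by rewrite oppr_eq0 hcoord_neq0.
exists (- hcoord p) => //; rewrite (rayE N0) -[RHS]hcoordK.
by apply/proj_classP; exists (-1); rewrite ?oppr_eq0 ?oner_eq0// scaleN1r.
Qed.

Lemma cone_neq0 v : C v -> v != 0.
Proof. by move=> Cv; apply/eqP => v0; move: Cv; rewrite v0; exact: (open_cone0 cC). Qed.

(** The set is star-shaped around any of its points: the segment between two lifts in [C] stays in
    [C] by convexity, and projects to the line because both lifts are in the span of [hcoord p] and
    [hcoord q]. *)
Lemma cone_domain_line p q : connected (projective_line p q `&` cone_domain).
Proof.
set S := _ `&` _.
have [[r0 Sr0]|nS] := pselect (S !=set0); last first.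
  rewrite (_ : S = set0); first exact: connected0.
  by apply/seteqP; split=> // r Sr; apply: nS; exists r.
have /choice[c hc] : forall r : RP R n, exists v, cone_domain r -> C v /\ ray v = r.
  move=> r; have [/cone_ray[v Cv vr]|nr] := pselect (cone_domain r); first by exists v.
  by exists 0.
have cP r : S r -> C (c r) /\ ray (c r) = r by move=> [_ /hc].
pose gm r (t : R) : V := (1 - t) *: c r0 + t *: c r.
have Cgm r t : S r -> 0 <= t <= 1 -> C (gm r t).
  move=> /cP[Cr _] /andP[t0 t1]; have [Cr0 _] := cP _ Sr0.
  move: t0; rewrite le_eqVlt => /orP[/eqP <-|t0].
    by rewrite /gm subr0 scale1r scale0r addr0.
  move: t1; rewrite le_eqVlt => /orP[/eqP ->|t1].
    by rewrite /gm subrr scale0r scale1r add0r.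
  by apply: (open_coneD cC); apply: (open_coneZ cC); rewrite ?subr_gt0.
have span r : S r -> exists k k' : R, c r = k *: hcoord p + k' *: hcoord q.
  move=> Sr; have [Cr er] := cP _ Sr; have [[[k [k' hr]] _] _] := (Sr, tt).
  have c0 := cone_neq0 Cr; have [j j0 hj] := hcoord_class c0.
  move: hr; have -> : hcoord r = j *: c r by rewrite -hj -(rayE c0) er.
  move=> hr; exists (j^-1 * k), (j^-1 * k'); rewrite -!scalerA -scalerDr -hr.
  by rewrite scalerK.
have SE : S = \bigcup_(r in S) ((ray \o gm r) @` `[0, 1]%classic).
  apply/seteqP; split=> [r Sr|_ [r Sr [t t01 <-]]].
    exists r => //; exists 1; first by rewrite /= in_itv/= ler01 lexx.
    by rewrite /gm/= subrr scale0r scale1r add0r; case: (cP _ Sr).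
  have Ct : C (gm r t) by apply: Cgm => //; move: t01; rewrite /= in_itv.
  split; last exact: ray_cone.
  have c0 := cone_neq0 Ct; have [j j0 hj] := hcoord_class c0.
  rewrite /projective_line/= (rayE c0) hj.
  have [k [k' e1]] := span _ Sr; have [l [l' e2]] := span _ Sr0.
  exists (j * ((1 - t) * l + t * k)), (j * ((1 - t) * l' + t * k')).
  by rewrite /gm e1 e2; apply/colP => i; rewrite !mxE; ring.
rewrite SE; apply: bigcup_connected.
  exists r0 => r Sr; exists 0; first by rewrite /= in_itv/= ler01 lexx.
  by rewrite /gm/= subr0 scale1r scale0r addr0; case: (cP _ Sr0).
move=> r Sr; apply: connected_continuous_connected; first exact: segment_connected.
apply: continuous_in_subspaceT => t /set_mem; rewrite /= in_itv/= => t01.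
have c0 := cone_neq0 (Cgm _ _ Sr t01); move=> N.
rewrite [(ray \o gm r) t](rayE c0) => /(nbhs_vlift _ c0) /nbhs_mxP[d d0 dN].
pose K := 1 + \sum_i `|c r i 0 - c r0 i 0|.
have K0 : 0 < K by rewrite ltr_pwDl// sumr_ge0.
apply/nbhs_ballP; exists (d / K); first exact: divr_gt0.
move=> t'; rewrite /ball/= => tt'.
have Nt : vlift N (gm r t').
  apply: dN => i j; rewrite ord1 !mxE.
  have -> : (1 - t') * c r0 i 0 + t' * c r i 0 - ((1 - t) * c r0 i 0 + t * c r i 0) =
      (t' - t) * (c r i 0 - c r0 i 0) by ring.
  rewrite normrM distrC; move: tt'; rewrite ltr_pdivlMr//.
  apply: le_lt_trans; rewrite ler_wpM2l// /K (bigD1 i)//= addrCA lerDl.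
  by rewrite addr_ge0// sumr_ge0.
by rewrite /= (rayE (vlift_neq0 Nt)); exact/vlift_class.
Qed.

Definition cone_holonomy : set (PGL R n) :=
  [set g | exists A (uA : A \in unitmx), G A /\ pgl_class uA = g].

Lemma cone_holonomy_group : group_closed (mem cone_holonomy).
Proof.
have [uG G1 GM GV] := mG; split.
  apply: mem_set; exists 1%:M, (unitmx1 R n.+1); split=> //.
  by apply: G1.
move=> g h /set_mem[A [uA [GA <-]]] /set_mem[B [uB [GB <-]]]; apply: mem_set.
exists (A *m invmx B), (mulmx_unit uA (invmx_unit uB)).
by split; [apply: GM => //; exact: GV|rewrite -pgl_mulE -pgl_invE].
Qed.

(** With both constants equal to [k = expR (eps / 4)], the two memberships need [k] times the
    coordinates of [v], respectively the coordinates themselves, to be below [rho * (k - 1)]. *)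
Lemma hilbert_lt_ones_near : exists2 d : R, 0 < d & forall v : V,
  (forall i, `|v i 0| < d) -> hilbert_lt C ones (ones + v) eps.
Proof.
have [rho0 _ _ _] := pC; pose k := expR (eps / 4).
have k1 : 1 < k by rewrite expR_gt1 divr_gt0.
have k0 : 0 < k by exact: expR_gt0.
have k10 : 0 < k - 1 by rewrite subr_gt0.
exists (rho * (k - 1) / k); first by rewrite divr_gt0// mulr_gt0.
move=> v hv; have hv' i : `|v i 0| * k < rho * (k - 1) by rewrite -ltr_pdivlMr.
exists k, k; split=> //.
- have -> : k *: (ones + v) - ones = (k - 1) *: ones + k *: v.
    by apply/colP => i; rewrite !mxE; ring.
  apply: (positive_cone_near pC) => i.
  by rewrite mxE normrM (gtr0_norm k0) [k * _]mulrC; exact: hv'.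
- have -> : k *: ones - (ones + v) = (k - 1) *: ones - v.
    by apply/colP => i; rewrite !mxE; ring.
  apply: (positive_cone_near pC) => i; rewrite mxE normrN.
  by apply: le_lt_trans (hv' i); rewrite ler_peMr//; exact: ltW.
- by rewrite -expRD ltr_expR; move: eps0; lra.
Qed.

Lemma cone_holonomy_discrete : cone_holonomy `<=` isolated cone_holonomy.
Proof.
move=> g Hg; have [A [uA [GA gA]]] := Hg; split; first exact: mem_set.
have [uG G1 GM GV] := mG; have [d d0 dlt] := hilbert_lt_ones_near.
(* The bound 1 will force [k > 0]: [k] times a positive coordinate is then at distance less than 1
   from 1. *)
pose d' := Num.min d 1; have d'0 : 0 < d' by rewrite lt_min d0 ltr01.
(* The free factor [k] makes [Q] invariant under rescaling, so it descends to an open set of [PGL].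
   Its members send the ray of [ones] close to where [A] sends it, and thickness then makes them
   multiples of [A]. *)
pose Q := [set B : 'M[R]_n.+1 | exists2 k : R, k != 0 & forall i,
  `|(k *: (invmx A *m B *m ones)) i 0 - 1| < d'].
have oQ : open Q.
  rewrite openE => B [k k0 hk].
  have E (B' : 'M[R]_n.+1) i : (k *: (invmx A *m B' *m ones)) i 0 =
      k * \sum_j invmx A i j * \sum_l B' j l.
    rewrite mxE -mulmxA mxE; congr (_ * _); apply: eq_bigr => j _.
    by rewrite mxE; congr (_ * _); apply: eq_bigr => l _; rewrite mxE mulr1.
  have cE i : (fun B' : 'M[R]_n.+1 => k * \sum_j invmx A i j * \sum_l B' j l) @ nbhs B
      --> k * \sum_j invmx A i j * \sum_l B j l.
    apply: cvgM; first exact: cvg_cst.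
    apply: (@cvg_big _ _ _ _ _ _ _ (nbhs B)) => [|j _]; first exact: add_continuous.
    apply: cvgM; first exact: cvg_cst.
    apply: (@cvg_big _ _ _ _ _ _ _ (nbhs B)) => [|l _]; first exact: add_continuous.
    exact: coord_continuous.
  have : \forall B' \near nbhs B, forall i,
      `|k * (\sum_j invmx A i j * \sum_l (B' : 'M[R]_n.+1) j l) - 1| < d'.
    apply: filter_forall => i; have := hk i; rewrite E => hki.
    have e0 : 0 < d' - `|k * (\sum_j invmx A i j * \sum_l B j l) - 1| by rewrite subr_gt0.
    move/cvgrPdist_lt : (cE i) => /(_ _ e0); apply: filterS => B' hB'.
    rewrite -[X in `|X|](subrKA (k * (\sum_j invmx A i j * \sum_l B j l))).
    apply: (le_lt_trans (ler_normD _ _)); rewrite distrC.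
    by rewrite -ltrBrDr.
  apply: filterS => B' hB'; exists k => // i; rewrite E; exact: hB'.
pose N := [set h : PGL R n | Q (pgl_mx h)].
have satQ (B : 'M[R]_n.+1) (k : R) : k != 0 -> Q (k *: B) -> Q B.
  move=> k0 [k' k'0 hk']; exists (k' * k); first by rewrite mulf_neq0.
  by move=> i; have := hk' i; rewrite -scalemxAr -scalemxAl scalerA.
have NP (B : 'M[R]_n.+1) (uB : B \in unitmx) : N (pgl_class uB) <-> Q B.
  rewrite /N/=; have [k k0 ->] := pgl_mx_class uB; split; first exact: satQ.
  by move=> QB; apply: (satQ _ k^-1); rewrite ?invr_eq0// scalerK.
have oN : open N.
  apply/(open_vlift _ open_invertible).
  rewrite (_ : vlift N = Q `&` invertible_matrices).
    by apply: openI => //; exact: open_invertible.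
  apply/seteqP; split=> [B NB|B [QB uB]]; last by apply/(vlift_pgl _ uB)/NP.
  have uB : B \in unitmx by case: NB => w <- _; exact: (set_mem (valP w)).
  by split=> //; apply/(NP _ uB)/(vlift_pgl _ uB).
have Ng : N g.
  rewrite -gA; apply/NP; exists 1; first exact: oner_neq0.
  by move=> i; rewrite mulVmx// mul1mx scale1r mxE subrr normr0.
exists N; first exact: open_nbhs_nbhs.
apply/seteqP; split=> [h [Nh [B [uB [GB hB]]]]|_ ->]; last by split.
move: Nh; rewrite -hB => /NP[k k0 hk].
have Cw : C (invmx A *m B *m ones) by apply: CG => //; apply: GM => //; exact: GV.
have kp : 0 < k.
  have := hk 0; rewrite mxE => hk0; have w0 := positive_cone_gt0 pC 0 Cw.
  rewrite -(pmulr_lgt0 _ w0).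
  have : `|k * (invmx A *m B *m ones) 0 0 - 1| < 1.
    by apply: lt_le_trans hk0 _; rewrite ge_min lexx orbT.
  by rewrite ltr_distl => /andP[]; rewrite subrr.
have hlt : hilbert_lt C ones (k *: (invmx A *m B *m ones)) eps.
  rewrite -[X in hilbert_lt _ _ X _](subrKC ones); apply: dlt => i.
  have := hk i; rewrite !mxE => /lt_le_trans; apply.
  by rewrite ge_min lexx.
have hlt' : hilbert_lt C ones (invmx A *m B *m ones) eps.
  by move: hlt; rewrite -{1}[ones]scale1r hilbert_lt_scale.
have [_ _ _ thG _] := mC.
have [c Bc] := thG _ _ (GM _ _ (GV _ GA) GB) C1 (hilbert_lt_refl cC eps0 C1) hlt'.
have Be : B = c *: A by rewrite -(mulKVmx uA B) Bc mul_mx_scalar.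
rewrite -gA; apply/pgl_classP; exists c => //.
by apply/eqP => c0; have := uB; rewrite Be c0 scale0r unitmxE det0 unitr0.
Qed.

Lemma cone_holonomy_torsion (g : PGL R n) k :
  cone_holonomy g -> (0 < k)%N -> (g ^+ k)%g = 1%g -> g = 1%g.
Proof.
move=> [A [uA [GA <-]]] k0; have [uAk ->] := pgl_classX uA k.
move=> /(pgl_class_scalar uAk) Ak; apply/(pgl_class_scalar uA).
by have [_ _ _ _ tfG] := mC; exact: tfG Ak.
Qed.

Lemma homography_cone A (uA : A \in unitmx) v : C v ->
  homography (pgl_class uA) (ray v) = ray (A *m v).
Proof. by move=> /cone_neq0 v0; rewrite homography_ray. Qed.

Lemma cone_holonomy_domain g : cone_holonomy g ->
  homography g @` cone_domain = cone_domain.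
Proof.
move=> [A [uA [GA <-]]]; have [uG _ _ GV] := mG; apply/seteqP; split.
  move=> _ [_ /cone_ray[v Cv <-] <-]; rewrite homography_cone//.
  by apply: ray_cone; exact: CG.
move=> _ /cone_ray[v Cv <-]; have CV := CG (GV _ GA) Cv.
exists (ray (invmx A *m v)); first exact: ray_cone.
by rewrite homography_cone// mulKVmx.
Qed.

Lemma cone_domain_neq0 : cone_domain !=set0.
Proof. by exists (ray ones); exact: ray_cone. Qed.

Lemma cone_domain_convex : properly_convex cone_domain.
Proof.
split; first by move=> p q _; exact: cone_domain_line.
exists sum_coords; last exact: cone_domain_closure.
by apply/eqP => /rowP/(_ 0); rewrite !mxE => /eqP; rewrite oner_eq0.
Qed.

Definition cone_manifold : convex_manifold R n :=
  @ConvexManifold R n cone_domain cone_holonomy cone_domain_neq0 cone_domain_open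
    cone_domain_convex cone_holonomy_group cone_holonomy_discrete
    cone_holonomy_torsion cone_holonomy_domain.

(** The scalar relating two representatives of a holonomy element is positive because both preserve
    [C]; so [G], closed under positive multiples, is recovered exactly. *)
Lemma cone_manifold_matrices : holonomy_matrices cone_manifold sum_coords = G.
Proof.
have [uG _ _ _] := mG.
rewrite /holonomy_matrices/= half_lift_cone_domain; apply/seteqP; split=> A.
  move=> [[uA [B [uB [GB /pgl_classP[k k0 BA]]]]] CA].
  have k'0 : 0 < k^-1.
    apply: (open_coneZ_gt0 cC (CG GB C1)); rewrite scalemxAl BA scalerK//.
    exact: CA.
  rewrite (_ : A = k^-1 *: B); first exact: matrix_groupZ.
  by rewrite BA scalerK.
move=> GA; split; last by move=> v; exact: CG.
by exists (uG _ GA), A, (uG _ GA).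
Qed.

Let Wu : closure (domain cone_manifold) `<=` affine_patch sum_coords.
Proof. exact: cone_domain_closure. Qed.

Lemma cone_manifold_dist a b r : C a -> C b ->
  quotient_dist cone_manifold (Defs.orbit cone_manifold (ray a))
    (Defs.orbit cone_manifold (ray b)) < r <-> quotient_lt C G a b r.
Proof.
move=> Ca Cb; have := @quotient_dist_ray _ _ _ _ Wu a b r.
rewrite cone_manifold_matrices half_lift_cone_domain; exact.
Qed.

(** [embedded_ball] speaks of every lift of the basepoint, whereas thickness is stated at [ones]; a
    lift [A *m ones] is brought back by conjugating the group element with [A]. *)
Lemma cone_manifold_inj :
  (eps%:E <= inj_radius cone_manifold (Defs.orbit cone_manifold (ray ones)))%E.
Proof.
have [uG _ GM GV] := mG; have [_ _ _ thG _] := mC.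
apply: ereal_sup_ubound; exists eps => //; split=> // p.
have orbP v q : C v -> Defs.orbit cone_manifold (ray v) q ->
    exists2 A, G A & q = ray (A *m v).
  move=> Cv [g [A [uA [GA <-]]] <-]; exists A => //; exact: homography_cone.
move=> /(orbP _ _ C1)[A GA ->] b b' /set_mem[Wb hb] /set_mem[Wb' hb'] bb'.
have [v Cv vb] := cone_ray Wb.
have : Defs.orbit cone_manifold b b' by rewrite bb'; exact: Defs.orbit_id.
rewrite -vb => /(orbP _ _ Cv)[B GB b'E].
have CA1 := CG GA C1; have CBv := CG GB Cv.
have distP a c r : C a -> C c ->
    hilbert_dist cone_domain (ray a) (ray c) < r <-> hilbert_lt C a c r.
  move=> Ca Cc; have := @hilbert_dist_ray _ _ cone_manifold _ Wu a c r.
  by rewrite half_lift_cone_domain; exact.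
move: hb hb'; rewrite -vb b'E => /(distP _ _ _ CA1 Cv) h1 /(distP _ _ _ CA1 CBv) h2.
have back w : hilbert_lt C (A *m ones) w eps -> hilbert_lt C ones (invmx A *m w) eps.
  move=> h; rewrite -[ones](mulKmx (uG _ GA)); apply: hilbert_lt_map h => z.
  by apply: CG; exact: GV.
have conjB : invmx A *m B *m A *m (invmx A *m v) = invmx A *m (B *m v).
  by rewrite -!mulmxA (mulmxA A) mulmxV ?uG// mul1mx.
have [c Bc] : exists c : R, invmx A *m B *m A = c%:M.
  apply: (thG _ (invmx A *m v)).
  - by apply: (GM) => //; apply: GM => //; exact: GV.
  - by apply: CG => //; exact: GV.
  - exact: back.
  - by rewrite conjB; exact: back.
have BE : B *m v = c *: v.
  have : A *m (invmx A *m B *m A) *m (invmx A *m v) = B *m v.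
    by rewrite -mulmxA conjB mulKVmx ?uG.
  by rewrite Bc mul_mx_scalar -scalemxAl mulKVmx ?uG.
rewrite BE ray_scale ?cone_neq0//.
by apply: contraTneq (cone_neq0 CBv) => c0; rewrite BE c0 scale0r eqxx.
Qed.

(** For coordinates, [a_i < l b_i] and [b_j < m a_j] with [l m < 1 + e] give
    [a_i b_j <= (1 + e) a_j b_i]; letting [e] tend to 0 makes all coordinate ratios equal. *)
Lemma hilbert_lt_all a b : C a -> C b -> (forall r, 0 < r -> hilbert_lt C a b r) ->
  exists2 k : R, k != 0 & a = k *: b.
Proof.
move=> Ca Cb h; have ap i := positive_cone_gt0 pC i Ca.
have bp i := positive_cone_gt0 pC i Cb.
have cross i j : a i 0 * b j 0 <= a j 0 * b i 0.
  have q0 : 0 < a j 0 * b i 0 by exact: mulr_gt0.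
  apply/ler_addgt0Pr => e' e'0; pose e := e' / (a j 0 * b i 0).
  have e0 : 0 < e by exact: divr_gt0.
  have r0 : 0 < ln (1 + e) by rewrite ln_gt0// ltrDl.
  have [l [m [l0 m0 Cl Cm lm]]] := h _ r0.
  have e1 : 0 < 1 + e by rewrite addr_gt0.
  have {}lm : l * m < 1 + e by move: lm; rewrite lnK.
  have := positive_cone_gt0 pC i Cl; have := positive_cone_gt0 pC j Cm.
  rewrite !mxE !subr_gt0 => h1 h2.
  apply: (@le_trans _ _ (l * b i 0 * (m * a j 0))).
    by apply: ler_pM; rewrite ?ltW.
  have -> : a j 0 * b i 0 + e' = (1 + e) * (a j 0 * b i 0).
    by rewrite mulrDl mul1r /e divfK// gt_eqF.
  by rewrite mulrACA [b i 0 * _]mulrC ler_pM2r//; exact: ltW.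
exists (a 0 0 / b 0 0); first by rewrite mulf_neq0 ?invr_eq0 ?gt_eqF.
apply/colP => i; rewrite mxE mulrAC; apply: (canRL (mulfK _)); first by rewrite gt_eqF.
by apply/eqP; rewrite eq_le !cross.
Qed.

(** The constant family with radii [1 / (k + 1)] along a nonprincipal ultrafilter: [lim_quotient]
    produces one [A] valid for every radius. This separates the points of the quotient metric. *)
Lemma quotient_lt_all a b : C a -> C b -> (forall r, 0 < r -> quotient_lt C G a b r) ->
  exists2 A, G A & a = A *m b.
Proof.
move=> Ca Cb h; have [U [UU Uoo]] := infinitely_many_ultra.
have hU : \forall k \near U, quotient_lt C G a b k.+1%:R^-1.
  by apply: nearW => k; apply: h; rewrite invr_gt0.
have h1 : \forall k \near U, (k.+1%:R^-1 : R) <= 1.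
  by apply: nearW => k; rewrite invf_le1 ?ltr0n// ler1n.
have [A GA hA] := lim_quotient (fun=> mC) mC (cone_lim_cst pC) (group_lim_cst eps0 mC)
  (mxlim_cst a) (mxlim_cst b) Ca Cb hU h1.
have [r r0|k k0 ak] := hilbert_lt_all Ca (CG GA Cb).
  have r2 : 0 < r / 2 by exact: divr_gt0.
  apply: (hA (r / 2)); last by lra.
  have [N hN] : exists N : nat, N.+1%:R^-1 < r / 2.
    by have /ltr_add_invr[N hN] := r2; exists N; rewrite add0r in hN.
  apply: filterS (Uoo N) => k Nk; apply: (le_trans _ (ltW hN)).
  by rewrite lef_pV2 ?posrE// ler_nat.
have k1 : 0 < k by apply: (open_coneZ_gt0 cC (CG GA Cb)); rewrite -ak.
by exists (k *: A); [exact: matrix_groupZ|rewrite -scalemxAl].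
Qed.

Theorem model_manifold : exists (M : convex_manifold R n) P X,
  [/\ points M P, (eps%:E <= inj_radius M P)%E, isometric_to_manifold X M P &
      exists phi : V -> Defs.space X, realizes C G phi].
Proof.
have [uG G1 GM GV] := mG; pose M := cone_manifold.
have ptP Q : points M Q -> exists2 v, C v & Q = Defs.orbit M (ray v).
  by move=> [p /cone_ray[v Cv <-] <-]; exists v.
have P1 : points M (Defs.orbit M (ray ones)).
  by exists (ray ones) => //; exact: ray_cone.
have qpos a b r : C a -> C b -> quotient_lt C G a b r -> 0 < r.
  by move=> Ca Cb [A GA]; apply: (hilbert_lt_gt0 cC); exact: CG.
have dge0 a b : C a -> C b ->
    0 <= quotient_dist M (Defs.orbit M (ray a)) (Defs.orbit M (ray b)).
  move=> Ca Cb; rewrite leNgt; apply/negP => /(cone_manifold_dist _ Ca Cb).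
  by move=> /(qpos _ _ _ Ca Cb); rewrite ltxx.
have [||||X iso] := @isometric_to_manifold_ex R n M _ P1.
- move=> Q /set_mem/ptP[a Ca ->]; apply/eqP; rewrite eq_le dge0// andbT.
  apply/ler_addgt0Pr => r r0; rewrite add0r; apply/ltW/(cone_manifold_dist _ Ca Ca).
  by exists 1%:M; [exact: G1|rewrite mul1mx; exact: hilbert_lt_refl].
- move=> Q S /set_mem/ptP[a Ca ->] /set_mem/ptP[b Cb ->] d0.
  have [|A GA ab] := @quotient_lt_all a b Ca Cb.
    by move=> r r0; apply/cone_manifold_dist => //; rewrite d0.
  apply: Defs.orbit_eq; exists (pgl_class (uG _ GA)).
    by exists A, (uG _ GA).
  by rewrite homography_cone// -ab.
- have sym a b r : C a -> C b -> quotient_lt C G a b r -> quotient_lt C G b a r.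
    move=> Ca Cb [A GA h]; exists (invmx A); first exact: GV.
    apply: hilbert_lt_sym; rewrite -[b](mulKmx (uG _ GA)); apply: hilbert_lt_map h => v.
    by apply: CG; exact: GV.
  have le a b : C a -> C b ->
      quotient_dist M (Defs.orbit M (ray a)) (Defs.orbit M (ray b)) <=
      quotient_dist M (Defs.orbit M (ray b)) (Defs.orbit M (ray a)).
    move=> Ca Cb; apply/ler_addgt0Pr => r r0; apply/ltW/(cone_manifold_dist _ Ca Cb).
    by apply: sym => //; apply/cone_manifold_dist => //; rewrite ltrDl.
  move=> Q S /set_mem/ptP[a Ca ->] /set_mem/ptP[b Cb ->].
  by apply/eqP; rewrite eq_le !le.
- move=> Q S T /set_mem/ptP[a Ca ->] /set_mem/ptP[b Cb ->] /set_mem/ptP[c Cc ->].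
  apply/ler_addgt0Pr => r r0; have r2 : 0 < r / 2 by exact: divr_gt0.
  apply/ltW/(cone_manifold_dist _ Ca Cc).
  set x := quotient_dist _ _ _; set y := quotient_dist _ _ _.
  have [A GA hA] : quotient_lt C G a b (x + r / 2).
    by apply/cone_manifold_dist => //; rewrite ltrDl.
  have [B GB hB] : quotient_lt C G b c (y + r / 2).
    by apply/cone_manifold_dist => //; rewrite ltrDl.
  exists (A *m B); first exact: GM.
  have -> : x + y + r = (x + r / 2) + (y + r / 2) by lra.
  apply: (hilbert_lt_trans cC hA); rewrite -mulmxA; apply: hilbert_lt_map hB => v.
  exact: CG.
exists M, (Defs.orbit M (ray ones)), X; split=> //; first exact: cone_manifold_inj.
have C1' : half_lift sum_coords (domain M) ones by rewrite half_lift_cone_domain.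
have [phi [sur base distP]] := manifold_realizes Wu C1' iso.
exists phi; move: sur distP.
by rewrite cone_manifold_matrices half_lift_cone_domain.
Qed.

End ModelManifold.

(** * Compactness *)

Theorem theorem0p14 (R : realType) (n : nat) (eps : R) (eps_gt0 : 0 < eps) :
  compact (@thick_classes R n eps).
Proof.
rewrite /thick_classes; set S := [set X | _].
(* The set of classes is the continuous image of a set of pointed spaces, so compactness is proved
   upstairs. *)
apply: continuous_compact.
  by apply: continuous_subspaceT; exact: pi_continuous.
rewrite compact_ultra => F UF FS.
have [X0 SX0] := filter_ex FS; pose rho : R := (4 * n.+1%:R)^-1.
have modS X : S X -> exists CG : set 'cV[R]_n.+1 * set 'M[R]_n.+1,
    model rho eps CG.1 CG.2 /\
    exists phi : 'cV[R]_n.+1 -> Defs.space X, realizes CG.1 CG.2 phi.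
  move=> [M [P [MP inj iso]]].
  have [C [G [phi [mCG rX]]]] := manifold_model MP inj iso.
  by exists (C, G); split=> //; exists phi.
(* Limits are taken over families of models indexed by all pointed spaces; those outside [S] receive
   the model of [X0], which does not affect anything near [F]. *)
have /choice[CG hCG] : forall X, exists CG : set 'cV[R]_n.+1 * set 'M[R]_n.+1,
    model rho eps CG.1 CG.2 /\
    (S X -> exists phi : 'cV[R]_n.+1 -> Defs.space X, realizes CG.1 CG.2 phi).
  move=> X; have [/modS[CG [? ?]]|nSX] := pselect (S X); first by exists CG.
  by have [CG [? _]] := modS _ SX0; exists CG.
have mX X : model rho eps (CG X).1 (CG X).2 by case: (hCG X).
have pX X : positive_cone rho (CG X).1 by case: (mX X).
pose C := limit_cone F (fun X => (CG X).1); pose G := limit_group F (fun X => (CG X).2).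
have mL : model (rho / 2) eps C G by exact: limit_model.
have [M [P [L [MP inj iso [psi rL]]]]] := model_manifold eps_gt0 mL.
exists L; split; first by exists M, P.
move=> B; rewrite -nbhs_entourageE => -[E [e e0 eE] EB].
have near_real : \forall X \near F, exists phi : 'cV[R]_n.+1 -> Defs.space X,
    realizes (CG X).1 (CG X).2 phi.
  by apply: filterS FS => X SX; case: (hCG X) => _; apply.
have lC : cone_lim F (fun X => (CG X).1) C by exact: limit_coneP pX.
have lG : group_lim F (fun X => (CG X).2) G by exact: limit_groupP.
apply: filterS (gh_close_limit mL eps_gt0 mX lC lG near_real rL e0) => X.
move=> /gh_close_sym cX; apply: EB.
by apply/xsectionP; exact: eE.
Qed.
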